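(* $\mathsf{RCA}_0$ proves: if every positive $\Pi^0_2$ set contains a perfect subset, then $\mathsf{TT}^1$ holds.
   Context: $\mathsf{RCA}_0$ is the usual base theory of reverse mathematics (second-order arithmetic with $\Delta^0_1$-comprehension and $\Sigma^0_1$-induction). All notions are interpreted in second-order arithmetic, with set parameters allowed. A $\Pi^0_2$ set is a class $A = \bigcap_k U_k$, where $(U_k)_{k \in \mathbb{N}}$ is a (coded) sequence of open subsets of $2^{\mathbb{N}}$, each $U_k$ coded by a set $O_k \subseteq 2^{<\mathbb{N}}$ with $U_k = \{X : \exists n\, (X \upharpoonright n \in O_k)\}$. It is positive if it has positive outer measure, in the sense that there is a rational $\delta > 0$ such that for all $k$ the open set $U_0 \cap \dots \cap U_k$ has measure greater than $\delta$; here an open set has measure greater than $\delta$ if there is a finite prefix-free set $D$ of strings with $\sum_{\sigma \in D} 2^{-|\sigma|} > \delta$ such that each $\sigma \in D$ extends (or equals) an element of the code of the open set (for $U_0 \cap \dots \cap U_k$: for each $j \le k$, $\sigma$ has an initial segment in $O_j$). The class $A$ contains a perfect subset if there exists a nonempty tree $T \subseteq 2^{<\mathbb{N}}$ (closed under initial segments) in which every node has two incomparable extensions in $T$ and such that every infinite path through $T$ belongs to $A$. $\mathsf{TT}^1$ is the statement: for every $n$ and every coloring $f: 2^{<\mathbb{N}} \to \{0, \dots, n-1\}$ there is an $f$-homogeneous perfect tree, i.e. a subset $S \subseteq 2^{<\mathbb{N}}$ such that $S$, ordered by the initial segment relation, is isomorphic to $2^{<\mathbb{N}}$ and $f$ is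 constant on $S$ ($S$ need not be closed under initial segments). *)

(* Defs.v *)
From Stdlib Require Import List.

(** * The language of second-order arithmetic

    Two-sorted de Bruijn syntax: number variables and set variables are indexed
    independently of each other.  The only set terms are variables, and equality
    is primitive for numbers only.  The remaining connectives and the
    existential quantifiers are classical abbreviations. *)

Inductive term : Type :=
| Var (x : nat)
| Zero
| One
| Plus (s t : term)
| Times (s t : term).

Inductive form : Type :=
| Eq (s t : term)
| Lt (s t : term)
| In (t : term) (X : nat)
| Bot
| Imp (A B : form)
| AllN (A : form)
| AllS (A : form).

Definition Neg A := Imp A Bot.
Definition And A B := Neg (Imp A (Neg B)).
Definition Or A B := Imp (Neg A) B.
Definition Iff A B := And (Imp A B) (Imp B A).
Definition ExN A := Neg (AllN (Neg A)).
Definition ExS A := Neg (AllS (Neg A)).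

Fixpoint tsubst (f : nat -> term) (t : term) : term :=
  match t with
  | Var x => f x
  | Zero => Zero
  | One => One
  | Plus s t => Plus (tsubst f s) (tsubst f t)
  | Times s t => Times (tsubst f s) (tsubst f t)
  end.

Definition tshift : term -> term := tsubst (fun x => Var (S x)).

Definition scons {A : Type} (a : A) (f : nat -> A) (n : nat) : A :=
  match n with 0 => a | S m => f m end.

Definition up_num (f : nat -> term) : nat -> term :=
  scons (Var 0) (fun n => tshift (f n)).

Definition up_set (r : nat -> nat) : nat -> nat :=
  scons 0 (fun n => S (r n)).

(** Simultaneous substitution of terms for number variables and of set
    variables for set variables. *)
Fixpoint subst (f : nat -> term) (r : nat -> nat) (A : form) : form :=
  match A with
  | Eq s t => Eq (tsubst f s) (tsubst f t)
  | Lt s t => Lt (tsubst f s) (tsubst f t)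
  | In t X => In (tsubst f t) (r X)
  | Bot => Bot
  | Imp A B => Imp (subst f r A) (subst f r B)
  | AllN A => AllN (subst (up_num f) r A)
  | AllS A => AllS (subst f (up_set r) A)
  end.

Definition shift_num : form -> form := subst (fun x => Var (S x)) (fun X => X).
Definition shift_set : form -> form := subst Var S.
Definition inst_num (t : term) : form -> form := subst (scons t Var) (fun X => X).
Definition inst_set (X : nat) : form -> form := subst Var (scons X (fun Y => Y)).

(** * Classical two-sorted natural deduction with equality

    [Ax] is a set of axioms whose free variables are read universally: the
    eigenvariable conditions in [prv_AllNI] and [prv_AllSI] concern the
    hypotheses in [G] only. *)

Inductive prv (Ax : form -> Prop) : list form -> form -> Prop :=
| prv_Ax G A : Ax A -> prv Ax G A
| prv_Hyp G A : List.In A G -> prv Ax G A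
| prv_ImpI G A B : prv Ax (A :: G) B -> prv Ax G (Imp A B)
| prv_ImpE G A B : prv Ax G (Imp A B) -> prv Ax G A -> prv Ax G B
| prv_RAA G A : prv Ax (Neg A :: G) Bot -> prv Ax G A
| prv_AllNI G A : prv Ax (map shift_num G) A -> prv Ax G (AllN A)
| prv_AllNE G A t : prv Ax G (AllN A) -> prv Ax G (inst_num t A)
| prv_AllSI G A : prv Ax (map shift_set G) A -> prv Ax G (AllS A)
| prv_AllSE G A X : prv Ax G (AllS A) -> prv Ax G (inst_set X A)
| prv_EqI G t : prv Ax G (Eq t t)
| prv_EqE G A s t :
    prv Ax G (Eq s t) -> prv Ax G (inst_num s A) -> prv Ax G (inst_num t A).

Definition proves (Ax : form -> Prop) (A : form) : Prop := prv Ax nil A.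

(** * The theory RCA_0 *)

(** Bounded formulas; set variables may occur as parameters.  The bound [t] is
    shifted, so that it does not contain the quantified variable.  Bounded
    existential quantifiers are covered as negations of bounded universal ones. *)
Inductive Sigma00 : form -> Prop :=
| S00_Eq s t : Sigma00 (Eq s t)
| S00_Lt s t : Sigma00 (Lt s t)
| S00_In t X : Sigma00 (In t X)
| S00_Bot : Sigma00 Bot
| S00_Imp A B : Sigma00 A -> Sigma00 B -> Sigma00 (Imp A B)
| S00_All t A : Sigma00 A -> Sigma00 (AllN (Imp (Lt (Var 0) (tshift t)) A)).

Inductive Sigma01 : form -> Prop :=
| S01_Ex A : Sigma00 A -> Sigma01 (ExN A).

Inductive Pi01 : form -> Prop :=
| P01_All A : Sigma00 A -> Pi01 (AllN A).

(** [A(x+1)], where [x] is the number variable of index 0. *)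
Definition at_succ : form -> form :=
  subst (scons (Plus (Var 0) One) (fun x => Var (S x))) (fun X => X).

Definition induction (A : form) : form :=
  Imp (inst_num Zero A) (Imp (AllN (Imp A (at_succ A))) (AllN A)).

(** In both [A] and [B] the number variable of index 0 is the element variable;
    [shift_set] ensures that the set being defined does not occur in [A]. *)
Definition comprehension (A B : form) : form :=
  Imp (AllN (Iff A B)) (ExS (AllN (Iff (In (Var 0) 0) (shift_set A)))).

Inductive RCA0 : form -> Prop :=
| succ_neq_0 s : RCA0 (Neg (Eq (Plus s One) Zero))
| succ_inj s t : RCA0 (Imp (Eq (Plus s One) (Plus t One)) (Eq s t))
| plus_0 s : RCA0 (Eq (Plus s Zero) s)
| plus_succ s t : RCA0 (Eq (Plus s (Plus t One)) (Plus (Plus s t) One))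
| times_0 s : RCA0 (Eq (Times s Zero) Zero)
| times_succ s t : RCA0 (Eq (Times s (Plus t One)) (Plus (Times s t) s))
| lt_0 s : RCA0 (Neg (Lt s Zero))
| lt_succ s t : RCA0 (Iff (Lt s (Plus t One)) (Or (Lt s t) (Eq s t)))
| Sigma01_induction A : Sigma01 A -> RCA0 (induction A)
| Delta01_comprehension A B :
    Sigma01 A -> Pi01 B -> RCA0 (comprehension A B).

(** * Writing formulas with named variables

    An open expression is a function of the numbers of number and set
    quantifiers in whose scope it is placed.  A bound variable remembers its de
    Bruijn level and is converted to an index at each occurrence, so that Rocq
    binders can be used for the quantifiers and no shifting is needed. *)

Definition oterm : Type := nat -> term.
Definition oset : Type := nat -> nat.
Definition oform : Type := nat -> nat -> form.

Definition close (A : oform) : form := A 0 0.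

Definition o_zero : oterm := fun _ => Zero.
Definition o_one : oterm := fun _ => One.
Definition o_plus (s t : oterm) : oterm := fun d => Plus (s d) (t d).
Definition o_times (s t : oterm) : oterm := fun d => Times (s d) (t d).
Definition o_eq (s t : oterm) : oform := fun d _ => Eq (s d) (t d).
Definition o_lt (s t : oterm) : oform := fun d _ => Lt (s d) (t d).
Definition o_in (t : oterm) (X : oset) : oform := fun d e => In (t d) (X e).
Definition o_neg (A : oform) : oform := fun d e => Neg (A d e).
Definition o_and (A B : oform) : oform := fun d e => And (A d e) (B d e).
Definition o_or (A B : oform) : oform := fun d e => Or (A d e) (B d e).
Definition o_imp (A B : oform) : oform := fun d e => Imp (A d e) (B d e).
Definition o_iff (A B : oform) : oform := fun d e => Iff (A d e) (B d e).
Definition o_all (A : oterm -> oform) : oform :=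
  fun d e => AllN (A (fun d' => Var (d' - S d)) (S d) e).
Definition o_ex (A : oterm -> oform) : oform :=
  fun d e => ExN (A (fun d' => Var (d' - S d)) (S d) e).
Definition o_allS (A : oset -> oform) : oform :=
  fun d e => AllS (A (fun e' => e' - S e) d (S e)).
Definition o_exS (A : oset -> oform) : oform :=
  fun d e => ExS (A (fun e' => e' - S e) d (S e)).

Declare Scope L2_scope.
Delimit Scope L2_scope with L2.

Reserved Notation "x \in X" (at level 70, no associativity).
Reserved Notation "A ==> B" (at level 99, right associativity, B at level 200).
Reserved Notation "'all' x .. y , A"
  (at level 200, x binder, y binder, right associativity).
Reserved Notation "'ex' x .. y , A"
  (at level 200, x binder, y binder, right associativity).
Reserved Notation "'allS' X .. Y , A"
  (at level 200, X binder, Y binder, right associativity).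
Reserved Notation "'exS' X .. Y , A"
  (at level 200, X binder, Y binder, right associativity).

Notation "0" := o_zero : L2_scope.
Notation "1" := o_one : L2_scope.
Notation "2" := (o_plus o_one o_one) : L2_scope.
Notation "s + t" := (o_plus s t) : L2_scope.
Notation "s * t" := (o_times s t) : L2_scope.
Notation "s = t" := (o_eq s t) : L2_scope.
Notation "s < t" := (o_lt s t) : L2_scope.
Notation "s <= t" := (o_or (o_lt s t) (o_eq s t)) : L2_scope.
Notation "t \in X" := (o_in t X) : L2_scope.
Notation "~ A" := (o_neg A) : L2_scope.
Notation "A /\ B" := (o_and A B) : L2_scope.
Notation "A \/ B" := (o_or A B) : L2_scope.
Notation "A ==> B" := (o_imp A B) : L2_scope.
Notation "A <-> B" := (o_iff A B) : L2_scope.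
Notation "'all' x .. y , A" := (o_all (fun x => .. (o_all (fun y => A)) ..)) : L2_scope.
Notation "'ex' x .. y , A" := (o_ex (fun x => .. (o_ex (fun y => A)) ..)) : L2_scope.
Notation "'allS' X .. Y , A" := (o_allS (fun X => .. (o_allS (fun Y => A)) ..)) : L2_scope.
Notation "'exS' X .. Y , A" := (o_exS (fun X => .. (o_exS (fun Y => A)) ..)) : L2_scope.

(** * Coding of finite objects by numbers *)

(** Simpson's pairing [(i,j) = (i+j)^2 + i], which is injective. *)
Definition pair (i j : oterm) : oterm := ((i + j) * (i + j) + i)%L2.

(** [a mod m = y] *)
Definition Rem (a m y : oterm) : oform :=
  (y < m /\ ex q, a = q * m + y)%L2.

(** A number [(l,(a,b))] codes the sequence of length [l] whose [i]-th entry is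
    Goedel's [beta(a,b,i) = a mod (b(i+1)+1)]. *)
Definition Len (s l : oterm) : oform :=
  (ex a b, s = pair l (pair a b))%L2.

Definition Entry (s i y : oterm) : oform :=
  (ex l a b, s = pair l (pair a b) /\ i < l /\ Rem a (b * (i + 1) + 1) y)%L2.

Definition SameSeq (s t : oterm) : oform :=
  (ex l, Len s l /\ Len t l /\ all i y, Entry s i y <-> Entry t i y)%L2.

(** Only the least code of a sequence is used as an element of the set of
    sequences, so that equality of sequences is equality of numbers. *)
Definition Seq (s : oterm) : oform :=
  ((ex l, Len s l) /\ all t, t < s ==> ~ SameSeq t s)%L2.

(** [s] belongs to [2^{<N}]. *)
Definition Str (s : oterm) : oform :=
  (Seq s /\ all i y, Entry s i y ==> y < 2)%L2.

(** [s] is an initial segment of [t], or equal to it. *)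
Definition Prefix (s t : oterm) : oform :=
  (Str s /\ Str t /\ all i y, Entry s i y ==> Entry t i y)%L2.

Definition Incomparable (s t : oterm) : oform :=
  (~ Prefix s t /\ ~ Prefix t s)%L2.

(** A finite set [D] of numbers is coded by the string of values of its
    characteristic function on an interval [0, l) that contains it. *)
Definition FinSet (D : oterm) : oform := Str D.

Definition Mem (x D : oterm) : oform := Entry D x 1%L2.

(** * Measure of open sets *)

(** [2^n = y] *)
Definition Pow2 (n y : oterm) : oform :=
  (ex s, Entry s 0 1 /\
     (all i u, i < n ==> Entry s i u ==> Entry s (i + 1) (2 * u)) /\
     Entry s n y)%L2.

(** [sum_{x in D} 2^{-|x|} > p/q].  The sum is computed over a common
    denominator [z = 2^L]: [s] is the sequence of the partial sums of the
    numerators [w = 2^{L-|x|}]; their existence forces [|x| <= L] for [x] in [D]. *)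
Definition WeightGt (D p q : oterm) : oform :=
  (ex L z s, Pow2 L z /\
     Entry s 0 0 /\
     (all x l u, Len D l ==> x < l ==> Entry s x u ==>
        (Mem x D ==> ex h y w,
           Len x h /\ Pow2 h y /\ w * y = z /\ Entry s (x + 1) (u + w)) /\
        (~ Mem x D ==> Entry s (x + 1) u)) /\
     (ex l v, Len D l /\ Entry s l v /\ p * z < q * v))%L2.

Definition PrefixFree (D : oterm) : oform :=
  (all x y, Mem x D ==> Mem y D ==> Prefix x y ==> x = y)%L2.

(** * Pi^0_2 classes

    A sequence [(O_k)] of sets of strings is a set [O] with
    [O_k = {x : (k,x) in O}].  Points of Cantor space are sets of numbers,
    identified with their characteristic functions. *)

Definition OpenCodes (O : oset) : oform :=
  (all k x, pair k x \in O ==> Str x)%L2.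

(** [x] is the restriction of [X] to the first [n] values. *)
Definition Restr (X : oset) (n x : oterm) : oform :=
  (Str x /\ Len x n /\ all i, i < n ==> (Entry x i 1 <-> i \in X))%L2.

(** [X] belongs to the open set [U_k]. *)
Definition InOpen (X O : oset) (k : oterm) : oform :=
  (ex n x, Restr X n x /\ pair k x \in O)%L2.

(** [X] belongs to the intersection of all [U_k]. *)
Definition InPi02 (X O : oset) : oform :=
  (all k, InOpen X O k)%L2.

(** The intersection of [U_0, ..., U_k] has measure greater than [p/q]. *)
Definition InterMeasureGt (O : oset) (k p q : oterm) : oform :=
  (ex D, FinSet D /\ (all x, Mem x D ==> Str x) /\ PrefixFree D /\
     WeightGt D p q /\
     (all x j, Mem x D ==> j <= k ==>
        ex y, Prefix y x /\ pair j y \in O))%L2.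

Definition Positive (O : oset) : oform :=
  (ex p q, 0 < p /\ 0 < q /\ all k, InterMeasureGt O k p q)%L2.

Definition Tree (T : oset) : oform :=
  ((all x, x \in T ==> Str x) /\
   (all x y, x \in T ==> Prefix y x ==> y \in T))%L2.

Definition Perfect (T : oset) : oform :=
  (all x, x \in T ==> ex y z, y \in T /\ z \in T /\
     Prefix x y /\ Prefix x z /\ Incomparable y z)%L2.

Definition Path (X T : oset) : oform :=
  (all n x, Restr X n x ==> x \in T)%L2.

Definition ContainsPerfect (O : oset) : oform :=
  (exS T, (ex x, x \in T) /\ Tree T /\ Perfect T /\
     (allS X, Path X T ==> InPi02 X O))%L2.

Definition PositivePi02HasPerfectSubset : oform :=
  (allS O, OpenCodes O ==> Positive O ==> ContainsPerfect O)%L2.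

(** * The tree theorem for singletons *)

(** [g] is (the graph of) a function from [P] to [Q]. *)
Definition Fun (g : oset) (P Q : oterm -> oform) : oform :=
  ((all z, z \in g ==> ex x y, z = pair x y /\ P x /\ Q y) /\
   (all x, P x ==> ex y, pair x y \in g) /\
   (all x y y', pair x y \in g ==> pair x y' \in g ==> y = y'))%L2.

(** [g] is an isomorphism from [2^{<N}] to [S], both ordered by [Prefix]. *)
Definition IsoToFull (g S : oset) : oform :=
  (Fun g Str (fun y => y \in S) /\
   (all x x' y, pair x y \in g ==> pair x' y \in g ==> x = x') /\
   (all y, y \in S ==> ex x, pair x y \in g) /\
   (all x x' y y', pair x y \in g ==> pair x' y' \in g ==>
      (Prefix x x' <-> Prefix y y')))%L2.

Definition PerfectlyHomogeneous (S f : oset) : oform :=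
  ((all x, x \in S ==> Str x) /\
   (exS g, IsoToFull g S) /\
   (ex c, all x, x \in S ==> pair x c \in f))%L2.

Definition TT1 : oform :=
  (all n, allS f, Fun f Str (fun c => c < n) ==>
     exS S, PerfectlyHomogeneous S f)%L2.

(* Main.v *)
Module Models.
From HB Require Import structures.
From Stdlib Require Import Ring_theory Ring.
From mathcomp Require Import ssreflect ssrfun ssrbool eqtype choice order ssralg ssrnum.
From mathcomp Require Import boolp lra.
Import GRing.Theory Num.Theory Order.TTheory.
Set Implicit Arguments. Unset Strict Implicit. Unset Printing Implicit Defensive.

(** The provability claim is reduced to a mathematical one by the completeness theorem: a
    sentence that holds in every model of the axioms, with an arbitrary collection of sets as
    second sort, is derivable ([completeness]).  So fix a model, possibly nonstandard, in which
    every positive class contains a perfect subset, and a coloring [f] of its binary strings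
    with [n] colors ([model_TT1]).

    Some color is seen infinitely often along a set of paths of positive measure, but which one
    cannot be determined without a form of collection that the base theory lacks.  The remedy
    is to let each path announce its color.  Write [c^Y] for the path that begins with the
    one-hot code of [c], of length [n], and continues with [Y].  The class of all [c^Y] such
    that [f] takes the value [c] on infinitely many initial segments of [Y] is the intersection
    of the open sets [U_k] generated by the strings [c^s] with [k <= |s|] and [f(s) = c].  The
    map that sends [s] to [f(s)^s] shows that [U_k] contains the cones of [2^k] strings of
    length [n + k], so every [U_k] has measure at least [2^-n], with no appeal to collection
    ([class_positive]).

    Let [T] be a perfect tree all of whose paths lie in this class.  One path of [T] yields a
    node that has announced a color [c].  Every node [y] of [T] above it lies on a path, which
    passes through nodes [c^s] with [s] of color [c] and arbitrarily long ([colored_node]).  So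
    the full binary tree embeds into [T] by alternately splitting and extending to such a node.
    Deleting the first [n] entries gives the homogeneous tree ([homogeneous]).  Making the
    image of each string longer than the code of that string makes the range of the embedding
    a set of the model.

    All of this takes place in a model of Sigma^0_1 induction.  Definability is handled by
    closure properties of the Delta^0_1 relations and of the total functions with Sigma^0_1
    graph (tactic [defn]), finite sequences by the beta function ([beta_exists]), and linear
    arithmetic by passing to the ordered ring of differences, where [lra] applies (tactic
    [arith]). *)

(** * Discretely ordered semirings and the rings of their differences *)

(** These axioms make the carrier the nonnegative part of a discretely ordered ring, which is
    rebuilt below as the ring of differences. *)
Record arith : Type := Arith {
  num :> Type;
  nzero : num; none : num;
  nadd : num -> num -> num;
  nmul : num -> num -> num;
  nlt : num -> num -> Prop;
  naddC : forall x y, nadd x y = nadd y x;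
  naddA : forall x y z, nadd x (nadd y z) = nadd (nadd x y) z;
  nadd0 : forall x, nadd nzero x = x;
  naddI : forall x y z, nadd z x = nadd z y -> x = y;
  nmulC : forall x y, nmul x y = nmul y x;
  nmulA : forall x y z, nmul x (nmul y z) = nmul (nmul x y) z;
  nmul0 : forall x, nmul nzero x = nzero;
  nmul1 : forall x, nmul none x = x;
  nmulD : forall x y z, nmul (nadd x y) z = nadd (nmul x z) (nmul y z);
  nsucc_neq0 : forall x, nadd x none <> nzero;
  nltE : forall x y, nlt x y <-> exists z, y = nadd (nadd x z) none;
  ntotal : forall x y, nlt x y \/ x = y \/ nlt y x }.

Arguments nzero {a}. Arguments none {a}.

Declare Scope num_scope.
Delimit Scope num_scope with num.
Bind Scope num_scope with num.

Definition nle (A : arith) (x y : A) := nlt x y \/ x = y.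

Notation "0" := nzero : num_scope.
Notation "1" := none : num_scope.
Notation "x + y" := (nadd x y) : num_scope.
Notation "x * y" := (nmul x y) : num_scope.
Notation "x < y" := (nlt x y) : num_scope.
Notation "x <= y" := (nle x y) : num_scope.

Section Differences.
Variable A : arith.
Implicit Types x y z : A.
Local Open Scope num_scope.

Lemma num_semiring :
  semi_ring_theory (@nzero A) (@none A) (@nadd A) (@nmul A) (@eq A).
Proof.
split; first [exact: nadd0 | exact: naddC | exact: naddA | exact: nmul1
  | exact: nmul0 | exact: nmulC | exact: nmulA | exact: nmulD].
Qed.
Add Ring num_ring : num_semiring.

Lemma nlt_irr x : ~ x < x.
Proof.
rewrite nltE => -[z e]; apply: (@nsucc_neq0 A z); apply: (@naddI A _ _ x).
by rewrite naddA -e; ring.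
Qed.

Lemma nlt_trans x y z : x < y -> y < z -> x < z.
Proof.
rewrite !nltE => -[u ->] [v ->]; exists (u + 1 + v); ring.
Qed.

Lemma nleE x y : x <= y <-> exists z, y = x + z.
Proof.
split=> [[|->]|[z ->]].
- by rewrite nltE => -[u ->]; exists (u + 1); ring.
- by exists 0; ring.
- have [|[<-|]] := ntotal 0 z; rewrite ?nltE.
  + by move=> [u ->]; left; rewrite nltE; exists u; ring.
  + by right; ring.
  + by move=> [u e]; case: (@nsucc_neq0 A (z + u)); rewrite -e.
Qed.

Lemma nle_total x y : x <= y \/ y <= x.
Proof. by rewrite /nle; have [|[|]] := ntotal x y; auto. Qed.

Lemma nle_anti x y : x <= y -> y <= x -> x = y.
Proof.
move=> [h [h'|//]|//]; by case: (nlt_irr (nlt_trans h h')).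
Qed.

Lemma nle_add2 x y z : z + x <= z + y <-> x <= y.
Proof.
rewrite !nleE; split=> -[u e]; exists u; last by rewrite e; ring.
by apply: (@naddI A _ _ z); rewrite e; ring.
Qed.

Lemma nmul_eq0 x y : x * y = 0 -> x = 0 \/ y = 0.
Proof.
have pos z : z = 0 \/ exists u, z = u + 1.
  have [|[<-|]] := ntotal 0 z; rewrite ?nltE; [|by left|].
  - by move=> [u ->]; right; exists u; ring.
  - by move=> [u e]; case: (@nsucc_neq0 A (z + u)); rewrite -e.
case: (pos x) => [|[u ->]]; first by left.
case: (pos y) => [|[v ->] e]; first by right.
by case: (@nsucc_neq0 A (u * v + u + v)); rewrite -e; ring.
Qed.

(** Differences are pairs (a, b), standing for [a - b], up to equality of cross sums;
    a class is represented by its characteristic predicate. *)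
Definition cross (p q : A * A) : Prop := p.1 + q.2 = q.1 + p.2.
Definition diff : Type := {c : A * A -> Prop | exists p, c = cross p}.
HB.instance Definition _ := gen_eqMixin diff.
HB.instance Definition _ := gen_choiceMixin diff.
Definition mk (p : A * A) : diff := exist _ (cross p) (ex_intro _ p erefl).
Definition repr (d : diff) : A * A := sval (cid (svalP d)).

Lemma cross_repr d : sval d = cross (repr d).
Proof. exact: (svalP (cid (svalP d))). Qed.

Lemma mk_repr d : mk (repr d) = d.
Proof.
by move: (cross_repr d); case: d => c cP /= h; apply: eq_exist.
Qed.

Lemma mk_eq p q : mk p = mk q <-> cross p q.
Proof.
split=> [[]|e].
  by move/(congr1 (@^~ q)) => ->.
rewrite /mk; apply: eq_exist; apply: funext => r; apply: propext.
rewrite /cross in e *; split=> h.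
- apply: (@naddI A _ _ p.2); transitivity (q.1 + p.2 + r.2); first ring.
  by rewrite -e; transitivity (p.1 + r.2 + q.2); [ring|rewrite h; ring].
- apply: (@naddI A _ _ q.2); transitivity (p.1 + q.2 + r.2); first ring.
  by rewrite e; transitivity (q.1 + r.2 + p.2); [ring|rewrite h; ring].
Qed.

Lemma diffP d : exists p, d = mk p.
Proof. by exists (repr d); rewrite mk_repr. Qed.

Definition diff_zero := mk (0, 0).
Definition diff_one := mk (1, 0).
Definition diff_add d e :=
  mk ((repr d).1 + (repr e).1, (repr d).2 + (repr e).2).
Definition diff_opp d := mk ((repr d).2, (repr d).1).
Definition diff_mul d e :=
  let: (p, q) := (repr d, repr e) in
  mk (p.1 * q.1 + p.2 * q.2, p.1 * q.2 + p.2 * q.1).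
Definition diff_le d e : bool :=
  `[< (repr d).1 + (repr e).2 <= (repr e).1 + (repr d).2 >].

Lemma repr_mk p : cross (repr (mk p)) p.
Proof. by apply/mk_eq; rewrite mk_repr. Qed.

Lemma mk_add p q : diff_add (mk p) (mk q) = mk (p.1 + q.1, p.2 + q.2).
Proof.
have := repr_mk p; have := repr_mk q; rewrite /diff_add /cross.
case: (repr _) => a b; case: (repr _) => c d /= h h'.
apply/mk_eq; rewrite /cross /=; transitivity (c + p.2 + (a + q.2)); first ring.
by rewrite h h'; ring.
Qed.

Lemma mk_opp p : diff_opp (mk p) = mk (p.2, p.1).
Proof.
have := repr_mk p; rewrite /diff_opp /cross; case: (repr _) => a b /= h.
by apply/mk_eq; rewrite /cross /= naddC -h naddC.
Qed.

Lemma mk_mul p q :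
  diff_mul (mk p) (mk q) = mk (p.1 * q.1 + p.2 * q.2, p.1 * q.2 + p.2 * q.1).
Proof.
have := repr_mk p; have := repr_mk q; rewrite /diff_mul /cross.
case: (repr _) => a b; case: (repr _) => c d; case: p q => [p p'] [q q'] /= h h'.
transitivity (mk (c * q + d * q', c * q' + d * q)); apply/mk_eq; rewrite /cross /=.
- transitivity (c * (a + q') + d * (q + b)); first ring.
  by rewrite h -{2}h; ring.
- transitivity (q * (c + p') + q' * (p + d)); first ring.
  by rewrite h' -{2}h'; ring.
Qed.

Lemma mk_le p q : diff_le (mk p) (mk q) = `[< p.1 + q.2 <= q.1 + p.2 >].
Proof.
have := repr_mk p; have := repr_mk q; rewrite /diff_le /cross.
case: (repr _) => a b; case: (repr _) => c d; case: p q => [p p'] [q q'] /= h h'.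
apply: asbool_equiv_eq.
rewrite -(nle_add2 _ _ (p' + q')) -(nle_add2 (p + q') _ (b + d)).
rewrite (_ : p' + q' + (c + b) = c + p' + (q' + b)); last ring.
rewrite (_ : p' + q' + (a + d) = a + q' + (p' + d)); last ring.
by rewrite h h' (_ : p + d + (q' + b) = b + d + (p + q')) //; [
  rewrite (_ : q + b + (p' + d) = b + d + (q + p')) //; ring|ring].
Qed.

Ltac lift_diff :=
  repeat (let d := fresh in let p := fresh in let p' := fresh in
    move=> d; case: (diffP d) => -[p p'] -> {d});
  rewrite /diff_zero /diff_one ?(mk_add, mk_opp, mk_mul, mk_le) /=.
Ltac diff_ring := lift_diff; apply/mk_eq; rewrite /cross /=; ring.

Lemma diff_addA : associative diff_add. Proof. diff_ring. Qed.
Lemma diff_addC : commutative diff_add. Proof. diff_ring. Qed.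
Lemma diff_add0 : left_id diff_zero diff_add. Proof. diff_ring. Qed.
Lemma diff_addN : left_inverse diff_zero diff_opp diff_add.
Proof. diff_ring. Qed.
Lemma diff_mulA : associative diff_mul. Proof. diff_ring. Qed.
Lemma diff_mulC : commutative diff_mul. Proof. diff_ring. Qed.
Lemma diff_mul1 : left_id diff_one diff_mul. Proof. diff_ring. Qed.
Lemma diff_mulD : left_distributive diff_mul diff_add. Proof. diff_ring. Qed.
Lemma diff_one_neq0 : diff_one != diff_zero.
Proof.
apply/eqP => /mk_eq; rewrite /cross /= => e; case: (@nsucc_neq0 A 0).
by transitivity (1 + 0 : A); [ring|rewrite e; ring].
Qed.

Definition diff_unit (d : diff) : bool := `[< exists e, diff_mul e d = diff_one >].
Definition diff_inv (d : diff) : diff :=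
  if pselect (exists e, diff_mul e d = diff_one) is left h
  then sval (cid h) else d.

Lemma diff_mulV : {in diff_unit, left_inverse diff_one diff_inv diff_mul}.
Proof.
move=> d /asboolP h; rewrite /diff_inv; case: pselect => // h'.
by case: (cid h').
Qed.
Lemma diff_unitP d e : diff_mul e d = diff_one -> diff_unit d.
Proof. by move=> h; apply/asboolP; exists e. Qed.
Lemma diff_inv_out : {in [predC diff_unit], diff_inv =1 id}.
Proof.
move=> d; rewrite inE => /asboolP h; rewrite /diff_inv.
by case: pselect.
Qed.

HB.instance Definition _ := GRing.isZmodule.Build diff
  diff_addA diff_addC diff_add0 diff_addN.
HB.instance Definition _ := GRing.Zmodule_isComNzRing.Build diff
  diff_mulA diff_mulC diff_mul1 diff_mulD diff_one_neq0.
HB.instance Definition _ := GRing.ComNzRing_hasMulInverse.Build diff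
  diff_mulV diff_unitP diff_inv_out.

Local Open Scope ring_scope.

Definition diff_norm (d : diff) : diff := if diff_le 0 d then d else - d.

Lemma diff_zeroE : 0 = mk (0%num, 0%num) :> diff. Proof. by []. Qed.
Lemma diff_oneE : 1 = mk (1%num, 0%num) :> diff. Proof. by []. Qed.
Lemma diff_addE d e : d + e = diff_add d e. Proof. by []. Qed.
Lemma diff_mulE d e : d * e = diff_mul d e. Proof. by []. Qed.
Lemma diff_oppE d : - d = diff_opp d. Proof. by []. Qed.
Local Definition diffE := (diff_zeroE, diff_oneE, diff_addE, diff_mulE, diff_oppE).

Lemma diff_ge0P d : diff_le 0 d <-> exists x, d = mk (x, 0%num).
Proof.
case: (diffP d) => -[a b] -> {d}; rewrite diffE mk_le /=; split.
- move/asboolP; rewrite nleE => -[x e]; exists x; apply/mk_eq; rewrite /cross /=.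
  by transitivity (a + 0)%num; [ring|rewrite e; ring].
- move=> [x /mk_eq]; rewrite /cross /= => e; apply/asboolP; rewrite nleE.
  by exists x; transitivity (a + 0)%num; [ring|rewrite e; ring].
Qed.

Lemma diff_ge0_add d e : diff_le 0 d -> diff_le 0 e -> diff_le 0 (d + e).
Proof.
rewrite !diff_ge0P => -[x ->] [y ->]; exists (x + y)%num.
by rewrite diffE mk_add; apply/mk_eq; rewrite /cross /=; ring.
Qed.

Lemma diff_ge0_mul d e : diff_le 0 d -> diff_le 0 e -> diff_le 0 (d * e).
Proof.
rewrite !diff_ge0P => -[x ->] [y ->]; exists (x * y)%num.
by rewrite diffE mk_mul; apply/mk_eq; rewrite /cross /=; ring.
Qed.

Lemma diff_le_total d e : diff_le d e || diff_le e d.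
Proof.
case: (diffP d) => -[a b] -> {d}; case: (diffP e) => -[a' b'] -> {e}.
rewrite !mk_le /=; apply/orP.
by case: (nle_total (a + b')%num (a' + b)%num) => h; [left|right]; apply/asboolP.
Qed.

Lemma diff_ge0_anti d : diff_le 0 d -> diff_le d 0 -> d = 0.
Proof.
case: (diffP d) => -[a b] -> {d}; rewrite !diffE !mk_le /=.
by move=> /asboolP h /asboolP h'; apply/mk_eq/nle_anti.
Qed.

Lemma diff_sub_ge0 d e : diff_le 0 (e - d) = diff_le d e.
Proof.
case: (diffP d) => -[a b] -> {d}; case: (diffP e) => -[a' b'] -> {e}.
rewrite !diffE mk_opp mk_add !mk_le /=; apply: asbool_equiv_eq.
have -> : (0 + (b' + a) = a + b')%num by ring.
by have -> : (a' + b + 0 = a' + b)%num by ring.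
Qed.

Lemma diff_normN d : diff_norm (- d) = diff_norm d.
Proof.
have le0N e : diff_le 0 (- e) = diff_le e 0 by rewrite -[RHS]diff_sub_ge0 sub0r.
rewrite /diff_norm opprK le0N; case: ifP => h; case: ifP => h' //.
- by rewrite (diff_ge0_anti h' h) oppr0.
- by move: (diff_le_total 0 d); rewrite h h'.
Qed.

Lemma diff_ge0_norm d : diff_le 0 d -> diff_norm d = d.
Proof. by rewrite /diff_norm => ->. Qed.

Lemma diff_integral (d e : diff) : d * e = 0 -> (d == 0) || (e == 0).
Proof.
move=> de0; apply/orP; move: de0.
wlog d0 : d / diff_le 0 d => [th|].
  case/orP: (diff_le_total 0 d) => h; first exact: th.
  move=> de0; rewrite -oppr_eq0; apply: th; last by rewrite mulNr de0 oppr0.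
  by rewrite -sub0r diff_sub_ge0.
wlog e0 : e / diff_le 0 e => [th|].
  case/orP: (diff_le_total 0 e) => h; first exact: th.
  move=> de0; rewrite -[e == 0]oppr_eq0; apply: th; last by rewrite mulrN de0 oppr0.
  by rewrite -sub0r diff_sub_ge0.
case/diff_ge0P: d0 => x ->; case/diff_ge0P: e0 => y ->.
rewrite diffE mk_mul => /mk_eq; rewrite /cross /= => h.
have /nmul_eq0 [->|->] : (x * y = 0)%num.
- by transitivity (x * y + 0 * 0 + 0)%num; [ring|rewrite h; ring].
- by left; apply/eqP.
- by right; apply/eqP.
Qed.

HB.instance Definition _ := GRing.ComUnitRing_isIntegral.Build diff diff_integral.
HB.instance Definition _ := Num.IntegralDomain_isLeReal.Build diff
  diff_ge0_add diff_ge0_mul diff_ge0_anti diff_sub_ge0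
  (diff_le_total 0) diff_normN diff_ge0_norm (fun _ _ => erefl).

Definition inj (x : A) : diff := mk (x, 0%num).

Lemma injD x y : inj (x + y)%num = inj x + inj y.
Proof. by rewrite diffE mk_add; apply/mk_eq; rewrite /cross /=; ring. Qed.
Lemma injM x y : inj (x * y)%num = inj x * inj y.
Proof. by rewrite diffE mk_mul; apply/mk_eq; rewrite /cross /=; ring. Qed.
Lemma inj_ge0 x : 0 <= inj x.
Proof. by apply/diff_ge0P; exists x. Qed.
Lemma inj_le x y : (x <= y)%num <-> inj x <= inj y.
Proof.
have e : (inj x <= inj y) = `[< (x + 0 <= y + 0)%num >] := mk_le _ _.
have E z : (z + 0 = z)%num by ring.
by rewrite e !E; split => /asboolP.
Qed.
Lemma inj_eq x y : x = y <-> inj x = inj y.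
Proof.
split=> [->//|/mk_eq]; rewrite /cross /= => h.
by transitivity (x + 0)%num; [ring|rewrite h; ring].
Qed.
Lemma nlt_le x y : (x < y)%num <-> (x + 1 <= y)%num.
Proof.
rewrite nltE nleE; split=> -[z ->]; exists z; ring.
Qed.
Lemma inj_lt x y : (x < y)%num <-> inj x + 1 <= inj y.
Proof. by rewrite nlt_le inj_le injD. Qed.
Lemma nnot_lt x y : ~ (x < y)%num <-> (y <= x)%num.
Proof.
split=> [h|h h']; first by case: (ntotal x y) => [//|[->|]]; rewrite /nle; auto.
by case: h => [/(nlt_trans h')|h]; [|move: h'; rewrite h]; apply: nlt_irr.
Qed.
Lemma nnot_le x y : ~ (x <= y)%num <-> (y < x)%num.
Proof.
split=> [h|h h']; first by case: (ntotal y x) => [//|[e|e]]; case: h; rewrite /nle; auto.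
by case: h' => [/(nlt_trans h)|h']; [|move: h; rewrite h']; apply: nlt_irr.
Qed.
End Differences.

(** [arith] settles linear goals about a discretely ordered semiring, by refuting the
    negated goal in the ring of differences, where [lra] applies. *)
Lemma nlt_contra (A : arith) (x y : A) : (y <= x -> False)%num -> (x < y)%num.
Proof. by move=> h; apply: contrapT => /nnot_lt. Qed.
Lemma nle_contra (A : arith) (x y : A) : (y < x -> False)%num -> (x <= y)%num.
Proof. by move=> h; apply: contrapT => /nnot_le. Qed.
Lemma num_eq_contra (A : arith) (x y : A) :
  (x < y -> False)%num -> (y < x -> False)%num -> x = y.
Proof. by move=> h h'; case: (ntotal x y) => [/h//|[//|/h'//]]. Qed.

Lemma inj0 (A : arith) : @inj A 0%num = 0%R. Proof. by []. Qed.
Lemma inj1 (A : arith) : @inj A 1%num = 1%R. Proof. by []. Qed.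
Definition injE := (injD, injM, inj0, inj1).

Ltac assert_ge0 x :=
  lazymatch goal with
  | _ : is_true (0%R <= inj x)%R |- _ => idtac
  | _ => let h := fresh in pose proof (h := inj_ge0 x); rewrite ?injE in h
  end.
Ltac atoms_ge0 x :=
  lazymatch x with
  | nadd ?u ?v => atoms_ge0 u; atoms_ge0 v
  | nmul ?u ?v => atoms_ge0 u; atoms_ge0 v; assert_ge0 x
  | @nzero _ => idtac
  | @none _ => idtac
  | _ => assert_ge0 x
  end.
Ltac arith_prep :=
  intros; try match goal with |- ~ _ => intro end;
  repeat match goal with H : _ /\ _ |- _ => destruct H end;
  lazymatch goal with
  | |- nlt _ _ => apply: nlt_contra => ?
  | |- nle _ _ => apply: nle_contra => ?
  | |- @eq (num _) _ _ => apply: num_eq_contra => ?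
  | |- _ => exfalso
  end;
  repeat match goal with
  | H : ~ nlt _ _ |- _ => move/nnot_lt in H
  | H : ~ nle _ _ |- _ => move/nnot_le in H
  end;
  repeat match goal with
  | H : nlt ?x ?y |- _ => atoms_ge0 x; atoms_ge0 y; move/inj_lt in H; rewrite ?injE in H
  | H : nle ?x ?y |- _ => atoms_ge0 x; atoms_ge0 y; move/inj_le in H; rewrite ?injE in H
  | H : @eq (num _) ?x ?y |- _ => atoms_ge0 x; atoms_ge0 y; move/inj_eq in H; rewrite ?injE in H
  end;
  (* [lra] would try to read these as linear constraints. *)
  repeat match goal with
  | H : forall x, _ |- _ => clear H
  | H : @eq (num _) _ _ |- _ => clear H
  | H : _ <-> _ |- _ => clear H
  | H : ~ _ |- _ => clear H
  | H : _ \/ _ |- _ => clear H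
  end;
  (* [lra] compares atoms up to conversion, which may unfold recursive definitions. *)
  repeat match goal with
  | _ : context [inj ?x] |- _ => let v := fresh "v" in set (v := inj x) in *; clearbody v
  end.
Ltac arith := arith_prep; lra.
Ltac narith := arith_prep; nra.

(** * Bounded definability *)

Section Bounded.
Variables (N S : Type) (z o : N) (add mul : N -> N -> N) (lt : N -> N -> Prop).
Variable mem : N -> S -> Prop.
Let env := nat -> N.

Inductive Tm : (env -> N) -> Prop :=
| Tm_var n : Tm (fun e => e n)
| Tm_const c : Tm (fun _ => c)
| Tm_add s t : Tm s -> Tm t -> Tm (fun e => add (s e) (t e))
| Tm_mul s t : Tm s -> Tm t -> Tm (fun e => mul (s e) (t e)).

(** The relations defined by bounded formulas with number and set parameters.  The
    parameters are constants of the metalanguage, so that only the number variables,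
    evaluated by an environment, vary. *)
Inductive D0 : (env -> Prop) -> Prop :=
| D0_eq s t : Tm s -> Tm t -> D0 (fun e => s e = t e)
| D0_lt s t : Tm s -> Tm t -> D0 (fun e => lt (s e) (t e))
| D0_mem s X : Tm s -> D0 (fun e => mem (s e) X)
| D0_bot : D0 (fun _ => False)
| D0_imp P Q : D0 P -> D0 Q -> D0 (fun e => P e -> Q e)
| D0_all t (P : env -> N -> Prop) : Tm t ->
    D0 (fun e => P (fun i => e (Datatypes.S i)) (e 0)) ->
    D0 (fun e => forall y, lt y (t e) -> P e y)
| D0_ext P Q : (forall e, P e <-> Q e) -> D0 P -> D0 Q.

(** In [P y x], [y] is the witness of the existential quantifier and [x] the induction
    variable, as in the de Bruijn numbering of the formulas. *)
Definition sigma1_induction : Prop :=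
  forall P : N -> N -> Prop, D0 (fun e => P (e 0) (e 1)) ->
  (exists y, P y z) ->
  (forall x, (exists y, P y x) -> exists y, P y (add x o)) ->
  forall x, exists y, P y x.

Definition delta1_comprehension : Prop :=
  forall P Q : N -> N -> Prop,
  D0 (fun e => P (e 0) (e 1)) -> D0 (fun e => Q (e 0) (e 1)) ->
  (forall x, (exists y, P y x) <-> (forall y, Q y x)) ->
  exists X, forall x, mem x X <-> exists y, P y x.

Lemma D0_iff P Q : D0 P -> D0 Q -> D0 (fun e => P e <-> Q e).
Proof.
move=> p q; apply: (@D0_ext (fun e => ((P e -> Q e) -> (Q e -> P e) -> False) -> False)).
  by move=> e; split=> [h|[h h'] k]; [apply: contrapT => k; apply: h => h h'; apply: k|apply: k].
by do !apply: D0_imp => //; apply: D0_bot.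
Qed.

Lemma D0_or P Q : D0 P -> D0 Q -> D0 (fun e => P e \/ Q e).
Proof.
move=> p q; apply: (@D0_ext (fun e => (P e -> False) -> Q e)).
  move=> e; split=> [h|[h k|//]]; last by case: k.
  by case: (pselect (P e)) => [k|/h]; [left|right].
by do !apply: D0_imp => //; apply: D0_bot.
Qed.

End Bounded.

Ltac d0 := cbv beta;
  repeat first [ apply: D0_iff | apply: D0_or | apply: D0_imp | apply: D0_eq | apply: D0_lt | apply: D0_bot
  | apply: D0_mem | apply: D0_all | apply: Tm_add | apply: Tm_mul | apply: Tm_var | apply: Tm_const ].

(** * Arithmetic from induction *)

Section Robinson.
Variables (N S : Type) (z o : N) (add mul : N -> N -> N) (lt : N -> N -> Prop).
Variable mem : N -> S -> Prop.
Local Notation "x + y" := (add x y).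
Local Notation "x * y" := (mul x y).
Local Notation "x < y" := (lt x y).

Hypothesis succ_neq0 : forall x, x + o <> z.
Hypothesis succ_inj : forall x y, x + o = y + o -> x = y.
Hypothesis addx0 : forall x, x + z = x.
Hypothesis addxS : forall x y, x + (y + o) = x + y + o.
Hypothesis mulx0 : forall x, x * z = z.
Hypothesis mulxS : forall x y, x * (y + o) = x * y + x.
Hypothesis ltx0 : forall x, ~ x < z.
Hypothesis ltxS : forall x y, x < y + o <-> x < y \/ x = y.
Hypothesis ind : sigma1_induction z o add mul lt mem.

(** The algebraic laws need induction for bounded relations only. *)
Lemma open_ind (P : N -> Prop) : D0 add mul lt mem (fun e => P (e 1)) ->
  P z -> (forall x, P x -> P (x + o)) -> forall x, P x.
Proof.
move=> p p0 pS x.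
have [_ //] : exists y : N, P x.
by apply: (ind (P := fun _ => P)); [|exists z|move=> {}x [y /pS h]; exists y].
Qed.

Lemma r_addA x y w : x + (y + w) = x + y + w.
Proof.
by elim/open_ind: w => [||w IH]; rewrite ?addx0 ?addxS ?IH //; d0.
Qed.
Lemma r_add0 x : z + x = x.
Proof. by elim/open_ind: x => [||x IH]; rewrite ?addx0 ?addxS ?IH //; d0. Qed.
Lemma r_addSx x y : x + o + y = x + y + o.
Proof. by elim/open_ind: y => [||y IH]; rewrite ?addx0 ?addxS ?IH //; d0. Qed.
Lemma r_addC x y : x + y = y + x.
Proof.
by elim/open_ind: y => [||y IH]; rewrite ?addx0 ?r_add0 ?addxS ?IH ?r_addSx //; d0.
Qed.
Lemma r_addI x y w : w + x = w + y -> x = y.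
Proof.
rewrite ![w + _]r_addC; elim/open_ind: w => [||w IH]; rewrite ?addx0 //; first by d0.
by rewrite !addxS => /succ_inj.
Qed.
Lemma r_mul0 x : z * x = z.
Proof. by elim/open_ind: x => [||x IH]; rewrite ?mulx0 ?mulxS ?IH ?addx0 //; d0. Qed.
Lemma r_mulSx x y : (x + o) * y = x * y + y.
Proof.
elim/open_ind: y => [||y IH]; rewrite ?mulx0 ?mulxS ?IH ?addx0 //; first by d0.
by rewrite -!r_addA; congr (_ + _); rewrite r_addA r_addC [y + x]r_addC !r_addA [o + x]r_addC -!r_addA [o + y]r_addC.
Qed.
Lemma r_mulC x y : x * y = y * x.
Proof.
by elim/open_ind: y => [||y IH]; rewrite ?mulx0 ?r_mul0 ?mulxS ?IH ?r_mulSx //; d0.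
Qed.
Lemma r_mulD x y w : (x + y) * w = x * w + y * w.
Proof.
elim/open_ind: w => [||w IH]; rewrite ?mulx0 ?mulxS ?IH ?addx0 //; first by d0.
by rewrite -!r_addA; congr (_ + _); rewrite !r_addA; congr (_ + _); rewrite r_addC.
Qed.
Lemma r_mulA x y w : x * (y * w) = x * y * w.
Proof.
elim/open_ind: w => [||w IH]; rewrite ?mulx0 ?mulxS ?IH ?addx0 //; first by d0.
by rewrite r_mulC r_mulD ![_ * x]r_mulC IH.
Qed.
Lemma r_one : o = z + o. Proof. by rewrite r_add0. Qed.
Lemma r_mul1 x : o * x = x.
Proof. by rewrite r_one r_mulSx r_mul0 r_add0. Qed.
Lemma r_zero_or_succ x : x = z \/ exists y, x = y + o.
Proof.
case: (pselect (x = z)) => [|h]; [by left|right].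
have [//|[y e]] : x = z \/ exists y, x = y + o.
  have : exists y, x = z \/ x = y + o.
    apply: (ind (P := fun y x => x = z \/ x = y + o)).
    - by d0.
    - by exists z; left.
    - by move=> {h}x _; exists x; right.
  by move=> [y [->|->]]; [left|right; exists y].
by exists y.
Qed.
Lemma r_ltE x y : x < y <-> exists w, y = x + w + o.
Proof.
split.
- have : exists w, x < y -> y = x + w + o.
    apply: (ind (P := fun w y => x < y -> y = x + w + o)).
    + by d0.
    + by exists z => /ltx0.
    + move=> {}y [w IH]; case: (pselect (x < y)) => [/IH e|h].
        by exists (w + o) => _; rewrite {1}e addxS.
      by exists z => /ltxS [//|->]; rewrite addx0.
  by move=> [w h] /h e; exists w.
- move=> [w ->]; elim/open_ind: w => [||w IH].
  + by d0.
  + by rewrite addx0; apply/ltxS; right.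
  + by apply/ltxS; left; rewrite addxS.
Qed.
Lemma r_total x y : x < y \/ x = y \/ y < x.
Proof.
elim/open_ind: y => [||y IH]; first by d0.
  case: (r_zero_or_succ x) => [->|[w ->]]; first by right; left.
  by right; right; apply/r_ltE; exists w; rewrite r_add0.
case: IH => [h|[->|/r_ltE[w ->]]]; first by left; apply/ltxS; left.
- by left; apply/ltxS; right.
- case: (r_zero_or_succ w) => [->|[v ->]]; first by rewrite addx0; right; left.
  by right; right; apply/r_ltE; exists v; rewrite !r_addA (r_addSx y v).
Qed.

Definition robinson_arith : arith := Arith r_addC r_addA r_add0 r_addI r_mulC r_mulA
  r_mul0 r_mul1 r_mulD succ_neq0 r_ltE r_total.
End Robinson.

(** The models of the base theory, with the relations defined by bounded formulas in
    place of the formulas. *)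
Record model : Type := Model {
  numbers :> arith;
  sets : Type;
  mem : numbers -> sets -> Prop;
  model_induction :
    sigma1_induction (@nzero numbers) (@none numbers) (@nadd _) (@nmul _) (@nlt _) mem;
  model_comprehension : delta1_comprehension (@nadd _) (@nmul _) (@nlt _) mem }.

(** * Definability and induction in a model *)

Section Definability.
Variable M : model.
Local Open Scope num_scope.
Definition env := nat -> M.
Definition tl (e : env) : env := fun i => e (S i).

Notation Term := (@Tm M (@nadd M) (@nmul M)).
Definition Delta0 (P : env -> Prop) := D0 (@nadd M) (@nmul M) (@nlt M) (@mem M) P.

Lemma Tm_subst t (sg : env -> env) :
  Term t -> (forall i, Term (fun e => sg e i)) -> Term (fun e => t (sg e)).
Proof. by move=> + h; elim=> [n|c|s t' _ IH _ IH'|s t' _ IH _ IH']; [|d0..]. Qed.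

Lemma Delta0_subst P (sg : env -> env) :
  Delta0 P -> (forall i, Term (fun e => sg e i)) -> Delta0 (fun e => P (sg e)).
Proof.
move=> p; elim: p sg => {P}.
- by move=> s t s' t' sg h; apply: D0_eq; apply: Tm_subst.
- by move=> s t s' t' sg h; apply: D0_lt; apply: Tm_subst.
- by move=> s X s' sg h; apply: D0_mem; apply: Tm_subst.
- by move=> sg h; apply: D0_bot.
- by move=> P Q _ IH _ IH' sg h; apply: D0_imp; [apply: IH|apply: IH'].
- move=> t P t' _ IH sg h; apply: D0_all; first exact: Tm_subst.
  apply: (IH (fun e i => if i is S j then sg (tl e) j else e 0%nat)) => -[|j].
    exact: Tm_var.
  by apply: (Tm_subst (h j)) => i; apply: Tm_var.
- by move=> P Q h _ IH sg hsg; apply: D0_ext (IH sg hsg) => e; apply: h.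
Qed.

Lemma Delta0_not P : Delta0 P -> Delta0 (fun e => ~ P e).
Proof. by move=> p; apply: D0_imp => //; apply: D0_bot. Qed.

Lemma Delta0_and P Q : Delta0 P -> Delta0 Q -> Delta0 (fun e => P e /\ Q e).
Proof.
move=> p q; apply: (@D0_ext _ _ _ _ _ _ (fun e => ~ (P e -> ~ Q e))).
  by move=> e; split=> [h|[h h'] k]; [apply: contrapT => k; apply: h => h h'; apply: k|apply: k].
by apply: Delta0_not; apply: D0_imp => //; apply: Delta0_not.
Qed.

Lemma Delta0_bex t (P : env -> M -> Prop) : Term t ->
  Delta0 (fun e => P (tl e) (e 0%nat)) -> Delta0 (fun e => exists y, y < t e /\ P e y).
Proof.
move=> ht p; apply: (@D0_ext _ _ _ _ _ _ (fun e => ~ (forall y, y < t e -> ~ P e y))).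
  move=> e; split=> [h|[y [h h']] k]; last exact: (k y).
  by apply: contrapT => k; apply: h => y h h'; apply: k; exists y.
by apply: Delta0_not; apply: D0_all => //; apply: Delta0_not.
Qed.

(** A function is definable when its graph is Sigma; being total, it then has a Delta graph,
    and may be substituted for a variable in Sigma and in Delta relations. *)
Definition Sigma (P : env -> Prop) := exists2 Q : env -> M -> Prop,
  Delta0 (fun e => Q (tl e) (e 0%nat)) & forall e, P e <-> exists y, Q e y.
Definition Delta (P : env -> Prop) := Sigma P /\ Sigma (fun e => ~ P e).
Definition Fn (F : env -> M) := Sigma (fun e => e 0%nat = F (tl e)).

Lemma Sigma_ext P Q : (forall e, P e <-> Q e) -> Sigma P -> Sigma Q.
Proof. by move=> h [R r hR]; exists R => // e; rewrite -h. Qed.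

Lemma Sigma_subst P (sg : env -> env) :
  Sigma P -> (forall i, Term (fun e => sg e i)) -> Sigma (fun e => P (sg e)).
Proof.
move=> [Q q h] hsg; exists (fun e => Q (sg e)) => [|e]; last exact: h.
apply: (Delta0_subst (sg := fun e i => if i is S j then sg (tl e) j else e 0%nat)) q _.
by case=> [|j]; [apply: Tm_var|apply: (Tm_subst (hsg j)) => i; apply: Tm_var].
Qed.

Lemma Sigma_Delta0 P : Delta0 P -> Sigma P.
Proof.
move=> p; exists (fun e _ => P e) => [|e]; last by split=> [h|[]//]; exists 0.
by apply: (Delta0_subst (sg := tl)) p _ => i; apply: Tm_var.
Qed.

(** Two witnesses are bounded by a single one. *)
Lemma Sigma_ex (P : env -> M -> Prop) : Sigma (fun e => P (tl e) (e 0%nat)) ->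
  Sigma (fun e => exists y, P e y).
Proof.
move=> [Q q h].
pose cons y (e : env) : env := fun i => if i is S j then e j else y.
exists (fun e w => exists y, y < w /\ exists x, x < w /\ Q (cons y e) x).
  apply: Delta0_bex; first exact: Tm_var.
  apply: Delta0_bex; first exact: Tm_var.
  apply: (Delta0_subst (sg := fun e i => match i with
    0%nat => e 0%nat | 1%nat => e 1%nat | S (S i) => e (S (S (S i))) end)) q _.
  by case=> [|[|i]]; apply: Tm_var.
move=> e; have {}h y : P e y <-> exists x, Q (cons y e) x := h (cons y e).
split=> [[y /h[x Qx]]|[w [y [_ [x [_ Qx]]]]]]; last by exists y; apply/h; exists x.
by exists (x + y + 1), y; split; [arith|exists x; split; [arith|]].
Qed.

Lemma Sigma_and P Q : Sigma P -> Sigma Q -> Sigma (fun e => P e /\ Q e).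
Proof.
move=> [P' p hp] [Q' q hq].
apply: (@Sigma_ext (fun e => exists x, exists y, P' e x /\ Q' e y)).
  move=> e; rewrite hp hq; split=> [[x [y []]]|[[x ?] [y ?]]]; last by exists x, y.
  by split; [exists x|exists y].
apply: Sigma_ex; apply: Sigma_ex; apply: Sigma_Delta0; apply: Delta0_and.
  by apply: (Delta0_subst (sg := tl)) p _ => i; apply: Tm_var.
apply: (Delta0_subst (sg := fun e i => if i is S j then e (S (S j)) else e 0%nat)) q _.
by case=> [|i]; apply: Tm_var.
Qed.

Lemma Sigma_or P Q : Sigma P -> Sigma Q -> Sigma (fun e => P e \/ Q e).
Proof.
move=> [P' p hp] [Q' q hq]; exists (fun e x => P' e x \/ Q' e x); first exact: D0_or.
move=> e; rewrite hp hq; split=> [[[x ?]|[x ?]]|[x [?|?]]]; try by exists x; auto.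
  by left; exists x.
by right; exists x.
Qed.

(** Collection: the witnesses for the [y] below a bound are themselves bounded, by
    induction on that bound. *)
Lemma Sigma_ball_term t (P : env -> M -> Prop) : Term t ->
  Sigma (fun e => P (tl e) (e 0%nat)) -> Sigma (fun e => forall y, y < t e -> P e y).
Proof.
move=> ht [Q q h].
pose cons y (e : env) : env := fun i => if i is S j then e j else y.
exists (fun e b => forall y, y < t e -> exists x, x < b /\ Q (cons y e) x).
  apply: D0_all; first by apply: (Tm_subst ht) => i; apply: Tm_var.
  apply: Delta0_bex; first exact: Tm_var.
  apply: (Delta0_subst (sg := fun e i => match i with
    0%nat => e 0%nat | 1%nat => e 1%nat | S (S i) => e (S (S (S i))) end)) q _.
  by case=> [|[|i]]; apply: Tm_var.
move=> e; have {}h y : P e y <-> exists x, Q (cons y e) x := h (cons y e).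
split=> [H|[b H] y /H[x [_ Qx]]]; last by apply/h; exists x.
have [//| |a [b IH]|b] := @model_induction M
  (fun b a => forall y, y < a -> y < t e -> exists x, x < b /\ Q (cons y e) x) _ _ _ (t e).
- apply: D0_all; first exact: Tm_var.
  apply: D0_imp; first by d0.
  apply: Delta0_bex; first exact: Tm_var.
  apply: (Delta0_subst (sg := fun e' i => match i with
    0%nat => e' 0%nat | 1%nat => e' 1%nat | S (S i) => e i end)) q _.
  by case=> [|[|i]]; [apply: Tm_var|apply: Tm_var|apply: Tm_const].
- by exists 0 => y; arith.
- case: (pselect (a < t e)) => [/[dup] lta /H/h[x Qx]|nlta].
    exists (b + x + 1) => y ya yt; case: (pselect (y < a)) => [/IH/(_ yt)[x' [? ?]]|ny].
      by exists x'; split=> //; arith.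
    have -> : y = a by arith.
    by exists x; split=> //; arith.
  by exists b => y _ yt; apply: IH => //; arith.
by move=> IH; exists b => y ?; apply: IH.
Qed.

Lemma Fn_term t : Term t -> Fn t.
Proof.
move=> ht; apply: Sigma_Delta0; apply: D0_eq; first exact: Tm_var.
by apply: (Tm_subst ht) => i; apply: Tm_var.
Qed.
Lemma Fn_var i : Fn (fun e => e i). Proof. exact/Fn_term/Tm_var. Qed.
Lemma Fn_const c : Fn (fun _ => c). Proof. exact/Fn_term/Tm_const. Qed.

(** Substituting a definable function: the value is first guessed, then checked. *)
Lemma Sigma_comp (P : env -> M -> Prop) F :
  Sigma (fun e => P (tl e) (e 0%nat)) -> Fn F -> Sigma (fun e => P e (F e)).
Proof.
move=> hP hF; apply: (@Sigma_ext (fun e => exists y, y = F e /\ P e y)).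
  by move=> e; split=> [[y [->]]//|h]; exists (F e).
by apply: Sigma_ex; apply: Sigma_and.
Qed.

Lemma Sigma_tl P : Sigma P -> Sigma (fun e => P (tl e)).
Proof. by move=> h; apply: (Sigma_subst (sg := tl)) h _ => i; apply: Tm_var. Qed.

Lemma Fn_tl F : Fn F -> Fn (fun e => F (tl e)).
Proof.
move=> h; apply: (Sigma_subst (sg := fun e i => if i is S j then e (S (S j)) else e 0%nat)) h _.
by case=> [|j]; apply: Tm_var.
Qed.

Lemma Sigma_pred1 (P : M -> Prop) s :
  Sigma (fun e => P (e 0%nat)) -> Fn s -> Sigma (fun e => P (s e)).
Proof. by move=> hP hs; apply: (@Sigma_comp (fun _ y => P y)). Qed.

Lemma Sigma_pred2 (P : M -> M -> Prop) s t :
  Sigma (fun e => P (e 0%nat) (e 1%nat)) -> Fn s -> Fn t -> Sigma (fun e => P (s e) (t e)).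
Proof.
move=> hP hs ht; apply: (@Sigma_comp (fun e y => P (s e) y)) => //.
by apply: (@Sigma_comp (fun e x => P x (e 0%nat))); [exact: hP|exact: Fn_tl].
Qed.

Lemma Sigma_pred3 (P : M -> M -> M -> Prop) s t u :
  Sigma (fun e => P (e 0%nat) (e 1%nat) (e 2%nat)) -> Fn s -> Fn t -> Fn u ->
  Sigma (fun e => P (s e) (t e) (u e)).
Proof.
move=> hP hs ht hu; apply: (@Sigma_comp (fun e y => P (s e) (t e) y)) => //.
apply: (@Sigma_comp (fun e y => P (s (tl e)) y (e 0%nat))); last exact: Fn_tl.
apply: (@Sigma_comp (fun e y => P y (e 0%nat) (e 1%nat))); first exact: hP.
exact: (Fn_tl (Fn_tl hs)).
Qed.

Lemma Sigma_pred4 (P : M -> M -> M -> M -> Prop) s t u v :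
  Sigma (fun e => P (e 0%nat) (e 1%nat) (e 2%nat) (e 3%nat)) ->
  Fn s -> Fn t -> Fn u -> Fn v -> Sigma (fun e => P (s e) (t e) (u e) (v e)).
Proof.
move=> hP hs ht hu hv; apply: (@Sigma_comp (fun e y => P (s e) (t e) (u e) y)) => //.
apply: (@Sigma_comp (fun e y => P (s (tl e)) (t (tl e)) y (e 0%nat))); last exact: Fn_tl.
apply: (@Sigma_comp (fun e y => P (s (tl (tl e))) y (e 0%nat) (e 1%nat))).
  apply: (@Sigma_comp (fun e y => P y (e 0%nat) (e 1%nat) (e 2%nat))); first exact: hP.
  exact: (Fn_tl (Fn_tl (Fn_tl hs))).
exact: (Fn_tl (Fn_tl ht)).
Qed.

Lemma Fn_comp1 (F : M -> M) s : Fn (fun e => F (e 0%nat)) -> Fn s -> Fn (fun e => F (s e)).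
Proof.
move=> hF hs; apply: (@Sigma_pred2 (fun y a => y = F a)); first exact: hF.
  exact: Fn_var.
exact: Fn_tl.
Qed.

Lemma Fn_comp2 (F : M -> M -> M) s t :
  Fn (fun e => F (e 0%nat) (e 1%nat)) -> Fn s -> Fn t -> Fn (fun e => F (s e) (t e)).
Proof.
move=> hF hs ht; apply: (@Sigma_pred3 (fun y a b => y = F a b)); first exact: hF.
- exact: Fn_var.
- exact: Fn_tl.
- exact: Fn_tl.
Qed.

Lemma Fn_comp3 (F : M -> M -> M -> M) s t u :
  Fn (fun e => F (e 0%nat) (e 1%nat) (e 2%nat)) -> Fn s -> Fn t -> Fn u ->
  Fn (fun e => F (s e) (t e) (u e)).
Proof.
move=> hF hs ht hu; apply: (@Sigma_pred4 (fun y a b c => y = F a b c)); first exact: hF.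
- exact: Fn_var.
- exact: Fn_tl.
- exact: Fn_tl.
- exact: Fn_tl.
Qed.

Lemma Fn_add s t : Fn s -> Fn t -> Fn (fun e => s e + t e).
Proof. by apply: (Fn_comp2 (F := @nadd M)); apply: Fn_term; d0. Qed.
Lemma Fn_mul s t : Fn s -> Fn t -> Fn (fun e => s e * t e).
Proof. by apply: (Fn_comp2 (F := @nmul M)); apply: Fn_term; d0. Qed.

Lemma Sigma_ball t (P : env -> M -> Prop) : Fn t ->
  Sigma (fun e => P (tl e) (e 0%nat)) -> Sigma (fun e => forall y, y < t e -> P e y).
Proof.
move=> ht hP; apply: (@Sigma_comp (fun e b => forall y, y < b -> P e y)) => //.
apply: (@Sigma_ball_term _ (fun e y => P (tl e) y)); first exact: Tm_var.
by apply: (Sigma_subst (sg := fun e i => if i is S j then e (S (S j)) else e 0%nat)) hP _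
  => -[|j]; apply: Tm_var.
Qed.

Lemma Sigma_bex t (P : env -> M -> Prop) : Fn t ->
  Sigma (fun e => P (tl e) (e 0%nat)) -> Sigma (fun e => exists y, y < t e /\ P e y).
Proof.
move=> ht hP; apply: Sigma_ex; apply: Sigma_and => //.
apply: Sigma_pred2; [by apply: Sigma_Delta0; d0|exact: Fn_var|exact: Fn_tl].
Qed.

Lemma Delta_Delta0 P : Delta0 P -> Delta P.
Proof. by move=> p; split; apply: Sigma_Delta0 => //; apply: Delta0_not. Qed.
Lemma Delta_Sigma P : Delta P -> Sigma P. Proof. by case. Qed.

Lemma Delta_not P : Delta P -> Delta (fun e => ~ P e).
Proof.
by move=> [h h']; split=> //; apply: Sigma_ext h => e; split=> [?|/contrapT//]; apply.
Qed.
Lemma Delta_and P Q : Delta P -> Delta Q -> Delta (fun e => P e /\ Q e).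
Proof.
move=> [p p'] [q q']; split; first exact: Sigma_and.
by apply: Sigma_ext (Sigma_or p' q') => e; rewrite not_andP.
Qed.
Lemma Delta_ext P Q : (forall e, P e <-> Q e) -> Delta P -> Delta Q.
Proof. by move=> h [p p']; split; [apply: Sigma_ext p|apply: Sigma_ext p'] => e; rewrite h. Qed.
Lemma Delta_or P Q : Delta P -> Delta Q -> Delta (fun e => P e \/ Q e).
Proof.
move=> [p p'] [q q']; split; first exact: Sigma_or.
by apply: Sigma_ext (Sigma_and p' q') => e; rewrite not_orP.
Qed.
Lemma Delta_imp P Q : Delta P -> Delta Q -> Delta (fun e => P e -> Q e).
Proof.
move=> p q; apply: Delta_ext (Delta_or (Delta_not p) q) => e.
by rewrite -implyE.
Qed.
Lemma Delta_iff P Q : Delta P -> Delta Q -> Delta (fun e => P e <-> Q e).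
Proof. by move=> p q; apply: Delta_and; apply: Delta_imp. Qed.
Lemma Delta_ball t (P : env -> M -> Prop) : Fn t ->
  Delta (fun e => P (tl e) (e 0%nat)) -> Delta (fun e => forall y, y < t e -> P e y).
Proof.
move=> ht [p p']; split; first exact: Sigma_ball.
apply: Sigma_ext (Sigma_bex (P := fun e y => ~ P e y) ht p') => e.
split=> [[y [h k]] H|h]; first exact: k (H y h).
by apply: contrapT => k; apply: h => y h; apply: contrapT => h'; apply: k; exists y.
Qed.
Lemma Delta_bex t (P : env -> M -> Prop) : Fn t ->
  Delta (fun e => P (tl e) (e 0%nat)) -> Delta (fun e => exists y, y < t e /\ P e y).
Proof.
move=> ht [p p']; split; first exact: Sigma_bex.
apply: Sigma_ext (Sigma_ball (P := fun e y => ~ P e y) ht p') => e.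
by split=> [H [y [h k]]|h y ? ?]; [apply: (H y)|apply: h; exists y].
Qed.

Lemma Delta_pred1 (P : M -> Prop) s :
  Delta (fun e => P (e 0%nat)) -> Fn s -> Delta (fun e => P (s e)).
Proof.
by move=> [h h'] ?; split; [apply: (Sigma_pred1 h)|apply: (Sigma_pred1 (P := fun x => ~ P x) h')].
Qed.
Lemma Delta_pred2 (P : M -> M -> Prop) s t :
  Delta (fun e => P (e 0%nat) (e 1%nat)) -> Fn s -> Fn t -> Delta (fun e => P (s e) (t e)).
Proof.
by move=> [h h'] ? ?; split; [apply: (Sigma_pred2 h)|
  apply: (Sigma_pred2 (P := fun x y => ~ P x y) h')].
Qed.
Lemma Delta_pred3 (P : M -> M -> M -> Prop) s t u :
  Delta (fun e => P (e 0%nat) (e 1%nat) (e 2%nat)) -> Fn s -> Fn t -> Fn u ->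
  Delta (fun e => P (s e) (t e) (u e)).
Proof.
by move=> [h h'] ? ? ?; split; [apply: (Sigma_pred3 h)|
  apply: (Sigma_pred3 (P := fun x y z => ~ P x y z) h')].
Qed.
Lemma Delta_eq s t : Fn s -> Fn t -> Delta (fun e => s e = t e).
Proof. by apply: Delta_pred2; apply: Delta_Delta0; d0. Qed.
Lemma Delta_lt s t : Fn s -> Fn t -> Delta (fun e => s e < t e).
Proof. by apply: Delta_pred2; apply: Delta_Delta0; d0. Qed.
Lemma Delta_le s t : Fn s -> Fn t -> Delta (fun e => s e <= t e).
Proof. by move=> ? ?; apply: Delta_or; [apply: Delta_lt|apply: Delta_eq]. Qed.
Lemma Delta_mem s X : Fn s -> Delta (fun e => mem (s e) X).
Proof. by apply: (Delta_pred1 (P := fun x => mem x X)); apply: Delta_Delta0; d0. Qed.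
Lemma Delta_const (P : Prop) : Delta (fun _ => P).
Proof.
case: (pselect P) => h; apply: Delta_Delta0.
  apply: (@D0_ext _ _ _ _ _ _ (fun _ => (0 : M) = 0)); last by d0.
  by split.
apply: (@D0_ext _ _ _ _ _ _ (fun _ => False)); last by d0.
by split.
Qed.

Lemma Sigma_ind (P : M -> Prop) : Sigma (fun e => P (e 0%nat)) ->
  P 0 -> (forall x, P x -> P (x + 1)) -> forall x, P x.
Proof.
move=> [Q q h] p0 pS.
have {}h x : P x <-> exists y, Q (fun _ => x) y := h (fun _ => x).
move=> x; apply/h; apply: (@model_induction M (fun y x => Q (fun _ => x) y)) => [||{}x].
- apply: (Delta0_subst (sg := fun e i => match i with 0%nat => e 0%nat | _ => e 1%nat end)) q _.
  by case=> [|i]; apply: Tm_var.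
- exact/h.
- by move/h/pS/h.
Qed.

(** If there were no least element, then it would follow by induction on [x] that nothing
    below [x] is in [P]; by collection this is a Sigma statement about [x]. *)
Lemma Delta_least (P : M -> Prop) : Delta (fun e => P (e 0%nat)) ->
  (exists y, P y) -> exists y, P y /\ forall z, z < y -> ~ P z.
Proof.
move=> [_ hP] [y Py]; apply: contrapT => h.
have H x : forall z, z < x -> ~ P z.
  elim/Sigma_ind: x => [||x IH z lz].
  - apply: (@Sigma_ball _ (fun e z => ~ P z)); [exact: Fn_var|exact: hP].
  - by move=> z; arith.
  - case: (pselect (z < x)) => [/IH//|nz].
    have -> : z = x by arith.
    by move=> Px; apply: h; exists x.
by apply: (H (y + 1) y) => //; arith.
Qed.

Lemma Delta_comprehension (P : M -> Prop) : Delta (fun e => P (e 0%nat)) ->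
  exists X, forall x, mem x X <-> P x.
Proof.
move=> [[Q q h] [R r h']].
have {}h x : P x <-> exists y, Q (fun _ => x) y := h (fun _ => x).
have {}h' x : ~ P x <-> exists y, R (fun _ => x) y := h' (fun _ => x).
have [|||X hX] := @model_comprehension M (fun y x => Q (fun _ => x) y) (fun y x => ~ R (fun _ => x) y).
- apply: (Delta0_subst (sg := fun e i => match i with 0%nat => e 0%nat | _ => e 1%nat end)) q _.
  by case=> [|i]; apply: Tm_var.
- apply: Delta0_not.
  apply: (Delta0_subst (sg := fun e i => match i with 0%nat => e 0%nat | _ => e 1%nat end)) r _.
  by case=> [|i]; apply: Tm_var.
- move=> x; rewrite -h; split=> [Px y Rxy|H].
    by have /h' : exists y, R (fun _ => x) y by exists y.
  by apply: contrapT => /h'[y]; apply: H.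
by exists X => x; rewrite hX h.
Qed.

(** Minimization is applied to Delta relations that have a witness for all values of the
    variables: then a value is recognized as the least witness by a Delta condition. *)
Definition mu (P : M -> Prop) : M :=
  if pselect (exists y, P y /\ forall z, z < y -> ~ P z) is left h then sval (cid h) else 0.

Lemma mu_least (P : M -> Prop) : Delta (fun e => P (e 0%nat)) ->
  (exists y, P y) -> P (mu P) /\ forall z, z < mu P -> ~ P z.
Proof.
by move=> hP /(Delta_least hP) h; rewrite /mu; case: pselect => // h'; exact: svalP (cid h').
Qed.

Lemma Delta_at (P : env -> M -> Prop) e : Delta (fun e => P (tl e) (e 0%nat)) ->
  Delta (fun e' => P e (e' 0%nat)).
Proof.
by move=> [p p']; split; [apply: (Sigma_subst (sg := fun e' i => if i is S j then e j else e' 0%nat)) p _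
  | apply: (Sigma_subst (sg := fun e' i => if i is S j then e j else e' 0%nat)) p' _];
  case=> [|i]; first [exact: Tm_var|exact: Tm_const].
Qed.

(** Substitution in the presence of further variables, which [sg] evaluates. *)
Lemma Delta_at1 (P : env -> M -> Prop) (sg : env -> env) s :
  Delta (fun e => P (tl e) (e 0%nat)) -> (forall i, Term (fun e => sg e i)) -> Fn s ->
  Delta (fun e => P (sg e) (s e)).
Proof.
move=> [p p'] hsg hs.
have tm j : Term (fun e : env => (if j is S j then sg (tl e) j else e 0%nat)).
  case: j => [|j]; first exact: Tm_var.
  by apply: (Tm_subst (hsg j)) => i; apply: Tm_var.
split; [apply: (@Sigma_comp (fun e x => P (sg e) x)) => //|
  apply: (@Sigma_comp (fun e x => ~ P (sg e) x)) => //].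
  exact: (Sigma_subst (sg := fun e i => if i is S j then sg (tl e) j else e 0%nat)) p tm.
exact: (Sigma_subst (sg := fun e i => if i is S j then sg (tl e) j else e 0%nat)) p' tm.
Qed.

Lemma Fn_at2 (F : env -> M -> M -> M) (sg : env -> env) s t :
  Fn (fun e => F (tl (tl e)) (e 0%nat) (e 1%nat)) ->
  (forall i, Term (fun e => sg e i)) -> Fn s -> Fn t ->
  Fn (fun e => F (sg e) (s e) (t e)).
Proof.
move=> hF hsg hs ht.
apply: (@Sigma_comp (fun e y => e 0%nat = F (sg (tl e)) (s (tl e)) y)); last exact: Fn_tl.
apply: (@Sigma_comp (fun e x => e 1%nat = F (sg (tl (tl e))) x (e 0%nat)));
  last exact: (Fn_tl (Fn_tl hs)).
apply: (Sigma_subst (sg := fun e i => match i with 0%nat => e 2%nat | 1%nat => e 0%nat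
  | 2%nat => e 1%nat | S (S (S j)) => sg (tl (tl (tl e))) j end)) hF _.
case=> [|[|[|j]]]; try exact: Tm_var.
by apply: (Tm_subst (hsg j)) => i; apply: Tm_var.
Qed.

Lemma Fn_mu (P : env -> M -> Prop) : Delta (fun e => P (tl e) (e 0%nat)) ->
  (forall e, exists y, P e y) -> Fn (fun e => mu (P e)).
Proof.
move=> hP tot.
apply: (@Sigma_ext (fun e => P (tl e) (e 0%nat) /\ forall z, z < e 0%nat -> ~ P (tl e) z)).
  move=> e; have [h h'] := mu_least (Delta_at (tl e) hP) (tot (tl e)).
  split=> [[k k']|->//].
  by apply: num_eq_contra => [/h'|/k'].
apply: Delta_Sigma; apply: Delta_and => //.
apply: (Delta_ball (P := fun e z => ~ P (tl e) z)); first exact: Fn_var.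
apply: Delta_not.
case: hP => p p'; split.
  by apply: (Sigma_subst (sg := fun e i => if i is S j then e (S (S j)) else e 0%nat)) p _
    => -[|j]; apply: Tm_var.
by apply: (Sigma_subst (sg := fun e i => if i is S j then e (S (S j)) else e 0%nat)) p' _
  => -[|j]; apply: Tm_var.
Qed.

Lemma Fn_if P s t : Delta P -> Fn s -> Fn t -> Fn (fun e => if `[< P e >] then s e else t e).
Proof.
move=> [p p'] hs ht.
apply: (@Sigma_ext (fun e => P (tl e) /\ e 0%nat = s (tl e) \/ ~ P (tl e) /\ e 0%nat = t (tl e))).
  by move=> e; case: asboolP => h; split=> [[[]|[]]//|]; [left|right].
apply: Sigma_or; apply: Sigma_and => //; first exact: Sigma_tl p.
exact: Sigma_tl p'.
Qed.
End Definability.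

(** [defn] proves definability by structural recursion on the defining expression; hypotheses
    that say that a function symbol preserves definability are used as well. *)
Ltac defn_ext := fail.
Ltac defn_step :=
  cbv beta delta [tl];
  first
  [ assumption
  | lazymatch goal with
    | |- Fn (fun e => e _) => exact: Fn_var
    | |- Fn (fun e => nadd _ _) => apply: Fn_add
    | |- Fn (fun e => nmul _ _) => apply: Fn_mul
    | |- Fn (fun e => if asbool _ then _ else _) => apply: Fn_if
    | |- Delta (fun e => @eq _ _ _) => apply: Delta_eq
    | |- Delta (fun e => nlt _ _) => apply: Delta_lt
    | |- Delta (fun e => nle _ _) => apply: Delta_le
    | |- Delta (fun e => mem _ _) => apply: Delta_mem
    | |- Delta (fun e => _ <-> _) => apply: Delta_iff
    | |- Delta (fun e => _ /\ _) => apply: Delta_and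
    | |- Delta (fun e => _ \/ _) => apply: Delta_or
    | |- Delta (fun e => ~ _) => apply: Delta_not
    | |- Delta (fun e => forall y, nlt y _ -> _) => apply: Delta_ball
    | |- Delta (fun e => exists y, nlt y _ /\ _) => apply: Delta_bex
    | |- Delta (fun e => _ -> _) => apply: Delta_imp
    | |- Sigma (fun e => forall y, nlt y _ -> _) => apply: Sigma_ball
    | |- Sigma (fun e => exists y, _) => apply: Sigma_ex
    | |- Sigma (fun e => _ /\ _) => apply: Sigma_and
    | |- Sigma (fun e => _ \/ _) => apply: Sigma_or
    | |- Sigma (fun e => _) => apply: Delta_Sigma
    end
  | apply: Fn_const
  | apply: Delta_const
  | match goal with
    | H : forall s, Fn s -> _ |- _ => apply: H
    | H : forall s t, Fn s -> Fn t -> _ |- _ => apply: H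
    end
  | defn_ext ].
Ltac defn := intros; repeat defn_step.

(** * Remainders, pairs and finite sequences *)

Section Coding.
Variable M : model.
Local Open Scope num_scope.
Add Ring model_ring : (num_semiring M).
Implicit Types (x y z a b m q i j k l : M).

Lemma nzero_or_pos x : x = 0 \/ 0 < x.
Proof. by case: (ntotal 0 x) => [|[|]]; [right|left|move=> h; exfalso; arith]. Qed.

Lemma pos_succ x : 0 < x -> exists y, x = y + 1.
Proof. by rewrite nltE => -[y ->]; exists y; rewrite nadd0. Qed.

(** Discreteness: a nonzero multiple of [m] exceeds all remainders. *)
Lemma quotient_unique q q' m y y' : q * m + y = q' * m + y' -> y < m -> y' < m ->
  q = q' /\ y = y'.
Proof.
wlog le : q q' y y' / q <= q' => [th e ym y'm|].
  case: (nle_total q q') => h; first exact: th.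
  by have [-> ->] := th _ _ _ _ h (esym e) y'm ym.
move/nleE: le => [u ->] e ym _.
case: (nzero_or_pos u) => [u0|/pos_succ[v uv]].
  by move: e; rewrite u0; split; arith.
have : q * m + y = q * m + v * m + m + y' by rewrite e uv; ring.
by move=> h; exfalso; arith.
Qed.

Definition rem a m : M := mu (fun y => m = 0 \/ y < m /\ exists q, q < a + 1 /\ a = q * m + y).

Lemma division a m : 0 < m -> exists q y, y < m /\ a = q * m + y.
Proof.
move=> m0; have : exists q, exists y, y < m /\ a = q * m + y.
  elim/(@Sigma_ind M): a => [||a [q [y [ym ->]]]].
  - by defn.
  - by exists 0, 0; split=> //; ring.
  - case: (pselect (y + 1 < m)) => h; first by exists q, (y + 1); split=> //; ring.
    exists (q + 1), 0; split=> //.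
    have -> : m = y + 1 by arith.
    ring.
by move=> [q [y h]]; exists q, y.
Qed.

Lemma rem_total a m : exists y, m = 0 \/ y < m /\ exists q, q < a + 1 /\ a = q * m + y.
Proof.
case: (nzero_or_pos m) => [->|/[dup] m0 /(division a)[q [y [ym e]]]]; first by exists 0; left.
exists y; right; split=> //; exists q; split=> //.
case: (pos_succ m0) => m' em; rewrite em in e.
by narith.
Qed.

Lemma Fn_rem (s t : env M -> M) : Fn s -> Fn t -> Fn (fun e : env M => rem (s e) (t e)).
Proof.
apply: Fn_comp2; apply: Fn_mu => [|e]; last exact: rem_total.
by defn.
Qed.

Lemma rem_eq a m q y : a = q * m + y -> y < m -> rem a m = y.
Proof.
move=> e ym.
have [|] := @mu_least M (fun y => m = 0 \/ y < m /\ exists q, q < a + 1 /\ a = q * m + y) _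
  (rem_total a m); first by defn.
rewrite -/(rem a m) => -[m0|[h [q' [_ e']]]] _; first by exfalso; arith.
by have [] := @quotient_unique q q' m y (rem a m); rewrite -?e -?e'.
Qed.

Lemma remP a m : 0 < m -> rem a m < m /\ exists q, a = q * m + rem a m.
Proof.
by case/(division a) => q [y [ym e]]; rewrite (rem_eq e ym); split=> //; exists q.
Qed.

Definition pr i j : M := (i + j) * (i + j) + i.

(** The sum [i + j] is determined as the integer part of the square root. *)
Lemma pr_inj i j i' j' : pr i j = pr i' j' -> i = i' /\ j = j'.
Proof.
rewrite /pr; wlog le : i j i' j' / i + j <= i' + j' => [th e|].
  case: (nle_total (i + j) (i' + j')) => h; first exact: th.
  by have [-> ->] := th _ _ _ _ h (esym e).
move/nleE: le => [u eu] e.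
case: (nzero_or_pos u) => [u0|/pos_succ[v uv]].
  by rewrite eu u0 in e; split; arith.
rewrite eu uv in e; exfalso.
by narith.
Qed.

(** * Goedel's beta function *)

Definition beta a b i : M := rem a (b * (i + 1) + 1).

Lemma Fn_beta (s t u : env M -> M) : Fn s -> Fn t -> Fn u -> Fn (fun e => beta (s e) (t e) (u e)).
Proof. by move=> ? ? ?; apply: Fn_rem; defn. Qed.

Lemma bounded (F : M -> M) l : Fn (fun e => F (e 0%nat)) ->
  exists B, forall i, i < l -> F i < B.
Proof.
move=> hF; elim/(@Sigma_ind M): l => [||l [B IH]].
- by defn; apply: Fn_comp1 hF _; defn.
- by exists 0 => i; arith.
- exists (B + F l + 1) => i il; case: (pselect (i < l)) => [/IH|ni]; first by arith.
  have -> : i = l by arith.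
  by arith.
Qed.

(** A substitute for the factorial, which is not available before primitive recursion. *)
Lemma common_multiple l B : exists b, B < b /\
  forall d, 0 < d -> d <= l -> exists c, b = d * c.
Proof.
have [b [h h']] : exists b, B < b /\ forall d, d < l + 1 -> 0 < d -> exists c, b = d * c.
  elim/(@Sigma_ind M): l => [||l [b [Bb IH]]].
  - apply: Sigma_ex; apply: Sigma_and; first by defn.
    apply: Sigma_ball; first by defn.
    apply: (@Sigma_ext _ (fun e => e 0%nat = 0 \/ exists c, e 1%nat = e 0%nat * c)); last by defn.
    move=> e; case: (nzero_or_pos (e 0%nat)) => h; split=> //.
    + by rewrite h => _ ?; exfalso; arith.
    + by move=> _; left.
    + by move=> [h'|//] _; exfalso; arith.
    + by right; auto.
  - exists (B + 1); split; first by arith.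
    by move=> d ? ?; exfalso; arith.
  - exists (b * (l + 1)); split; first by narith.
    move=> d dl d0; case: (pselect (d < l + 1)) => [/IH/(_ d0)[c ->]|nd].
      by exists (c * (l + 1)); ring.
    have -> : d = l + 1 by arith.
    by exists b; ring.
by exists b; split=> // d d0 dl; apply: h'; arith.
Qed.

(** Modulo the larger modulus [m], the product [b * (i + d + 1)] is -1, so [b] and its divisor
    [d] are units.  The smaller modulus differs from [m] by [b * d], hence is a unit as well;
    multiplying the inverses gives the explicit witness. *)
Lemma moduli_coprime b c d i : 0 < d -> b = d * c -> 0 < b ->
  exists x y, (b * (i + 1) + 1) * x = (b * (i + d + 1) + 1) * y + 1.
Proof.
move=> d0 -> b0; set u := i + d + 1.
have [w ew] : exists w, d * c * u = w + 1.
  by apply: pos_succ; rewrite /u; narith.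
exists (d * c * u * (u * u * c)), (d * c * (i + 1) * (u * u * c) + w).
set v := d * c * (i + 1); set k := u * u * c.
have e : (w + 1) * k = v * k + (w + 1) * (w + 1).
  by rewrite -ew /k /v /u; ring.
rewrite ew; transitivity (v * (w + 1) * k + (w + 1) * k); first by ring.
by rewrite e; ring.
Qed.

(** Chinese remaindering, one modulus at a time.  The number [P] of the invariant is a multiple
    of the moduli already treated, so that adding multiples of [P] to [a] preserves the
    remainders found so far, and is invertible modulo those to come, so that some multiple
    corrects the next remainder. *)
Lemma beta_exists (F : M -> M) l : Fn (fun e => F (e 0%nat)) ->
  exists a b, forall i, i < l -> beta a b i = F i.
Proof.
move=> hF.
have hF' s : Fn s -> Fn (fun e => F (s e)) := Fn_comp1 hF.
have [B hB] := bounded l hF.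
have [b [Bb hb]] := common_multiple l B.
pose m i := b * (i + 1) + 1.
have Fm i : i < l -> F i < m i.
  by move=> /hB h; rewrite /m; narith.
have m0 i : 0 < m i by rewrite /m; arith.
pose invariant k a P :=
  (forall i, i < k -> beta a b i = F i /\ exists c, P = m i * c) /\
  (forall j, j < l -> k <= j -> exists x y, P * x = m j * y + 1).
have cop i j : i < j -> j < l -> exists x y, m i * x = m j * y + 1.
  move=> ij jl; have [d ed] : exists d, j = i + (d + 1).
    by move/nltE: ij => -[d ->]; exists d; ring.
  have [c ec] : exists c, b = (d + 1) * c by apply: hb; arith.
  rewrite ed /m; apply: (@moduli_coprime b c (d + 1) i) => //; arith.
have [|a [P [h _]]] : l <= l -> exists a P, invariant l a P; [|by right|by exists a, b => i /h[]].
elim/(@Sigma_ind M): {1 3}l => [||k IH kl].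
  - have hm (s : env M -> M) : Fn s -> Fn (fun e => m (s e)) by rewrite /m; defn.
    have hbeta (s t : env M -> M) : Fn s -> Fn t -> Fn (fun e => beta (s e) b (t e)).
      by move=> ? ?; apply: Fn_beta; defn.
    apply: (@Sigma_ext _ (fun e => l < e 0%nat \/ exists a P, invariant (e 0%nat) a P)).
      move=> e; rewrite -nnot_le; split=> [[//|//]|h].
      by case: (pselect (e 0%nat <= l)) => [/h|]; [right|left].
    apply: Sigma_or; first by defn.
    do 2 apply: Sigma_ex; apply: Sigma_and; last apply: Sigma_ball.
    + defn; try (apply: hF'; defn); try (apply: hm; defn); try (apply: hbeta; defn).
    + by defn.
    + apply: (@Sigma_ext _ (fun e => e 0%nat < e 3%nat \/ exists x y, e 1%nat * x = m (e 0%nat) * y + 1)).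
        move=> e; rewrite /tl -nnot_le; split=> [[//|//]|h].
        by case: (pselect (e 3%nat <= e 0%nat)) => [/h|]; [right|left].
      by defn; apply: hm; defn.
  - exists 0, 1; split=> [i|j _ _]; first by arith.
    by exists 1, 0; ring.
  - have [|a [P [h h']]] := IH; first by arith.
    have [|x [y exy]] := h' k _ (or_intror erefl); first by arith.
    exists (a + P * (x * (F k + b * (k + 1) * a))), (P * m k); split.
      move=> i ik; case: (pselect (i < k)) => ik'.
        have [eb [c ec]] := h i ik'; split; last first.
          by exists (c * m k); rewrite ec; ring.
        have [_ [q eq]] := remP a (m0 i).
        apply: (@rem_eq _ _ (q + c * (x * (F k + b * (k + 1) * a)))); last by apply: Fm; arith.
        rewrite {1}eq -/(m i) -eb /beta -/(m i) ec; ring.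
      have -> : i = k by arith.
      split; last by exists P; ring.
      apply: (@rem_eq _ _ (a + y * (F k + b * (k + 1) * a))); last by apply: Fm; arith.
      rewrite -/(m k); transitivity (a + (P * x) * (F k + b * (k + 1) * a)); first by ring.
      by rewrite exy /m; ring.
    move=> j jl kj; have [||x' [y' e']] := cop k j; try by arith.
    have [|x1 [y1 e1]] := h' j jl; first by arith.
    exists (x1 * x'), (m j * y1 * y' + y1 + y').
    transitivity ((P * x1) * (m k * x')); first by ring.
    by rewrite e1 e'; ring.
Qed.
End Coding.

(** * Finite sequences and strings *)

Section Sequences.
Variable M : model.
Local Open Scope num_scope.
Add Ring model_ring' : (num_semiring M).
Implicit Types (x y z a b m q i j k l p s t : M).

(** A name that ends in an underscore is the meaning in the model of the formula of that
    name; the lemmas that follow replace it by an equivalent Delta relation. *)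
Definition Rem_ a m y : Prop := y < m /\ exists q, a = q * m + y.
Definition Len_ s l : Prop := exists a b, s = pr l (pr a b).
Definition Entry_ s i y : Prop :=
  exists l a b, s = pr l (pr a b) /\ i < l /\ Rem_ a (b * (i + 1) + 1) y.
Definition SameSeq_ s t : Prop :=
  exists l, Len_ s l /\ Len_ t l /\ forall i y, Entry_ s i y <-> Entry_ t i y.
Definition Seq_ s : Prop := (exists l, Len_ s l) /\ forall t, t < s -> ~ SameSeq_ t s.
Definition Str_ s : Prop := Seq_ s /\ forall i y, Entry_ s i y -> y < 1 + 1.
Definition Prefix_ s t : Prop :=
  Str_ s /\ Str_ t /\ forall i y, Entry_ s i y -> Entry_ t i y.

Lemma pr_bound i j : i <= pr i j /\ j <= pr i j.
Proof.
rewrite /pr; case: (nzero_or_pos (i + j)) => [h|/pos_succ[k h]].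
  by split; rewrite h; arith.
rewrite h; split; narith.
Qed.

Lemma Fn_pr (s t : env M -> M) : Fn s -> Fn t -> Fn (fun e => pr (s e) (t e)).
Proof. by rewrite /pr; defn. Qed.

(** The disjunct for numbers that code no pair makes the projections total. *)
Definition is_pr p := exists i, i < p + 1 /\ exists j, j < p + 1 /\ p = pr i j.
Definition pr1 p : M := mu (fun i => ~ is_pr p \/ exists j, j < p + 1 /\ p = pr i j).
Definition pr2 p : M := mu (fun j => ~ is_pr p \/ exists i, i < p + 1 /\ p = pr i j).

Lemma Delta_is_pr (s : env M -> M) : Fn s -> Delta (fun e => is_pr (s e)).
Proof.
apply: Delta_pred1; rewrite /is_pr.
have h (s' t' : env M -> M) : Fn s' -> Fn t' -> Fn (fun e => pr (s' e) (t' e)) := @Fn_pr _ _.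
by defn.
Qed.

Lemma pr1_total p : exists i, ~ is_pr p \/ exists j, j < p + 1 /\ p = pr i j.
Proof.
by case: (pselect (is_pr p)) => [[i [_ h]]|h]; [exists i; right|exists 0; left].
Qed.
Lemma pr2_total p : exists j, ~ is_pr p \/ exists i, i < p + 1 /\ p = pr i j.
Proof.
case: (pselect (is_pr p)) => [[i [h [j [_ e]]]]|h]; last by exists 0; left.
by exists j; right; exists i.
Qed.

Local Ltac defn_ext ::= lazymatch goal with
  | |- Fn (fun e => pr _ _) => apply: Fn_pr
  | |- Delta (fun e => is_pr _) => apply: Delta_is_pr
  end.

Lemma Delta_pr1 : Delta (fun e : env M =>
  ~ is_pr (e 1%nat) \/ exists j, j < e 1%nat + 1 /\ e 1%nat = pr (e 0%nat) j).
Proof. by defn. Qed.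
Lemma Delta_pr2 : Delta (fun e : env M =>
  ~ is_pr (e 1%nat) \/ exists i, i < e 1%nat + 1 /\ e 1%nat = pr i (e 0%nat)).
Proof. by defn. Qed.

Lemma Fn_pr1 (s : env M -> M) : Fn s -> Fn (fun e => pr1 (s e)).
Proof.
apply: Fn_comp1; apply: Fn_mu => [|e]; [exact: Delta_pr1|exact: pr1_total].
Qed.
Lemma Fn_pr2 (s : env M -> M) : Fn s -> Fn (fun e => pr2 (s e)).
Proof.
apply: Fn_comp1; apply: Fn_mu => [|e]; [exact: Delta_pr2|exact: pr2_total].
Qed.

Lemma is_pr_pr i j : is_pr (pr i j).
Proof.
have [h h'] := pr_bound i j.
by exists i; split; [arith|exists j; split=> //; arith].
Qed.

Lemma pr1_pr i j : pr1 (pr i j) = i.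
Proof.
have [||[h|[j' [_ /pr_inj[e e']]]] _] := @mu_least M
  (fun i' => ~ is_pr (pr i j) \/ exists j', j' < pr i j + 1 /\ pr i j = pr i' j').
- by defn.
- exact: pr1_total.
- by case: h; apply: is_pr_pr.
- by [].
Qed.
Lemma pr2_pr i j : pr2 (pr i j) = j.
Proof.
have [||[h|[j' [_ /pr_inj[e e']]]] _] := @mu_least M
  (fun j' => ~ is_pr (pr i j) \/ exists i', i' < pr i j + 1 /\ pr i j = pr i' j').
- by defn.
- exact: pr2_total.
- by case: h; apply: is_pr_pr.
- by [].
Qed.

Definition is_seq s := is_pr s /\ is_pr (pr2 s).
Definition len s := pr1 s.
Definition ent s i := beta (pr1 (pr2 s)) (pr2 (pr2 s)) i.

Lemma Delta_is_seq (s : env M -> M) : Fn s -> Delta (fun e => is_seq (s e)).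
Proof. by move=> ?; apply: Delta_and; apply: Delta_is_pr => //; apply: Fn_pr2. Qed.
Lemma Fn_len (s : env M -> M) : Fn s -> Fn (fun e => len (s e)). Proof. exact: Fn_pr1. Qed.
Lemma Fn_ent (s t : env M -> M) : Fn s -> Fn t -> Fn (fun e => ent (s e) (t e)).
Proof.
by move=> ? ?; apply: Fn_beta => //; [apply: Fn_pr1; apply: Fn_pr2|do 2 apply: Fn_pr2].
Qed.

Lemma is_seqE s : is_seq s <-> exists l a b, s = pr l (pr a b).
Proof.
split=> [[]|[l [a [b ->]]]]; last by rewrite /is_seq pr2_pr; split; apply: is_pr_pr.
by move=> [l [_ [j [_ ->]]]]; rewrite pr2_pr => -[a [_ [b [_ ->]]]]; exists l, a, b.
Qed.

Lemma LenE s l : Len_ s l <-> is_seq s /\ l = len s.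
Proof.
split=> [[a [b ->]]|[/is_seqE[l' [a [b ->]]]]]; last by rewrite /len pr1_pr => ->; exists a, b.
by rewrite is_seqE /len pr1_pr; split=> //; exists l, a, b.
Qed.

Lemma EntryE s i y : Entry_ s i y <-> [/\ is_seq s, i < len s & y = ent s i].
Proof.
split=> [[l [a [b [-> [il [h [q e]]]]]]]|[/is_seqE[l [a [b ->]]]]].
  rewrite /len /ent /beta pr2_pr !pr1_pr pr2_pr (rem_eq e h).
  by split=> //; apply/is_seqE; exists l, a, b.
rewrite /len /ent /beta pr2_pr !pr1_pr pr2_pr => il ->; exists l, a, b; split=> //; split=> //.
by apply: remP; arith.
Qed.

Definition same s t := [/\ is_seq s, is_seq t, len s = len t &
  forall i, i < len s -> ent s i = ent t i].

Lemma SameSeqE s t : SameSeq_ s t <-> same s t.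
Proof.
split.
  move=> [l [/LenE[hs ->] [/LenE[ht e] h]]]; split=> // i il.
  by have /h/EntryE[] : Entry_ s i (ent s i) by apply/EntryE.
move=> [hs ht e h]; exists (len s); split; first exact/LenE.
split=> [|i y]; first exact/LenE.
by rewrite !EntryE -e; split=> -[_ il ->]; split=> //; rewrite h.
Qed.

(** Minimality of the code, with the comparison of sequences in bounded form. *)
Definition is_str s := is_seq s /\ (forall t, t < s ->
  ~ (is_seq t /\ len s = len t /\ forall i, i < len s -> ent s i = ent t i)) /\
  forall i, i < len s -> ent s i < 1 + 1.

Lemma StrE s : Str_ s <-> is_str s.
Proof.
rewrite /Str_ /Seq_; split.
  move=> [[[l /LenE[hs _]] h] h']; split=> //; split=> [t ts [ht [e he]]|i il].
    by apply: (h t ts); apply/SameSeqE; split=> // i; rewrite -e => /he.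
  by apply: (h' i); apply/EntryE.
move=> [hs [h h']]; split; last by move=> i y /EntryE[_ il ->]; apply: h'.
split=> [|t ts /SameSeqE[ht _ e he]]; first by exists (len s); apply/LenE.
by apply: (h t ts); split=> //; split=> // i il; rewrite he // e.
Qed.

Local Ltac defn_ext ::= lazymatch goal with
  | |- Fn (fun e => ent _ _) => apply: Fn_ent
  | |- Fn (fun e => len _) => apply: Fn_len
  | |- Delta (fun e => is_seq _) => apply: Delta_is_seq
  end.

Lemma Delta_is_str (s : env M -> M) : Fn s -> Delta (fun e => is_str (s e)).
Proof. by apply: Delta_pred1; rewrite /is_str; defn. Qed.

(** The entries of a string are used through the set of positions of the value 1. *)
Definition bit s i := ent s i = 1.

Lemma Delta_bit (s t : env M -> M) : Fn s -> Fn t -> Delta (fun e => bit (s e) (t e)).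
Proof. by rewrite /bit; defn. Qed.

Lemma str_bit s i : is_str s -> i < len s -> ~ bit s i -> ent s i = 0.
Proof.
move=> [_ [_ h]] /h lt ne; have [//|] := nzero_or_pos (ent s i) => h'.
by case: ne; rewrite /bit; arith.
Qed.

(** Strings are determined by their bits, since a string is the least code of its entries. *)
Lemma str_ext s t : is_str s -> is_str t -> len s = len t ->
  (forall i, i < len s -> bit s i <-> bit t i) -> s = t.
Proof.
move=> hs ht e h.
have E i : i < len s -> ent s i = ent t i.
  move=> il; have il' : i < len t by rewrite -e.
  case: (pselect (bit s i)) => [/[dup] b1 /h b2|b1]; first by rewrite b1 b2.
  by rewrite !str_bit // -h.
case: hs ht => [ss [ms _]] [st [mt _]]; apply: num_eq_contra => lt.
  by apply: (mt _ lt); split=> //; split=> // i; rewrite -e => /E.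
by apply: (ms _ lt).
Qed.

Lemma seq_exists (F : M -> M) l : Fn (fun e => F (e 0%nat)) ->
  exists s, [/\ is_seq s, len s = l & forall i, i < l -> ent s i = F i].
Proof.
move=> hF; have [a [b h]] := beta_exists l hF; exists (pr l (pr a b)).
split; [|exact: pr1_pr|move=> i il].
  by apply/is_seqE; exists l, a, b.
by rewrite /ent pr2_pr pr1_pr pr2_pr h.
Qed.

Lemma str_exists (P : M -> Prop) l : Delta (fun e => P (e 0%nat)) ->
  exists s, is_str s /\ len s = l /\ forall i, i < l -> bit s i <-> P i.
Proof.
move=> hP.
pose Q s := is_seq s /\ len s = l /\ forall i, i < l -> ent s i = if `[< P i >] then 1 else 0.
have hP' (s : env M -> M) : Fn s -> Delta (fun e => P (s e)) := Delta_pred1 hP.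
have [||s [[ss [ls es]] ms]] := @Delta_least M Q.
- by rewrite /Q; defn.
- have [|s [h h' h'']] := @seq_exists (fun i => if `[< P i >] then 1 else 0) l.
    by defn.
  by exists s.
exists s; split; last first.
  split=> // i /es; rewrite /bit => ->; case: asboolP => // h; split=> // h'; exfalso; arith.
split=> //; split=> [t ts [st [e h]]|i].
  by apply: (ms t ts); split=> //; split=> [|i il]; [rewrite -e|rewrite -h ?es ?ls].
by rewrite ls => /es ->; case: ifP => _; arith.
Qed.

Definition strof (P : M -> Prop) l : M :=
  mu (fun s => is_str s /\ len s = l /\ forall i, i < l -> bit s i <-> P i).

Lemma strofP (P : M -> Prop) l : Delta (fun e => P (e 0%nat)) ->
  [/\ is_str (strof P l), len (strof P l) = l & forall i, i < l -> bit (strof P l) i <-> P i].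
Proof.
move=> hP; have hP' (s : env M -> M) : Fn s -> Delta (fun e => P (s e)) := Delta_pred1 hP.
have [||[h1 [h2 h3]] _] := @mu_least M
   (fun s => is_str s /\ len s = l /\ forall i, i < l -> bit s i <-> P i) => //.
  by rewrite /bit; defn; apply: Delta_is_str; defn.
exact: str_exists.
Qed.

Lemma Fn_strof (P : env M -> M -> Prop) (t : env M -> M) :
  Delta (fun e => P (tl e) (e 0%nat)) -> Fn t -> Fn (fun e => strof (P e) (t e)).
Proof.
move=> hP ht; apply: Fn_mu => [|e]; last by apply: str_exists; apply: Delta_at hP.
apply: Delta_and; first by apply: Delta_is_str; defn.
apply: Delta_and; first by defn; apply: (Fn_tl ht).
apply: Delta_ball; first exact: (Fn_tl ht).
apply: Delta_iff; first by rewrite /bit; defn.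
by apply: (Delta_at1 (sg := fun e => tl (tl e)) hP) => [i|]; [exact: Tm_var|defn].
Qed.
End Sequences.

(** * Primitive recursion and string operations *)

Ltac defn_ext ::= lazymatch goal with
  | |- Fn (fun e => pr _ _) => apply: Fn_pr
  | |- Fn (fun e => ent _ _) => apply: Fn_ent
  | |- Fn (fun e => len _) => apply: Fn_len
  | |- Delta (fun e => is_pr _) => apply: Delta_is_pr
  | |- Delta (fun e => is_seq _) => apply: Delta_is_seq
  | |- Delta (fun e => is_str _) => apply: Delta_is_str
  | |- Delta (fun e => bit _ _) => apply: Delta_bit
  end.

Section Recursion.
Variable M : model.
Local Open Scope num_scope.
Add Ring model_ring'' : (num_semiring M).
Implicit Types (x y z a b m q i j k l p s t u : M).

(** Taking the least code makes the course of values definable by minimization. *)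
Definition course (G : M -> M -> M) a i : M := mu (fun s => is_seq s /\ len s = i + 1 /\
  ent s 0 = a /\ forall j, j < i -> ent s (j + 1) = G j (ent s j)).
Definition recn (G : M -> M -> M) a i : M := ent (course G a i) i.

Lemma course_exists (G : M -> M -> M) a i : Fn (fun e => G (e 0%nat) (e 1%nat)) ->
  exists s, is_seq s /\ len s = i + 1 /\
  ent s 0 = a /\ forall j, j < i -> ent s (j + 1) = G j (ent s j).
Proof.
move=> hG; have hG' (s t : env M -> M) : Fn s -> Fn t -> Fn (fun e => G (s e) (t e)) := Fn_comp2 hG.
elim/(@Sigma_ind M): i => [||i [s [_ [ls [s0 IH]]]]].
- by defn.
- have [|s [h1 h2 h3]] := @seq_exists M (fun _ => a) (0 + 1); first by defn.
  by exists s; split=> //; split=> //; split=> [|j]; [apply: h3; arith|arith].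
- have [|t [h1 h2 h3]] := @seq_exists M
    (fun j => if `[< j < i + 1 >] then ent s j else G i (ent s i)) (i + 1 + 1).
    by defn.
  exists t; split=> //; split=> //; split=> [|j ji].
    by rewrite h3; [case: asboolP => // h; exfalso; arith|arith].
  rewrite !h3; try arith.
  case: asboolP => h; case: asboolP => h'; try by (exfalso; arith).
    by apply: IH; arith.
  by have -> : j = i by arith.
Qed.

Lemma courseP (G : M -> M -> M) a i : Fn (fun e => G (e 0%nat) (e 1%nat)) ->
  let s := course G a i in is_seq s /\ len s = i + 1 /\
  ent s 0 = a /\ forall j, j < i -> ent s (j + 1) = G j (ent s j).
Proof.
move=> hG; have hG' (s t : env M -> M) : Fn s -> Fn t -> Fn (fun e => G (s e) (t e)) := Fn_comp2 hG.
have [||h _] := @mu_least M (fun s => is_seq s /\ len s = i + 1 /\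
  ent s 0 = a /\ forall j, j < i -> ent s (j + 1) = G j (ent s j)); last exact: h.
  by defn.
exact: course_exists.
Qed.

Lemma course_recn G a i j : Fn (fun e => G (e 0%nat) (e 1%nat)) -> j <= i ->
  ent (course G a i) j = recn G a j.
Proof.
move=> hG ji; have [_ [_ [h0 hS]]] := courseP a i hG.
have [_ [_ [k0 kS]]] := courseP a j hG.
have H l : l <= j -> ent (course G a i) l = ent (course G a j) l.
  elim/(@Sigma_ind M): l => [||l IH lj]; first by defn.
  - by rewrite h0 k0.
  - by rewrite hS ?kS ?IH //; arith.
by apply: H; right.
Qed.

Lemma recn0 G a : Fn (fun e => G (e 0%nat) (e 1%nat)) -> recn G a 0 = a.
Proof. by move=> hG; have [_ [_ [h0 _]]] := courseP a 0 hG. Qed.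

Lemma recnS G a i : Fn (fun e => G (e 0%nat) (e 1%nat)) ->
  recn G a (i + 1) = G i (recn G a i).
Proof.
move=> hG; have [_ [_ [_ hS]]] := courseP a (i + 1) hG.
rewrite [LHS]/recn hS; last by arith.
by rewrite course_recn //; arith.
Qed.

Lemma Fn_at (G : env M -> M -> M -> M) e : Fn (fun e => G (tl (tl e)) (e 0%nat) (e 1%nat)) ->
  Fn (fun e' : env M => G e (e' 0%nat) (e' 1%nat)).
Proof.
move=> h; apply: (Fn_at2 (sg := fun=> e) h) => [i||]; first exact: Tm_const.
  exact: Fn_var.
exact: Fn_var.
Qed.

(** Uniformity: the step function and the initial value may depend on further variables. *)
Lemma Fn_recn (G : env M -> M -> M -> M) (a i : env M -> M) :
  Fn (fun e => G (tl (tl e)) (e 0%nat) (e 1%nat)) -> Fn a -> Fn i ->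
  Fn (fun e => recn (G e) (a e) (i e)).
Proof.
move=> hG ha hi; apply: Fn_ent => //; apply: Fn_mu => [|e]; last first.
  by apply: course_exists; apply: Fn_at hG.
have := Fn_tl hi; have := Fn_tl ha; have := Fn_tl (Fn_tl hi).
move=> hi2 ha1 hi1; defn.
by apply: (Fn_at2 (sg := fun e => tl (tl e)) hG) => [j||]; [exact: Tm_var|defn..].
Qed.

Lemma recn_ext G G' a i : Fn (fun e => G (e 0%nat) (e 1%nat)) ->
  Fn (fun e => G' (e 0%nat) (e 1%nat)) -> (forall j u, j < i -> G j u = G' j u) ->
  recn G a i = recn G' a i.
Proof.
move=> hG hG' h.
have H j : j <= i -> recn G a j = recn G' a j.
  elim/(@Sigma_ind M): j => [||j IH ji].
  - by defn; apply: Fn_recn; defn.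
  - by rewrite !recn0.
  - by rewrite !recnS // IH ?h //; arith.
by apply: H; right.
Qed.

(** ** Powers of two and counting *)

Definition pow2 : M -> M := recn (fun _ u => (1 + 1) * u) 1.

Lemma Fn_pow2 (s : env M -> M) : Fn s -> Fn (fun e => pow2 (s e)).
Proof. by move=> ?; apply: Fn_recn => //; defn. Qed.
Lemma pow2_0 : pow2 0 = 1. Proof. by apply: recn0; defn. Qed.
Lemma pow2_S i : pow2 (i + 1) = (1 + 1) * pow2 i. Proof. by apply: recnS; defn. Qed.
Lemma pow2_gt0 i : 0 < pow2 i.
Proof.
elim/(@Sigma_ind M): i => [||i]; rewrite ?pow2_0 ?pow2_S; first by defn; apply: Fn_pow2; defn.
all: arith.
Qed.
Lemma pow2_add i j : pow2 (i + j) = pow2 i * pow2 j.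
Proof.
elim/(@Sigma_ind M): j => [||j].
- by defn; apply: Fn_pow2; defn.
- by rewrite pow2_0 -[i + 0]naddC nadd0; ring.
- by rewrite naddA !pow2_S => ->; ring.
Qed.

Definition cnt (P : M -> Prop) l := recn (fun x u => if `[< P x >] then u + 1 else u) 0 l.

Lemma Fn_cnt (P : env M -> M -> Prop) (l : env M -> M) :
  Delta (fun e => P (tl e) (e 0%nat)) -> Fn l -> Fn (fun e => cnt (P e) (l e)).
Proof.
move=> hP hl; apply: Fn_recn => //; last by defn.
apply: Fn_if; [|defn..].
apply: (Delta_at1 (sg := fun e => tl (tl e)) hP) => [i|]; [exact: Tm_var|exact: Fn_var].
Qed.

Lemma cnt_def (P : M -> Prop) : Delta (fun e => P (e 0%nat)) ->
  Fn (fun e => if `[< P (e 0%nat) >] then e 1%nat + 1 else e 1%nat).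
Proof. by move=> h; defn. Qed.
Lemma cnt0 P : Delta (fun e => P (e 0%nat)) -> cnt P 0 = 0.
Proof. by move=> hP; apply: recn0; apply: cnt_def hP. Qed.
Lemma cntS P l : Delta (fun e => P (e 0%nat)) ->
  cnt P (l + 1) = if `[< P l >] then cnt P l + 1 else cnt P l.
Proof. by move=> hP; rewrite {1}/cnt recnS //; apply: cnt_def hP. Qed.

(** The only property of counting that is needed: a new element increases the count. *)
Lemma cnt_lt (P Q : M -> Prop) y l :
  Delta (fun e => P (e 0%nat)) -> Delta (fun e => Q (e 0%nat)) ->
  (forall x, P x -> Q x) -> ~ P y -> Q y -> y < l -> cnt P l + 1 <= cnt Q l.
Proof.
move=> hP hQ PQ Py Qy yl.
have hcP (s : env M -> M) : Fn s -> Fn (fun e => cnt P (s e)).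
  by move=> hs; apply: (Fn_cnt (P := fun _ => P)).
have hcQ (s : env M -> M) : Fn s -> Fn (fun e => cnt Q (s e)).
  by move=> hs; apply: (Fn_cnt (P := fun _ => Q)).
have [_ h] : cnt P l <= cnt Q l /\ (y < l -> cnt P l + 1 <= cnt Q l); last exact: h.
elim/(@Sigma_ind M): {yl}l => [||l [IH IH']].
- by defn.
- by rewrite !cnt0 //; split; arith.
- rewrite !cntS //; case: (asboolP (P l)) => hl; case: (asboolP (Q l)) => hl'.
  + split=> [|yl]; first by arith.
    have /IH' : y < l by case: (ntotal y l) => [//|[e|]]; [case: Py; rewrite e|arith].
    by arith.
  + by case: hl'; apply: PQ.
  + split=> [|yl]; first by arith.
    by arith.
  + split=> [//|yl]; apply: IH'.
    by case: (ntotal y l) => [//|[e|]]; [case: hl'; rewrite -e|arith].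
Qed.
End Recursion.

(** * Strings *)

Section Strings.
Variable M : model.
Local Open Scope num_scope.
Add Ring model_ring3 : (num_semiring M).
Implicit Types (x y z a b m n q i j k l p s t u v : M).

Definition minus a b : M := mu (fun d => a = b + d \/ a < b).

Lemma minus_total a b : exists d, a = b + d \/ a < b.
Proof.
case: (pselect (a < b)) => [h|/nnot_lt/nleE[d ->]]; first by exists 0; right.
by exists d; left.
Qed.

Lemma Fn_minus (s t : env M -> M) : Fn s -> Fn t -> Fn (fun e => minus (s e) (t e)).
Proof. by apply: Fn_comp2; apply: Fn_mu => [|e]; [defn|exact: minus_total]. Qed.

Lemma minusK a b : b <= a -> b + minus a b = a.
Proof.
move=> ba; have [||[//|h] _] := @mu_least M (fun d => a = b + d \/ a < b).
- by defn.
- exact: minus_total.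
by exfalso; arith.
Qed.

Lemma is_str_seq s : is_str s -> is_seq s. Proof. by case. Qed.

Lemma len_le_code s : is_seq s -> len s <= s.
Proof.
by move/is_seqE => [l [a [b ->]]]; rewrite /len pr1_pr; case: (pr_bound l (pr a b)).
Qed.

Definition pre s t :=
  is_str s /\ is_str t /\ len s <= len t /\ forall i, i < len s -> (bit s i <-> bit t i).

Lemma Delta_pre (s t : env M -> M) : Fn s -> Fn t -> Delta (fun e => pre (s e) (t e)).
Proof. by apply: Delta_pred2; rewrite /pre; defn. Qed.

Lemma PrefixE s t : Prefix_ s t <-> pre s t.
Proof.
rewrite /Prefix_ !StrE; split=> -[hs [ht h]]; split=> //; split=> //.
  have E i : i < len s -> i < len t /\ ent s i = ent t i.
    move=> il; have /h/EntryE[] // : Entry_ s i (ent s i).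
    by apply/EntryE; split=> //; apply: is_str_seq.
  split=> [|i /E[_ e]]; last by rewrite /bit e.
  case: (nzero_or_pos (len s)) => [->|/pos_succ[l el]]; first by arith.
  by case: (E l); arith.
move=> i y /EntryE[_ il ->]; apply/EntryE; split.
- exact: is_str_seq.
- by case: h => h _; arith.
- case: h => h /(_ i il) e; case: (pselect (bit s i)) => b.
    by rewrite b; symmetry; apply/e.
  rewrite !str_bit // -?e //; arith.
Qed.

Lemma pre_refl s : is_str s -> pre s s.
Proof. by move=> h; split=> //; split=> //; split=> //; right. Qed.

Lemma pre_trans t s u : pre s t -> pre t u -> pre s u.
Proof.
move=> [hs [ht [l h]]] [_ [hu [l' h']]]; split=> //; split=> //; split=> [|i il]; first by arith.
by rewrite h // h' //; arith.
Qed.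

Lemma pre_same_len s t : pre s t -> len t <= len s -> s = t.
Proof.
move=> [hs [ht [l h]]] l'; apply: str_ext => //.
exact: nle_anti.
Qed.

Lemma pre_common s t u : pre s u -> pre t u -> len s <= len t -> pre s t.
Proof.
move=> [hs [hu [l h]]] [ht [_ [l' h']]] st; split=> //; split=> //; split=> // i il.
by rewrite h // h' //; arith.
Qed.

(** The initial segments of a string form a chain. *)
Lemma pre_comparable s t u : pre s u -> pre t u -> pre s t \/ pre t s.
Proof.
by move=> h h'; case: (nle_total (len s) (len t)) => l; [left|right]; apply: pre_common h' _ || apply: pre_common h _.
Qed.

Definition take i s : M := strof (bit s) i.

Lemma Fn_take (s t : env M -> M) : Fn s -> Fn t -> Fn (fun e => take (s e) (t e)).
Proof. by apply: Fn_comp2; apply: Fn_strof; defn. Qed.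

Lemma takeP i s : [/\ is_str (take i s), len (take i s) = i &
  forall j, j < i -> bit (take i s) j <-> bit s j].
Proof. by apply: strofP; defn. Qed.

Lemma take_pre i s : is_str s -> i <= len s -> pre (take i s) s.
Proof.
move=> hs il; have [h1 h2 h3] := takeP i s.
by split=> //; split=> //; split; rewrite h2.
Qed.

Lemma take_eq i s t : (forall j, j < i -> bit s j <-> bit t j) -> take i s = take i t.
Proof.
move=> h; have [h1 h2 h3] := takeP i s; have [k1 k2 k3] := takeP i t.
apply: str_ext => //; first by rewrite h2.
by move=> j; rewrite h2 => ji; rewrite h3 // k3 // h.
Qed.

Lemma pre_take s t : pre s t -> take (len s) t = s.
Proof.
move=> [hs [ht [l h]]]; have [h1 h2 h3] := takeP (len s) t.
by apply: str_ext => // j; rewrite h2 => jl; rewrite h3 // h.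
Qed.

Lemma take_len s : is_str s -> take (len s) s = s.
Proof. by move=> /pre_refl/pre_take. Qed.

Definition drop n s : M := strof (fun i => bit s (n + i)) (minus (len s) n).

Lemma Fn_drop (s t : env M -> M) : Fn s -> Fn t -> Fn (fun e => drop (s e) (t e)).
Proof. by apply: Fn_comp2; apply: Fn_strof; [|apply: Fn_minus]; defn. Qed.

Lemma dropP n s : [/\ is_str (drop n s), len (drop n s) = minus (len s) n &
  forall j, j < minus (len s) n -> bit (drop n s) j <-> bit s (n + j)].
Proof. by apply: strofP; defn. Qed.

Lemma drop_pre n s t : pre s t -> n <= len s -> pre (drop n s) (drop n t).
Proof.
move=> [hs [ht [l h]]] ns; have [h1 h2 h3] := dropP n s; have [k1 k2 k3] := dropP n t.
have e1 := minusK ns; have e2 : n + minus (len t) n = len t by apply: minusK; arith.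
split=> //; split=> //; split=> [|i]; first by rewrite h2 k2; arith.
by rewrite h2 => il; rewrite h3 // k3 ?h //; arith.
Qed.

(** Dropping a common part of two strings loses nothing. *)
Lemma pre_of_drop n r s t : pre r s -> pre r t -> n <= len r ->
  pre (drop n s) (drop n t) -> pre s t.
Proof.
move=> [hr [hs [ls s']]] [_ [ht [lt t']]] nr [_ [_ []]].
have [h1 h2 h3] := dropP n s; have [k1 k2 k3] := dropP n t.
have e1 : n + minus (len s) n = len s by apply: minusK; arith.
have e2 : n + minus (len t) n = len t by apply: minusK; arith.
rewrite h2 k2 => l h; split=> //; split=> //; split=> [|i il]; first by arith.
case: (pselect (i < n)) => [iN|/nnot_lt/nleE[j e]].
  by rewrite -s' ?t' //; arith.
move: il; rewrite e => il; rewrite -h3 ?h ?k3 //; arith.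
Qed.

(** The string [c^t] that announces the color [c] and continues with [t]. *)
Definition onehot c n t : M := strof (fun i => i = c \/ exists j, j < i + 1 /\ (i = n + j /\ bit t j)) (n + len t).

Lemma onehotP c n t : c < n -> is_str t -> let x := onehot c n t in
  [/\ is_str x, len x = n + len t, drop n x = t & forall i, i < n -> bit x i <-> i = c].
Proof.
move=> cn ht; have [|h1 h2 h3] := @strofP M
  (fun i => i = c \/ exists j, j < i + 1 /\ (i = n + j /\ bit t j)) (n + len t).
  by defn.
rewrite /onehot; split=> //; last first.
  move=> i iN; rewrite h3; last by arith.
  by split=> [[//|[j [_ [e _]]]]|->]; [exfalso; arith|left].
set x := strof _ _; have [k1 k2 k3] := dropP n x.
have el : minus (len x) n = len t.
  by have : n + minus (len x) n = len x; [apply: minusK; rewrite h2; arith|rewrite h2; arith].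
apply: str_ext => //; rewrite k2 el // => j jl; rewrite k3; last by rewrite el.
rewrite h3; last by arith.
split=> [[e|[j' [_ [e b]]]]|b]; first by exfalso; arith.
  by have -> : j = j' by arith.
by right; exists j; split; [arith|].
Qed.

(** The value of a string read as a binary numeral; it enumerates the strings of a given
    length, so that they can be counted. *)
Definition val s : M := recn (fun j u => u + u + ent s j) 0 (len s).

Lemma val_def s : Fn (fun e : env M => e 1%nat + e 1%nat + ent s (e 0%nat)).
Proof. by defn. Qed.

Lemma Fn_val (s : env M -> M) : Fn s -> Fn (fun e => val (s e)).
Proof.
move=> hs; apply: Fn_recn; try by defn.
have := Fn_tl (Fn_tl hs) => hs2; defn.
Qed.

(** Halving [a] gives the last bit and the number to be represented by the other bits. *)
Lemma val_onto k a : a < pow2 k -> exists s, [/\ is_str s, len s = k & val s = a].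
Proof.
have h : forall a, a < pow2 k -> exists s, is_str s /\ len s = k /\ val s = a.
  have hpow (s : env M -> M) : Fn s -> Fn (fun e => pow2 (s e)) := @Fn_pow2 _ _.
  have hval (s : env M -> M) : Fn s -> Fn (fun e => val (s e)) := @Fn_val _.
  elim/(@Sigma_ind M): k => [||k IH {}a].
  - by defn.
  - move=> {}a; rewrite pow2_0 => a1.
    have [|s [hs [ls _]]] := @str_exists M (fun _ => False) 0; first by defn.
    exists s; split=> //; split=> //; rewrite /val ls recn0; first by arith.
    exact: val_def.
  - rewrite pow2_S => ak; have [|a' [r [r2 e]]] := @division M a (1 + 1); first by arith.
    have [|s [hs [ls vs]]] := IH a'; first by arith.
    have [|s' [hs' [ls' bs']]] := @str_exists M (fun i => i < k /\ bit s i \/ i = k /\ r = 1) (k + 1).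
      by defn.
    exists s'; split=> //; split=> //; rewrite /val ls' recnS; last exact: val_def.
    have E i : i < k -> ent s' i = ent s i.
      move=> ik; have b : bit s' i <-> bit s i.
        rewrite bs'; last by arith.
        by split=> [[[]|[e' _]]//|]; [exfalso; arith|left].
      case: (pselect (bit s i)) => [/[dup] h1 /b h2|h1]; first by rewrite h1 h2.
      by rewrite !str_bit ?b ?ls ?ls' //; arith.
    have Ek : ent s' k = r.
      have b : bit s' k <-> r = 1.
        rewrite bs'; last by arith.
        by split=> [[[h]|[]//]|]; [exfalso; arith|right].
      case: (pselect (r = 1)) => [/[dup] h1 /b h2|h1]; first by rewrite h1 h2.
      rewrite str_bit ?b ?ls' //; first by case: (ntotal r 1) => [|[//|]]; arith.
      by arith.
    rewrite Ek (@recn_ext _ _ (fun j u => u + u + ent s j)); last 3 first.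
    + exact: val_def.
    + exact: val_def.
    + by move=> j u /E ->.
    by rewrite -ls -/(val s) vs e; ring.
by move=> /h[s [h1 [h2 h3]]]; exists s.
Qed.
End Strings.

Ltac defn_ext ::= lazymatch goal with
  | |- Fn (fun e => pr _ _) => apply: Fn_pr
  | |- Fn (fun e => pr1 _) => apply: Fn_pr1
  | |- Fn (fun e => pr2 _) => apply: Fn_pr2
  | |- Fn (fun e => ent _ _) => apply: Fn_ent
  | |- Fn (fun e => len _) => apply: Fn_len
  | |- Fn (fun e => minus _ _) => apply: Fn_minus
  | |- Fn (fun e => take _ _) => apply: Fn_take
  | |- Fn (fun e => drop _ _) => apply: Fn_drop
  | |- Fn (fun e => val _) => apply: Fn_val
  | |- Fn (fun e => pow2 _) => apply: Fn_pow2
  | |- Delta (fun e => is_pr _) => apply: Delta_is_pr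
  | |- Delta (fun e => is_seq _) => apply: Delta_is_seq
  | |- Delta (fun e => is_str _) => apply: Delta_is_str
  | |- Delta (fun e => bit _ _) => apply: Delta_bit
  | |- Delta (fun e => pre _ _) => apply: Delta_pre
  end.

(** * The statement in a model *)

Section Statement.
Variable M : model.
Local Open Scope num_scope.
Implicit Types (x y z a b m n q i j k l p s t u v w h D : M) (X O T f g : sets M).

Definition Incomparable_ s t : Prop := ~ Prefix_ s t /\ ~ Prefix_ t s.
Definition Mem_ x D : Prop := Entry_ D x 1.
Definition Pow2_ n y : Prop := exists s, Entry_ s 0 1 /\
  (forall i u, i < n -> Entry_ s i u -> Entry_ s (i + 1) ((1 + 1) * u)) /\ Entry_ s n y.
Definition WeightGt_ D p q : Prop := exists L z s, Pow2_ L z /\ Entry_ s 0 0 /\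
  (forall x l u, Len_ D l -> x < l -> Entry_ s x u ->
    (Mem_ x D -> exists h y w,
       Len_ x h /\ Pow2_ h y /\ w * y = z /\ Entry_ s (x + 1) (u + w)) /\
    (~ Mem_ x D -> Entry_ s (x + 1) u)) /\
  (exists l v, Len_ D l /\ Entry_ s l v /\ p * z < q * v).
Definition PrefixFree_ D : Prop :=
  forall x y, Mem_ x D -> Mem_ y D -> Prefix_ x y -> x = y.
Definition OpenCodes_ O : Prop := forall k x, mem (pr k x) O -> Str_ x.
Definition Restr_ X n x : Prop :=
  Str_ x /\ Len_ x n /\ forall i, i < n -> (Entry_ x i 1 <-> mem i X).
Definition InOpen_ X O k : Prop := exists n x, Restr_ X n x /\ mem (pr k x) O.
Definition InPi02_ X O : Prop := forall k, InOpen_ X O k.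
Definition InterMeasureGt_ O k p q : Prop := exists D, Str_ D /\
  (forall x, Mem_ x D -> Str_ x) /\ PrefixFree_ D /\ WeightGt_ D p q /\
  (forall x j, Mem_ x D -> j <= k -> exists y, Prefix_ y x /\ mem (pr j y) O).
Definition Positive_ O : Prop :=
  exists p q, 0 < p /\ 0 < q /\ forall k, InterMeasureGt_ O k p q.
Definition Tree_ T : Prop := (forall x, mem x T -> Str_ x) /\
  (forall x y, mem x T -> Prefix_ y x -> mem y T).
Definition Perfect_ T : Prop := forall x, mem x T -> exists y z, mem y T /\ mem z T /\
  Prefix_ x y /\ Prefix_ x z /\ Incomparable_ y z.
Definition Path_ X T : Prop := forall n x, Restr_ X n x -> mem x T.
Definition ContainsPerfect_ O : Prop := exists T, (exists x, mem x T) /\ Tree_ T /\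
  Perfect_ T /\ (forall X, Path_ X T -> InPi02_ X O).
Definition PositivePi02HasPerfectSubset_ : Prop :=
  forall O, OpenCodes_ O -> Positive_ O -> ContainsPerfect_ O.
Definition Fun_ g (P Q : M -> Prop) : Prop :=
  (forall z, mem z g -> exists x y, z = pr x y /\ P x /\ Q y) /\
  (forall x, P x -> exists y, mem (pr x y) g) /\
  (forall x y y', mem (pr x y) g -> mem (pr x y') g -> y = y').
Definition IsoToFull_ g (S : sets M) : Prop :=
  Fun_ g (@Str_ M) (fun y => mem y S) /\
  (forall x x' y, mem (pr x y) g -> mem (pr x' y) g -> x = x') /\
  (forall y, mem y S -> exists x, mem (pr x y) g) /\
  (forall x x' y y', mem (pr x y) g -> mem (pr x' y') g ->
     (Prefix_ x x' <-> Prefix_ y y')).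
Definition PerfectlyHomogeneous_ (S f : sets M) : Prop :=
  (forall x, mem x S -> Str_ x) /\ (exists g, IsoToFull_ g S) /\
  (exists c, forall x, mem x S -> mem (pr x c) f).
Definition TT1_ : Prop := forall n f, Fun_ f (@Str_ M) (fun c => c < n) ->
  exists S, PerfectlyHomogeneous_ S f.
End Statement.

(** * The positive class of a coloring *)

Section Coloring.
Variable M : model.
Local Open Scope num_scope.
Add Ring model_ring4 : (num_semiring M).
Implicit Types (x y z a b m n q i j k l p s t u v w h D : M) (X O T f g : sets M).
Variables (n : M) (f : sets M).
Hypothesis coloring : Fun_ f (@Str_ M) (fun c => c < n).

Definition color s : M := mu (fun c => ~ is_str s \/ mem (pr s c) f).

Lemma color_total s : exists c, ~ is_str s \/ mem (pr s c) f.
Proof.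
case: (pselect (is_str s)) => [hs|]; last by exists 0; left.
have [_ [h _]] := coloring; have [|c hc] := h s; first exact/StrE.
by exists c; right.
Qed.

Lemma Fn_color (s : env M -> M) : Fn s -> Fn (fun e => color (s e)).
Proof. by apply: Fn_comp1; apply: Fn_mu => [|e]; [defn|exact: color_total]. Qed.

Lemma colorP s : is_str s -> mem (pr s (color s)) f /\ color s < n.
Proof.
move=> hs; have [||[//|h] _] := @mu_least M (fun c => ~ is_str s \/ mem (pr s c) f).
- by defn.
- exact: color_total.
split=> //; have [h' _] := coloring; have [x [y [e [_ yn]]]] := h' _ h.
by have [_] := pr_inj e; rewrite -/(color s) => ->.
Qed.

(** These are the strings [c^s] with [k <= |s|] and [s] of color [c]. *)
Definition good k x := is_str x /\ n + k <= len x /\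
  forall i, i < n -> (bit x i <-> i = color (drop n x)).

Lemma Delta_good (s t : env M -> M) : Fn s -> Fn t -> Delta (fun e => good (s e) (t e)).
Proof.
have := Fn_color; move=> ?.
by apply: Delta_pred2; rewrite /good; defn.
Qed.

Variable O : sets M.
Definition represents : Prop := forall k x, mem (pr k x) O <-> good k x.
Hypothesis memO : represents.

Lemma Entry_bit s i : is_str s -> i < len s -> Entry_ s i 1 <-> bit s i.
Proof. 
move=> hs il; split=> [/EntryE[]//|h]; apply/EntryE; split=> //.
exact: is_str_seq.
Qed.

Lemma Entry1 s i : Entry_ s i 1 -> i < len s /\ bit s i.
Proof. by move/EntryE => []. Qed.

Lemma Pow2_pow2 k : Pow2_ k (pow2 k).
Proof.
have [s [h1 h2 h3]] := @seq_exists M (@pow2 M) (k + 1) (Fn_pow2 (Fn_var M 0%nat)).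
exists s; split; [|split=> [i u ik|]].
- by apply/EntryE; split=> //; rewrite ?h2 ?h3 ?pow2_0 //; arith.
- move=> /EntryE[_ _ ->]; apply/EntryE; split=> //; first by rewrite h2; arith.
  by rewrite !h3 ?pow2_S //; arith.
- by apply/EntryE; split=> //; rewrite ?h2 ?h3 //; arith.
Qed.

(** The bound [a] on the value of the remainder allows the members to be counted one by one,
    by induction on [a]. *)
Definition level k a x := good k x /\ len x = n + k /\ val (drop n x) < a.

Lemma Delta_level k (a s : env M -> M) : Fn a -> Fn s -> Delta (fun e => level k (a e) (s e)).
Proof.
apply: Delta_pred2; rewrite /level; apply: Delta_and; last by defn.
by apply: Delta_good; defn.
Qed.

(** The new member is [f(s)^s], where [s] is the string of value [a]. *)
Lemma level_exists k a : a < pow2 k -> exists x, level k (a + 1) x /\ ~ level k a x.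
Proof.
move=> /val_onto[s [hs ls vs]]; have [_ cn] := colorP hs.
have /= [h1 h2 h3 h4] := onehotP cn hs.
exists (onehot (color s) n s); split; last by move=> [_ [_]]; rewrite h3 vs; arith.
split; last by rewrite h3 h2 ls vs; split=> //; arith.
split=> //; rewrite h3 h2 ls; split=> //; by right.
Qed.

Lemma level_count k : exists l, pow2 k <= cnt (level k (pow2 k)) l.
Proof.
have hl (a s : env M -> M) : Fn a -> Fn s -> Delta (fun e => level k (a e) (s e)) := @Delta_level k a s.
pose P a y := pow2 k <= a \/ level k (a + 1) y /\ ~ level k a y.
have Ptot a : exists y, P a y.
  case: (pselect (a < pow2 k)) => [/level_exists[y h]|h]; first by exists y; right.
  by exists 0; left; arith.
have FP : Fn (fun e : env M => mu (P (e 0%nat))) by apply: Fn_mu => //; rewrite /P; defn.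
have [l hl'] := @bounded M (fun a => mu (P a)) (pow2 k) FP; exists l.
have hc (a : env M -> M) : Fn a -> Fn (fun e => cnt (level k (a e)) l).
  by move=> ha; apply: Fn_cnt; [apply: hl; [exact: Fn_tl|defn]|defn].
have H a : a <= pow2 k -> a <= cnt (level k a) l.
  elim/(@Sigma_ind M): a => [||a IH ak].
  - by defn.
  - by move=> _; arith.
  - have [|//|[h|[h1 h2]] _] := @mu_least M (P a).
    + by rewrite /P; defn.
    + by arith.
    + have le1 : a <= cnt (level k a) l by apply: IH; arith.
      have le2 : cnt (level k a) l + 1 <= cnt (level k (a + 1)) l.
        apply: (@cnt_lt M _ _ (mu (P a))) => //; try (by apply: hl; defn).
          by move=> x [? [? ?]]; split=> //; split=> //; arith.
        by apply: hl'; arith.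
      by arith.
by apply: H; right.
Qed.

Lemma good_le j k x : j <= k -> good k x -> good j x.
Proof. by move=> jk [hx [l h]]; split=> //; split=> //; arith. Qed.

(** The level [n + k] has [2^(n + k)] strings, of which [2^k] at least are in the class, so the
    measure is at least [2^-n]; half of it is a strict lower bound. *)
Lemma class_positive : Positive_ O.
Proof.
exists 1, (pow2 (n + 1)); split; first by arith.
split=> [|k]; first exact: pow2_gt0.
have [l hl] := level_count k; set Q := level k (pow2 k) in hl.
have hQ : Delta (fun e : env M => Q (e 0%nat)) by apply: Delta_level; defn.
have hcQ : Fn (fun e : env M => cnt Q (e 0%nat)).
  by apply: (Fn_cnt (P := fun _ => Q)) => //; defn.
have [hD lD bD] := strofP l hQ; set D := strof Q l in hD lD bD.
have memD x : Mem_ x D <-> x < l /\ Q x.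
  split=> [/Entry1[]|[xl Qx]]; first by rewrite lD => xl /bD; auto.
  by apply/Entry_bit; rewrite ?lD // bD.
have [s [hs ls es]] := @seq_exists M (cnt Q) (l + 1) hcQ.
have Es i y : i <= l -> y = cnt Q i -> Entry_ s i y.
  by move=> il ->; apply/EntryE; rewrite ls es //; [split=> //; arith|arith].
exists D; split; first exact/StrE.
split=> [x /memD[_ [[hx _] _]]|]; first exact/StrE.
split=> [x y /memD[_ [_ [lx _]]] /memD[_ [_ [ly _]]] /PrefixE p|].
  by apply: pre_same_len => //; rewrite lx ly; right.
split=> [|x j /memD[_ [gx _]] jk]; last first.
  exists x; split; last by apply/memO; apply: good_le gx.
  by apply/PrefixE; apply: pre_refl; case: gx.
exists (n + k), (pow2 (n + k)), s; split; first exact: Pow2_pow2.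
split; first by apply: Es; [arith|rewrite cnt0].
split=> [x _ u /LenE[_ ->] |]; last first.
  exists l, (cnt Q l); split; first by apply/LenE; rewrite lD; split=> //; apply: is_str_seq.
  split; first by apply: Es => //; right.
  rewrite pow2_S pow2_add; move: (pow2_gt0 n) (pow2_gt0 k) => h1 h2.
  rewrite (_ : 1 * _ = pow2 n * pow2 k); last by ring.
  move: hl h1 h2; move: (pow2 n) (pow2 k) (cnt Q l) => u v w {}hl h1 h2.
  by narith.
rewrite lD => xl /EntryE[_ _ ->]; rewrite es; last by arith.
split=> [/memD[_ Qx]|nx].
  exists (n + k), (pow2 (n + k)), 1; split.
    by apply/LenE; case: Qx => [[hx _] [<- _]]; split=> //; apply: is_str_seq.
  split; first exact: Pow2_pow2.
  split; first by ring.
  by apply: Es; [arith|rewrite cntS //; case: asboolP].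
apply: Es; [arith|rewrite cntS //; case: asboolP => // Qx].
by case: nx; apply/memD.
Qed.
End Coloring.

(** * The homogeneous tree *)

Section Homogeneous.
Variable M : model.
Local Open Scope num_scope.
Add Ring model_ring5 : (num_semiring M).
Implicit Types (x y z a b c m n q i j k l p s t u v w h : M) (X O T f g : sets M).
Variables (n : M) (f : sets M).
Hypothesis coloring : Fun_ f (@Str_ M) (fun c => c < n).
Variable O : sets M.
Hypothesis memO : represents n f O.
Variable T : sets M.
Hypothesis tree : Tree_ T.
Hypothesis perfect : Perfect_ T.
Definition subclass : Prop := forall X, Path_ X T -> InPi02_ X O.
Hypothesis paths : subclass.

Lemma tree_str x : mem x T -> is_str x.
Proof. by case: tree => h _ /h/StrE. Qed.
Lemma tree_pre x y : mem x T -> pre y x -> mem y T.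
Proof. by case: tree => _ h /h h' /PrefixE/h'. Qed.

Definition splits y p := mem (pr1 p) T /\ mem (pr2 p) T /\ pre y (pr1 p) /\ pre y (pr2 p) /\
  ~ pre (pr1 p) (pr2 p) /\ ~ pre (pr2 p) (pr1 p).
Definition sp y : M := mu (fun p => ~ mem y T \/ splits y p).

Lemma Delta_splits (s t : env M -> M) : Fn s -> Fn t -> Delta (fun e => splits (s e) (t e)).
Proof. by apply: Delta_pred2; rewrite /splits; defn. Qed.

Lemma sp_total y : exists p, ~ mem y T \/ splits y p.
Proof.
case: (pselect (mem y T)) => [|]; last by exists 0; left.
move=> /perfect[u [v [uT [vT [/PrefixE yu [/PrefixE yv [uv vu]]]]]]].
exists (pr u v); right; rewrite /splits pr1_pr pr2_pr; do 4 split=> //.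
by split=> /PrefixE.
Qed.

Lemma Fn_sp (s : env M -> M) : Fn s -> Fn (fun e => sp (s e)).
Proof.
apply: Fn_comp1; apply: Fn_mu => [|e]; last exact: sp_total.
by have := Delta_splits => ?; defn.
Qed.

Lemma spP y : mem y T -> splits y (sp y).
Proof.
move=> yT; have [||[//|//] _] := @mu_least M (fun p => ~ mem y T \/ splits y p).
- by have := Delta_splits => ?; defn.
- exact: sp_total.
Qed.

Lemma sp_longer y : mem y T -> len y < len (pr1 (sp y)) /\ len y < len (pr2 (sp y)).
Proof.
move=> /spP[_ [_ [h1 [h2 [h h']]]]]; split.
  apply: contrapT => /nnot_lt le; case: h.
  by rewrite -(pre_same_len h1).
apply: contrapT => /nnot_lt le; case: h'.
by rewrite -(pre_same_len h2).
Qed.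

(** The path that always takes the first of two incomparable extensions. *)
Lemma path_through y k : mem y T ->
  exists x, mem x T /\ good n f k x /\ (len y <= len x -> pre y x).
Proof.
move=> yT; have hsp := Fn_sp.
pose G (_ u : M) := pr1 (sp u); pose P := recn G y.
have hG : Fn (fun e : env M => G (e 0%nat) (e 1%nat)) by rewrite /G; defn.
have hP (s : env M -> M) : Fn s -> Fn (fun e => P (s e)).
  by move=> hs; rewrite /P; apply: Fn_recn => //; defn.
have PT i : mem (P i) T.
  elim/(@Sigma_ind M): i => [||i iT]; first by defn.
    by rewrite /P recn0.
  by rewrite /P recnS //; case: (spP iT).
have PS i : pre (P i) (P (i + 1)) /\ len (P i) < len (P (i + 1)).
  have -> : P (i + 1) = pr1 (sp (P i)) by rewrite /P recnS.
  split; first by case: (spP (PT i)) => [_ [_ []]].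
  by case: (sp_longer (PT i)).
have Plen i : i <= len (P i).
  elim/(@Sigma_ind M): i => [||i]; [by defn|by arith|].
  by case: (PS i); arith.
have Ppre i d : pre (P i) (P (i + d)).
  elim/(@Sigma_ind M): d => [||d IH]; first by defn.
    by rewrite (_ : i + 0 = i); [apply: pre_refl; apply: tree_str|ring].
  by apply: pre_trans IH _; rewrite naddA; case: (PS (i + d)).
have Pbit i j : j < i -> bit (P (j + 1)) j <-> bit (P i) j.
  move=> ji; have /nleE[d ->] : j + 1 <= i by arith.
  by case: (Ppre (j + 1) d) => [_ [_ [_ ->]]] //; have := Plen (j + 1); arith.
have [|X hX] := @Delta_comprehension M (fun j => bit (P (j + 1)) j); first by defn.
have XT : Path_ X T.
  move=> l x [/StrE hx [/LenE[_ lx] bx]].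
  have -> : x = take l (P l).
    have [h1 h2 h3] := takeP l (P l); apply: str_ext => //; first by rewrite h2.
    move=> i; rewrite -lx => il; rewrite h3 // -Pbit // -hX -bx //.
    by rewrite Entry_bit // -lx.
  apply: (tree_pre (PT l)); apply: take_pre; [exact: tree_str|exact: Plen].
have [l [x [R /memO xO]]] := paths XT k.
exists x; split; first exact: XT R.
split=> // le; split; first exact: tree_str.
case: R => [/StrE hx [/LenE[_ lx] bx]]; do 2 split=> //.
move=> i il; have il' : i < len x by arith.
rewrite -(Entry_bit hx il') bx ?hX ?lx //.
have P0 : P 0 = y by rewrite /P recn0.
have := Ppre 0 (i + 1); rewrite P0 nadd0 => -[_ [_ [_ h]]].
by rewrite h.
Qed.

(** All extensions of a first colored node share its first [n] values, hence its color. *)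
Lemma colored_node : (exists x, mem x T) -> exists x0 c, mem x0 T /\ n <= len x0 /\
  forall y b, mem y T -> pre x0 y ->
    exists z, mem z T /\ pre y z /\ n + b <= len z /\ color f (drop n z) = c.
Proof.
move=> [r rT]; have [x0 [x0T [[hx0 [lx0 bx0]] _]]] := path_through 0 rT.
exists x0, (color f (drop n x0)); split=> //; split; first by arith.
move=> y b yT py; have [z [zT [[hz [lz bz]] yz]]] := path_through (len y + b) yT.
have pyz : pre y z by apply: yz; arith.
exists z; split=> //; split=> //; split; first by arith.
have [hd _ _] := dropP n x0; have [_ cn] := colorP coloring hd.
symmetry; apply/bz => //; case: (pre_trans py pyz) => [_ [_ [_ <-]]]; last by arith.
exact/bx0.
Qed.

Variables (x0 c : M).
Definition extends y b z := mem z T /\ pre y z /\ n + b <= len z /\ color f (drop n z) = c.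
Hypothesis x0T : mem x0 T.
Definition long_enough : Prop := n <= len x0.
Hypothesis lx0 : long_enough.
Definition extendible := forall y b, mem y T -> pre x0 y -> exists z, extends y b z.
Hypothesis ext : extendible.

Definition extend y b : M := mu (fun z => ~ (mem y T /\ pre x0 y) \/ extends y b z).

Lemma Delta_extends (s t u : env M -> M) : Fn s -> Fn t -> Fn u ->
  Delta (fun e => extends (s e) (t e) (u e)).
Proof. by have := Fn_color coloring => ?; apply: Delta_pred3; rewrite /extends; defn. Qed.

Lemma extend_total y b : exists z, ~ (mem y T /\ pre x0 y) \/ extends y b z.
Proof.
case: (pselect (mem y T /\ pre x0 y)) => [[h h']|]; last by exists 0; left.
by have [z hz] := ext b h h'; exists z; right.
Qed.

Lemma Delta_extend : Delta (fun e : env M =>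
  ~ (mem (e 1%nat) T /\ pre x0 (e 1%nat)) \/ extends (e 1%nat) (e 2%nat) (e 0%nat)).
Proof. by apply: Delta_or; [|apply: Delta_extends]; defn. Qed.

Lemma Fn_extend (s t : env M -> M) : Fn s -> Fn t -> Fn (fun e => extend (s e) (t e)).
Proof.
apply: Fn_comp2; apply: Fn_mu => [|e]; last exact: extend_total.
exact: Delta_extend.
Qed.

Lemma extendP y b : mem y T -> pre x0 y -> extends y b (extend y b).
Proof.
move=> yT py; have [||[[]//|//] _] := @mu_least M
  (fun z => ~ (mem y T /\ pre x0 y) \/ extends y b z); last exact: extend_total.
by apply: Delta_or; [|apply: Delta_extends]; defn.
Qed.

(** The embedding of the full binary tree into [T]: at the [j]-th step along [s], move to the
    side given by the [j]-th bit, then to a node of color [c] that is longer than the code of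
    the string reached, so that the range of the embedding can be searched. *)
Definition side (P : Prop) y : M := if `[< P >] then pr2 (sp y) else pr1 (sp y).
Definition node_step s j u := extend (side (bit s j) u) (take (j + 1) s).
Definition node s j : M := recn (node_step s) (extend x0 (take 0 s)) j.

Lemma Fn_node_step (s t u : env M -> M) : Fn s -> Fn t -> Fn u ->
  Fn (fun e => node_step (s e) (t e) (u e)).
Proof.
by have := Fn_sp => ?; apply: Fn_comp3; apply: Fn_extend; rewrite /side; defn.
Qed.
Lemma node_def s : Fn (fun e : env M => node_step s (e 0%nat) (e 1%nat)).
Proof. by apply: Fn_node_step; defn. Qed.
Lemma Fn_node (s t : env M -> M) : Fn s -> Fn t -> Fn (fun e => node (s e) (t e)).
Proof.
apply: Fn_comp2; apply: Fn_recn; [apply: Fn_node_step|apply: Fn_extend|]; defn.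
Qed.

Lemma node0 s : node s 0 = extend x0 (take 0 s). Proof. exact: recn0 (node_def s). Qed.
Lemma nodeS s j : node s (j + 1) = node_step s j (node s j).
Proof. exact: recnS (node_def s). Qed.

Lemma side_tree P y : mem y T -> pre x0 y ->
  [/\ mem (side P y) T, pre x0 (side P y), pre y (side P y) & len y < len (side P y)].
Proof.
move=> yT py; have [h1 [h2 [h3 [h4 _]]]] := spP yT; have [l1 l2] := sp_longer yT.
by rewrite /side; case: ifP => _; split=> //; apply: pre_trans py _.
Qed.

Lemma node_ok s j : mem (node s j) T /\ pre x0 (node s j) /\
  n + take j s <= len (node s j) /\ color f (drop n (node s j)) = c.
Proof.
have := Fn_node => ?; have := Fn_color coloring => ?.
elim/(@Sigma_ind M): j => [||j [jT [pj _]]]; first by defn.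
  rewrite node0; have [h1 [h2 [h3 h4]]] := extendP (take 0 s) x0T (pre_refl (tree_str x0T)).
  exact: conj h1 (conj h2 (conj h3 h4)).
rewrite nodeS /node_step; set y := side _ _.
have [yT py _ _] := side_tree (bit s j) jT pj.
have [h1 [h2 [h3 h4]]] := extendP (take (j + 1) s) yT py.
exact: conj h1 (conj (pre_trans py h2) (conj h3 h4)).
Qed.

Lemma side_node s j : pre (side (bit s j) (node s j)) (node s (j + 1)).
Proof.
have [jT [pj _]] := node_ok s j; have [yT py _ _] := side_tree (bit s j) jT pj.
by rewrite nodeS; have [_ []] := extendP (take (j + 1) s) yT py.
Qed.

Lemma node_mono s i j : i <= j -> pre (node s i) (node s j).
Proof.
have := Fn_node => ?; move/nleE => [d ->].
elim/(@Sigma_ind M): d => [||d IH]; first by defn.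
  rewrite (_ : i + 0 = i); last by ring.
  by apply: pre_refl; apply: tree_str; case: (node_ok s i).
rewrite naddA; apply: pre_trans IH _; apply: pre_trans (side_node _ _).
by have [jT [pj _]] := node_ok s (i + d); have [] := side_tree (bit s (i + d)) jT pj.
Qed.

Lemma node_agree s t j : (forall i, i < j -> bit s i <-> bit t i) -> node s j = node t j.
Proof.
move=> h; have E i : i <= j -> take i s = take i t.
  by move=> ij; apply: take_eq => k ki; apply: h; arith.
rewrite /node (E 0); last by arith.
apply: recn_ext; try exact: node_def.
move=> i u ij; rewrite /node_step E; last by arith.
by congr (extend _ _); rewrite /side (propext (h i ij)).
Qed.

Definition image s : M := drop n (node s (len s)).

Lemma Fn_image (s : env M -> M) : Fn s -> Fn (fun e => image (s e)).
Proof. by move=> ?; apply: Fn_drop; [|apply: Fn_node]; defn. Qed.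

Lemma image_str s : is_str (image s). Proof. by case: (dropP n (node s (len s))). Qed.

Lemma image_color s : color f (image s) = c. Proof. by case: (node_ok s (len s)) => _ [_ []]. Qed.

Lemma le_image s : is_str s -> s <= image s.
Proof.
move=> hs; have [_ [_ [h _]]] := node_ok s (len s); rewrite take_len // in h.
have [h1 h2 _] := dropP n (node s (len s)).
have e : n + minus (len (node s (len s))) n = len (node s (len s)) by apply: minusK; arith.
have := len_le_code (is_str_seq (image_str s)); rewrite {1}/image h2; arith.
Qed.

(** If [s] is not an initial segment of [t], consider the first position of [s] where [t] ends
    or differs.  The images agree up to there.  If [t] ends, then the image of [s] is longer
    than that of [t]; if [t] differs, then the two images extend incomparable nodes. *)
Lemma image_pre s t : is_str s -> is_str t -> pre s t <-> pre (image s) (image t).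
Proof.
move=> hs ht.
have [_ [ps _]] := node_ok s (len s); have [tT [pt _]] := node_ok t (len t).
split=> [[_ [_ [l h]]]|/(pre_of_drop ps pt lx0) H].
  apply: drop_pre; last by have : n <= len x0 := lx0; case: ps => _ [_ []]; arith.
  by rewrite (node_agree h); apply: node_mono.
apply: contrapT => nst.
pose P i := ~ (i < len s -> i < len t /\ (bit s i <-> bit t i)).
have [||i [Pi min]] := @Delta_least M P.
- by rewrite /P; defn.
- apply: contrapT => none; apply: nst; do 2 split=> //.
  have E i : i < len s -> i < len t /\ (bit s i <-> bit t i).
    by move=> il; apply: contrapT => h; apply: none; exists i => /(_ il).
  split=> [|i /E[]//].
  case: (nzero_or_pos (len s)) => [->|/pos_succ[l el]]; first by arith.
  by case: (E l); arith.
have is_lt : i < len s by apply: contrapT => h; apply: Pi.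
have agree j : j < i -> j < len t /\ (bit s j <-> bit t j).
  by move=> ji; have /contrapT := min j ji; apply; arith.
have e : node s i = node t i by apply: node_agree => j /agree[].
have it : i <= len t.
  by case: (nzero_or_pos i) => [->|/pos_succ[l el]]; [arith|case: (agree l); arith].
have [iT [pi _]] := node_ok s i.
have H1 : pre (side (bit s i) (node s i)) (node t (len t)).
  by apply: pre_trans H; apply: pre_trans (side_node s i) _; apply: node_mono; arith.
case: (pselect (i < len t)) => it'.
  have H2 : pre (side (bit t i) (node s i)) (node t (len t)).
    by rewrite e; apply: pre_trans (side_node t i) _; apply: node_mono; arith.
  have nb : ~ (bit s i <-> bit t i) by move=> h; exact: Pi (fun _ => conj it' h).
  have [_ [_ [_ [_ [n1 n2]]]]] := spP iT.
  move: H1 H2 nb; rewrite /side; case: asboolP => b1; case: asboolP => b2 H1 H2 nb.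
  - by case: nb; split=> _.
  - by case: (pre_comparable H1 H2) => [/n2|/n1].
  - by case: (pre_comparable H1 H2) => [/n1|/n2].
  - by case: nb; split=> h; [case: (b1 h)|case: (b2 h)].
have el : len t = i by arith.
have [_ _ _ l] := side_tree (bit s i) iT pi.
by case: H1 => _ [_ [l' _]]; move: l l'; rewrite el e; arith.
Qed.

(** The range is a set because [s <= image s] bounds the search for a preimage. *)
Lemma homogeneous : exists S, PerfectlyHomogeneous_ S f.
Proof.
have := Fn_image => ?.
have [|S hS] := @Delta_comprehension M (fun y => exists s, s < y + 1 /\ (is_str s /\ y = image s)).
  by defn.
have memS y : mem y S <-> exists s, is_str s /\ y = image s.
  rewrite hS; split=> [[s [_ h]]|[s [hs e]]]; first by exists s.
  by exists s; split=> //; rewrite e; have := le_image hs; arith.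
have [|g hg] := @Delta_comprehension M
  (fun p => is_pr p /\ is_str (pr1 p) /\ pr2 p = image (pr1 p)); first by defn.
have memg s y : mem (pr s y) g <-> is_str s /\ y = image s.
  rewrite hg pr1_pr pr2_pr; split=> [[_ h]//|h]; split=> //; exact: is_pr_pr.
have inj s t : is_str s -> is_str t -> image s = image t -> s = t.
  move=> hs ht e; have hp : pre (image s) (image t) by rewrite e; apply: pre_refl; exact: image_str.
  have hp' : pre (image t) (image s) by rewrite e; apply: pre_refl; exact: image_str.
  have [_ [_ [l _]]] := proj2 (image_pre ht hs) hp'.
  exact: pre_same_len (proj2 (image_pre hs ht) hp) l.
exists S; split=> [y /memS[s [_ ->]]|]; first by apply/StrE/image_str.
split; last first.
  exists c => y /memS[s [_ ->]]; rewrite -(image_color s).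
  by case: (colorP coloring (image_str s)).
exists g; split.
  split=> [p /hg[[i [_ [j [_ ->]]]]]|].
    rewrite pr1_pr pr2_pr => -[hi ->]; exists i, (image i); split=> //; split; first exact/StrE.
    by apply/memS; exists i.
  split=> [s /StrE hs|s y y' /memg[_ ->] /memg[_ ->]//].
  by exists (image s); apply/memg.
split=> [s t y /memg[hs ->] /memg[ht]|]; first exact: inj.
split=> [y /memS[s [hs ->]]|s t y y' /memg[hs ->] /memg[ht ->]].
  by exists s; apply/memg.
by rewrite !PrefixE; apply: image_pre.
Qed.
End Homogeneous.

Theorem model_TT1 (M : model) : PositivePi02HasPerfectSubset_ M -> TT1_ M.
Proof.
move=> H n f col.
have [|O hO] := @Delta_comprehension M
  (fun p => is_pr p /\ good n f (pr1 p) (pr2 p)).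
  by apply: Delta_and; [|apply: Delta_good]; defn.
have memO : represents n f O.
  move=> k x; rewrite hO pr1_pr pr2_pr; split=> [[]//|h]; split=> //; exact: is_pr_pr.
have [||T [ne [tree [perfect paths]]]] := H O.
- by move=> k x /memO[/StrE].
- exact: (class_positive col memO).
have [x0 [c [x0T [lx0 ext]]]] := colored_node col memO tree perfect paths ne.
exact: (homogeneous col tree perfect x0T lx0 ext).
Qed.

End Models.

From Stdlib Require Import List Arith Lia Cantor.
From Stdlib Require Import Classical ClassicalEpsilon FunctionalExtensionality PropExtensionality.
Require Import Defs.

(** * Substitution *)

Lemma scons_comp {A B : Type} (h : A -> B) a f :
  (fun x => h (scons a f x)) = scons (h a) (fun x => h (f x)).
Proof. apply functional_extensionality; intros [|x]; reflexivity. Qed.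

Lemma tsubst_tsubst f g t : tsubst f (tsubst g t) = tsubst (fun x => tsubst f (g x)) t.
Proof. induction t; simpl; congruence. Qed.

Lemma tsubst_Var t : tsubst Var t = t.
Proof. induction t; simpl; congruence. Qed.

Lemma tsubst_scons_tshift a f t : tsubst (scons a f) (tshift t) = tsubst f t.
Proof. unfold tshift; rewrite tsubst_tsubst; reflexivity. Qed.

Lemma tsubst_tshift f t : tsubst (fun x => tshift (f x)) t = tshift (tsubst f t).
Proof. unfold tshift; rewrite tsubst_tsubst; reflexivity. Qed.

Lemma up_num_comp f g :
  (fun x => tsubst (up_num f) (up_num g x)) = up_num (fun x => tsubst f (g x)).
Proof.
  apply functional_extensionality; intros [|x]; [reflexivity|].
  unfold up_num at 1 2 3; cbn [scons].
  rewrite tsubst_scons_tshift; apply tsubst_tshift.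
Qed.

Lemma up_set_comp r s : (fun X => up_set r (up_set s X)) = up_set (fun X => r (s X)).
Proof. apply functional_extensionality; intros [|X]; reflexivity. Qed.

Lemma subst_subst f r g s A :
  subst f r (subst g s A) = subst (fun x => tsubst f (g x)) (fun X => r (s X)) A.
Proof.
  revert f r g s; induction A; intros; cbn [subst]; rewrite ?tsubst_tsubst; try reflexivity.
  - now rewrite IHA1, IHA2.
  - now rewrite IHA, up_num_comp.
  - now rewrite IHA, up_set_comp.
Qed.

Lemma up_num_Var : up_num Var = Var.
Proof. apply functional_extensionality; intros [|x]; reflexivity. Qed.

Lemma up_set_id : up_set (fun X => X) = (fun X => X).
Proof. apply functional_extensionality; intros [|X]; reflexivity. Qed.

Lemma subst_id A : subst Var (fun X => X) A = A.
Proof.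
  induction A; cbn [subst]; rewrite ?up_num_Var, ?up_set_id, ?tsubst_Var; congruence.
Qed.

Lemma subst_shift_num f r A : subst (up_num f) r (shift_num A) = shift_num (subst f r A).
Proof.
  unfold shift_num; rewrite !subst_subst; cbn; f_equal.
Qed.

Lemma subst_shift_set f r A : subst f (up_set r) (shift_set A) = shift_set (subst f r A).
Proof.
  unfold shift_set; rewrite !subst_subst; f_equal.
  apply functional_extensionality; intros x; now rewrite tsubst_Var.
Qed.

Lemma subst_inst_num f r t A :
  subst f r (inst_num t A) = inst_num (tsubst f t) (subst (up_num f) r A).
Proof.
  unfold inst_num; rewrite !subst_subst; f_equal.
  apply functional_extensionality; intros [|x]; [reflexivity|].
  cbn; now rewrite tsubst_scons_tshift, tsubst_Var.
Qed.

Lemma subst_inst_set f r X A :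
  subst f r (inst_set X A) = inst_set (r X) (subst f (up_set r) A).
Proof.
  unfold inst_set; rewrite !subst_subst; f_equal.
  - apply functional_extensionality; intros x; now rewrite tsubst_Var.
  - apply functional_extensionality; intros [|x]; reflexivity.
Qed.

Lemma inst_num_up t f r A : inst_num t (subst (up_num f) r A) = subst (scons t f) r A.
Proof.
  unfold inst_num; rewrite subst_subst; f_equal.
  apply functional_extensionality; intros [|x]; [reflexivity|].
  cbn; now rewrite tsubst_scons_tshift, tsubst_Var.
Qed.

Lemma inst_set_up X f r A : inst_set X (subst f (up_set r) A) = subst f (scons X r) A.
Proof.
  unfold inst_set; rewrite subst_subst; f_equal.
  - apply functional_extensionality; intros x; now rewrite tsubst_Var.
  - apply functional_extensionality; intros [|x]; reflexivity.
Qed.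

(** Bounds for the free variables; they need not be sharp. *)
Fixpoint tbound (t : term) : nat :=
  match t with
  | Var x => S x
  | Zero | One => 0
  | Plus s t | Times s t => tbound s + tbound t
  end.

Fixpoint nbound (A : form) : nat :=
  match A with
  | Eq s t | Lt s t => tbound s + tbound t
  | In t X => tbound t
  | Bot => 0
  | Imp A B => nbound A + nbound B
  | AllN A => pred (nbound A)
  | AllS A => nbound A
  end.

Fixpoint sbound (A : form) : nat :=
  match A with
  | Eq _ _ | Lt _ _ | Bot => 0
  | In t X => S X
  | Imp A B => sbound A + sbound B
  | AllN A => sbound A
  | AllS A => pred (sbound A)
  end.

Lemma tsubst_ext f g t : (forall x, x < tbound t -> f x = g x) -> tsubst f t = tsubst g t.
Proof.
  induction t; cbn; intros H; [apply H; lia|reflexivity|reflexivity|f_equal|f_equal];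
    first [apply IHt1 | apply IHt2]; intros; apply H; lia.
Qed.

Lemma subst_ext f r g s A : (forall x, x < nbound A -> f x = g x) ->
  (forall X, X < sbound A -> r X = s X) -> subst f r A = subst g s A.
Proof.
  revert f r g s; induction A; cbn; intros f r g s' H H'.
  - f_equal; apply tsubst_ext; intros; apply H; lia.
  - f_equal; apply tsubst_ext; intros; apply H; lia.
  - rewrite (H' X) by lia; f_equal; apply tsubst_ext; intros; apply H; lia.
  - reflexivity.
  - f_equal; [apply IHA1|apply IHA2]; intros; first [apply H | apply H']; lia.
  - f_equal; apply IHA; auto; intros [|x] l; cbn; auto; rewrite H; auto; lia.
  - f_equal; apply IHA; auto; intros [|x] l; cbn; auto; rewrite H'; auto; lia.
Qed.

(** * Derivations *)

Section Derivations.
Variable Ax : form -> Prop.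
Hypothesis Ax_subst : forall f r A, Ax A -> Ax (subst f r A).

Lemma prv_subst G A : prv Ax G A -> forall f r, prv Ax (map (subst f r) G) (subst f r A).
Proof.
  induction 1; intros f r; cbn [subst map] in *.
  - now apply prv_Ax, Ax_subst.
  - now apply prv_Hyp, in_map.
  - now apply prv_ImpI, IHprv.
  - eapply prv_ImpE; [apply IHprv1|apply IHprv2].
  - apply prv_RAA, (IHprv f r).
  - apply prv_AllNI; rewrite map_map.
    erewrite map_ext; [rewrite <- (map_map shift_num); apply IHprv|].
    intros B; symmetry; apply subst_shift_num.
  - rewrite subst_inst_num; apply prv_AllNE, IHprv.
  - apply prv_AllSI; rewrite map_map.
    erewrite map_ext; [rewrite <- (map_map shift_set); apply IHprv|].
    intros B; symmetry; apply subst_shift_set.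
  - rewrite subst_inst_set; apply prv_AllSE, IHprv.
  - apply prv_EqI.
  - rewrite subst_inst_num; eapply prv_EqE; [apply IHprv1|].
    rewrite <- subst_inst_num; apply IHprv2.
Qed.

Lemma prv_weak G A : prv Ax G A -> forall G', incl G G' -> prv Ax G' A.
Proof.
  induction 1; intros G' i.
  - now apply prv_Ax.
  - apply prv_Hyp; auto.
  - apply prv_ImpI, IHprv; intros C [<-|h]; [now left|right; auto].
  - eapply prv_ImpE; eauto.
  - apply prv_RAA, IHprv; intros C [<-|h]; [now left|right; auto].
  - apply prv_AllNI, IHprv; now apply incl_map.
  - apply prv_AllNE; auto.
  - apply prv_AllSI, IHprv; now apply incl_map.
  - apply prv_AllSE; auto.
  - apply prv_EqI.
  - eapply prv_EqE; eauto.
Qed.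

Definition consistent G := ~ prv Ax G Bot.

Definition list_bound (b : form -> nat) (G : list form) : nat := fold_right (fun A n => b A + n) 0 G.

Lemma list_bound_le b G A : List.In A G -> b A <= list_bound b G.
Proof.
  induction G as [|B G IH]; cbn; [easy|]; intros [->|h]; [|specialize (IH h)];
    fold (list_bound b G) in *; lia.
Qed.

(** The derivation of the universal statement generalizes the fresh variable that stands for the
    counterexample, by renaming it to the eigenvariable. *)
Lemma consistent_num G B y : consistent G -> List.In (Neg (AllN B)) G ->
  list_bound nbound G <= y -> consistent (Neg (inst_num (Var y) B) :: G).
Proof.
  intros c h ly p; apply c; eapply prv_ImpE; [apply prv_Hyp, h|].
  apply prv_AllNI.
  set (f := fun x => if Nat.eq_dec x y then Var 0 else Var (S x)).
  pose proof (prv_subst _ _ (prv_RAA _ _ _ p) f (fun X => X)) as q.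
  replace (map (subst f (fun X => X)) G) with (map shift_num G) in q.
  - replace (subst f (fun X => X) (inst_num (Var y) B)) with B in q; [exact q|].
    unfold inst_num; rewrite subst_subst, <- (subst_id B) at 1.
    apply subst_ext; [intros [|x] l|reflexivity]; cbn; unfold f.
    + destruct (Nat.eq_dec y y); congruence.
    + destruct (Nat.eq_dec x y); [|reflexivity].
      pose proof (list_bound_le nbound _ _ h); cbn in *; lia.
  - apply map_ext_in; intros A hA; apply subst_ext; [|reflexivity].
    intros x l; unfold f; destruct (Nat.eq_dec x y); [|reflexivity].
    pose proof (list_bound_le nbound _ _ hA); lia.
Qed.

Lemma consistent_set G B y : consistent G -> List.In (Neg (AllS B)) G ->
  list_bound sbound G <= y -> consistent (Neg (inst_set y B) :: G).
Proof.
  intros c h ly p; apply c; eapply prv_ImpE; [apply prv_Hyp, h|].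
  apply prv_AllSI.
  set (r := fun X => if Nat.eq_dec X y then 0 else S X).
  pose proof (prv_subst _ _ (prv_RAA _ _ _ p) Var r) as q.
  replace (map (subst Var r) G) with (map shift_set G) in q.
  - replace (subst Var r (inst_set y B)) with B in q; [exact q|].
    unfold inst_set; rewrite subst_subst, <- (subst_id B) at 1.
    apply subst_ext; [reflexivity|intros [|x] l]; cbn; unfold r.
    + destruct (Nat.eq_dec y y); congruence.
    + destruct (Nat.eq_dec x y); [|reflexivity].
      pose proof (list_bound_le sbound _ _ h); cbn in *; lia.
  - apply map_ext_in; intros A hA; apply subst_ext; [reflexivity|].
    intros x l; unfold r; destruct (Nat.eq_dec x y); [|reflexivity].
    pose proof (list_bound_le sbound _ _ hA); lia.
Qed.

(** * Enumeration of the formulas *)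

Fixpoint tcode (t : term) : nat :=
  match t with
  | Var x => to_nat (0, x)
  | Zero => to_nat (1, 0)
  | One => to_nat (2, 0)
  | Plus s t => to_nat (3, to_nat (tcode s, tcode t))
  | Times s t => to_nat (4, to_nat (tcode s, tcode t))
  end.

Fixpoint code (A : form) : nat :=
  match A with
  | Eq s t => to_nat (0, to_nat (tcode s, tcode t))
  | Lt s t => to_nat (1, to_nat (tcode s, tcode t))
  | In t X => to_nat (2, to_nat (tcode t, X))
  | Bot => to_nat (3, 0)
  | Imp A B => to_nat (4, to_nat (code A, code B))
  | AllN A => to_nat (5, code A)
  | AllS A => to_nat (6, code A)
  end.

Ltac to_nat_inj :=
  repeat match goal with
  | H : to_nat _ = to_nat _ |- _ => apply to_nat_inj in H
  | H : (_, _) = (_, _) |- _ => apply pair_equal_spec in H; destruct H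
  end.

Lemma tcode_inj s t : tcode s = tcode t -> s = t.
Proof.
  revert t; induction s; intros []; cbn [tcode]; intros; to_nat_inj;
    first [discriminate | f_equal; auto].
Qed.

Lemma code_inj A B : code A = code B -> A = B.
Proof.
  revert B; induction A; intros []; cbn [code]; intros; to_nat_inj;
    first [discriminate | f_equal; auto using tcode_inj].
Qed.

Definition enum (n : nat) : form := epsilon (inhabits Bot) (fun A => code A = n).

Lemma enum_code A : enum (code A) = A.
Proof.
  apply code_inj; unfold enum; apply (epsilon_spec (inhabits Bot) (fun B => code B = code A)).
  now exists A.
Qed.

(** * A complete Henkin theory *)

Variable A0 : form.
Hypothesis unprovable : ~ prv Ax nil A0.

(** Adding [A]; if [A] refutes a universal statement, a counterexample is named at once, which
    is possible because a stage consists of finitely many formulas. *)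
Definition henkin (A : form) (G : list form) : list form :=
  match A with
  | Imp (AllN B) Bot => Neg (inst_num (Var (list_bound nbound (A :: G))) B) :: A :: G
  | Imp (AllS B) Bot => Neg (inst_set (list_bound sbound (A :: G)) B) :: A :: G
  | _ => A :: G
  end.

Lemma henkin_consistent A G : consistent (A :: G) -> consistent (henkin A G).
Proof.
  intros c; unfold henkin; destruct A as [| | | |[] []| |]; auto.
  - apply consistent_num; auto; now left.
  - apply consistent_set; auto; now left.
Qed.

Lemma henkin_incl A G : incl (A :: G) (henkin A G).
Proof. unfold henkin; destruct A as [| | | |[] []| |]; auto using incl_refl, incl_tl. Qed.

Fixpoint stage (n : nat) : list form :=
  match n with
  | 0 => Neg A0 :: nil
  | S n => if excluded_middle_informative (consistent (enum n :: stage n))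
           then henkin (enum n) (stage n) else stage n
  end.

Lemma stage_consistent n : consistent (stage n).
Proof.
  induction n; cbn.
  - intros p; apply unprovable, prv_RAA, p.
  - destruct excluded_middle_informative; auto using henkin_consistent.
Qed.

Lemma stage_incl m n : m <= n -> incl (stage m) (stage n).
Proof.
  induction 1; [apply incl_refl|]; cbn; destruct excluded_middle_informative; auto.
  eapply incl_tran; [apply IHle|]; eapply incl_tran; [|apply henkin_incl]; apply incl_tl, incl_refl.
Qed.

Definition Th (A : form) : Prop := exists n, prv Ax (stage n) A.

Lemma Th_mp A B : Th (Imp A B) -> Th A -> Th B.
Proof.
  intros [m p] [n q]; exists (m + n); eapply prv_ImpE; eapply prv_weak; eauto;
    apply stage_incl; lia.
Qed.

Lemma Th_Bot : ~ Th Bot.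
Proof. intros [n p]; exact (stage_consistent n p). Qed.

(** A theorem is consistent with every stage, so it was added when its turn came. *)
Lemma Th_added A : Th A -> exists n, incl (henkin A (stage n)) (stage (S n)).
Proof.
  intros h; exists (code A); cbn; rewrite enum_code.
  destruct excluded_middle_informative as [c|c]; [apply incl_refl|].
  exfalso; apply c; intros p; apply Th_Bot.
  apply (Th_mp A); [|assumption]; exists (code A); now apply prv_ImpI.
Qed.

Lemma Th_complete A : Th A \/ Th (Neg A).
Proof.
  destruct (excluded_middle_informative (consistent (A :: stage (code A)))) as [c|c].
  - left; exists (S (code A)); apply prv_Hyp; cbn; rewrite enum_code.
    destruct excluded_middle_informative; [|easy].
    apply henkin_incl; now left.
  - right; exists (code A); apply prv_ImpI; now apply NNPP in c.
Qed.

Lemma Th_Neg A : Th (Neg A) <-> ~ Th A.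
Proof.
  split; [intros h h'; apply Th_Bot; eapply Th_mp; eauto|].
  intros h; destruct (Th_complete A); tauto.
Qed.

Lemma Th_Imp A B : Th (Imp A B) <-> (Th A -> Th B).
Proof.
  split; [apply Th_mp|intros h].
  destruct (Th_complete A) as [a|[n a]].
  - destruct (h a) as [n b]; exists n; apply prv_ImpI; eapply prv_weak; eauto; now apply incl_tl, incl_refl.
  - exists n; apply prv_ImpI, prv_RAA; eapply prv_ImpE;
      [eapply prv_weak; [apply a|]; apply incl_tl, incl_tl, incl_refl|].
    apply prv_Hyp; right; now left.
Qed.

Lemma Th_AllN A : Th (AllN A) <-> forall t, Th (inst_num t A).
Proof.
  split; [intros [n p] t; exists n; now apply prv_AllNE|intros h].
  apply NNPP; intros h'; apply Th_Neg, Th_added in h' as [n i]; cbn in i.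
  eapply Th_Neg, h; exists (S n); apply prv_Hyp, i; now left.
Qed.

Lemma Th_AllS A : Th (AllS A) <-> forall X, Th (inst_set X A).
Proof.
  split; [intros [n p] t; exists n; now apply prv_AllSE|intros h].
  apply NNPP; intros h'; apply Th_Neg, Th_added in h' as [n i]; cbn in i.
  eapply Th_Neg, h; exists (S n); apply prv_Hyp, i; now left.
Qed.

Lemma Th_Eq_refl t : Th (Eq t t).
Proof. exists 0; apply prv_EqI. Qed.

Lemma Th_Eq_subst A s t : Th (Eq s t) -> Th (inst_num s A) -> Th (inst_num t A).
Proof.
  intros [m p] [n q]; exists (m + n).
  apply (prv_EqE _ _ _ s); eapply prv_weak; eauto; apply stage_incl; lia.
Qed.

Lemma Th_A0 : ~ Th A0.
Proof. apply Th_Neg; exists 0; apply prv_Hyp; now left. Qed.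
End Derivations.

(** * Structures and satisfaction *)

Record structure : Type := Structure {
  carrier : Type;
  points : Type;
  s_zero : carrier; s_one : carrier;
  s_plus : carrier -> carrier -> carrier;
  s_times : carrier -> carrier -> carrier;
  s_lt : carrier -> carrier -> Prop;
  s_mem : carrier -> points -> Prop }.

Section Satisfaction.
Variable K : structure.

Fixpoint eval (e : nat -> carrier K) (t : term) : carrier K :=
  match t with
  | Var x => e x
  | Zero => s_zero K
  | One => s_one K
  | Plus s t => s_plus K (eval e s) (eval e t)
  | Times s t => s_times K (eval e s) (eval e t)
  end.

Fixpoint sat (e : nat -> carrier K) (r : nat -> points K) (A : form) : Prop :=
  match A with
  | Eq s t => eval e s = eval e t
  | Lt s t => s_lt K (eval e s) (eval e t)
  | In t X => s_mem K (eval e t) (r X)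
  | Bot => False
  | Imp A B => sat e r A -> sat e r B
  | AllN A => forall v, sat (scons v e) r A
  | AllS A => forall X, sat e (scons X r) A
  end.

Lemma eval_tsubst e f t : eval e (tsubst f t) = eval (fun x => eval e (f x)) t.
Proof. induction t; cbn; congruence. Qed.

Lemma eval_tshift v e t : eval (scons v e) (tshift t) = eval e t.
Proof. unfold tshift; now rewrite eval_tsubst. Qed.

Lemma sat_subst A : forall e r f g,
  sat e r (subst f g A) <-> sat (fun x => eval e (f x)) (fun X => r (g X)) A.
Proof.
  induction A; intros e r f g; cbn; rewrite ?eval_tsubst; try tauto.
  - now rewrite IHA1, IHA2.
  - split; intros H v; specialize (H v); rewrite IHA in *; revert H;
      replace (fun x => eval (scons v e) (up_num f x)) with (scons v (fun x => eval e (f x)));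
      auto; apply functional_extensionality; intros [|x]; cbn; auto;
      now rewrite eval_tshift.
  - split; intros H v; specialize (H v); rewrite IHA in *; revert H;
      replace (fun X => scons v r (up_set g X)) with (scons v (fun X => r (g X)));
      auto; apply functional_extensionality; intros [|x]; cbn; auto.
Qed.

Lemma sat_Or e r A B : sat e r (Or A B) <-> sat e r A \/ sat e r B.
Proof. cbn; tauto. Qed.
Lemma sat_Iff e r A B : sat e r (Iff A B) <-> (sat e r A <-> sat e r B).
Proof. cbn; tauto. Qed.
Lemma sat_ExN e r A : sat e r (ExN A) <-> exists v, sat (scons v e) r A.
Proof.
  cbn; split; [|intros [v h] k; exact (k v h)].
  intros h; apply NNPP; intros k; apply h; intros v h'; apply k; now exists v.
Qed.
Lemma sat_ExS e r A : sat e r (ExS A) <-> exists X, sat e (scons X r) A.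
Proof.
  cbn; split; [|intros [v h] k; exact (k v h)].
  intros h; apply NNPP; intros k; apply h; intros v h'; apply k; now exists v.
Qed.
End Satisfaction.

(** * The term model *)

Section TermModel.
Variable Ax : form -> Prop.
Hypothesis Ax_subst : forall f r A, Ax A -> Ax (subst f r A).
Variable A0 : form.
Hypothesis unprovable : ~ prv Ax nil A0.
Local Notation Th := (Th Ax A0).

Definition eqv s t := Th (Eq s t).

Lemma eqv_refl t : eqv t t. Proof. apply Th_Eq_refl. Qed.

Lemma eqv_leibniz A s t : eqv s t -> Th (inst_num s A) -> Th (inst_num t A).
Proof. apply Th_Eq_subst. Qed.

Lemma eqv_sym s t : eqv s t -> eqv t s.
Proof.
  intros h; pose proof (eqv_leibniz (Eq (Var 0) (tshift s)) s t h) as k; revert k.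
  unfold inst_num; cbn; rewrite !tsubst_scons_tshift, !tsubst_Var; intros k; apply k, eqv_refl.
Qed.

Lemma eqv_trans s t u : eqv s t -> eqv t u -> eqv s u.
Proof.
  intros h h'; pose proof (eqv_leibniz (Eq (tshift s) (Var 0)) t u h') as k; revert k.
  unfold inst_num; cbn; rewrite !tsubst_scons_tshift, !tsubst_Var; intros k; exact (k h).
Qed.

Lemma eqv_op (op : term -> term -> term) :
  (forall f s t, tsubst f (op s t) = op (tsubst f s) (tsubst f t)) ->
  forall s s' t t', eqv s s' -> eqv t t' -> eqv (op s t) (op s' t').
Proof.
  intros hop s s' t t' hs ht.
  pose proof (eqv_leibniz (Eq (tshift (op s t)) (op (Var 0) (tshift t))) s s' hs) as k.
  pose proof (eqv_leibniz (Eq (tshift (op s t)) (op (tshift s') (Var 0))) t t' ht) as k'.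
  revert k k'; unfold inst_num; cbn; rewrite !hop, !tsubst_scons_tshift, !tsubst_Var; cbn.
  intros k k'; apply k', k, eqv_refl.
Qed.

Lemma eqv_atom (C : term -> term -> form) :
  (forall f r s t, subst f r (C s t) = C (tsubst f s) (tsubst f t)) ->
  forall s s' t t', eqv s s' -> eqv t t' -> Th (C s t) -> Th (C s' t').
Proof.
  intros hop s s' t t' hs ht.
  pose proof (eqv_leibniz (C (Var 0) (tshift t)) s s' hs) as k.
  pose proof (eqv_leibniz (C (tshift s') (Var 0)) t t' ht) as k'.
  revert k k'; unfold inst_num; rewrite !hop, !tsubst_scons_tshift, !tsubst_Var; cbn; auto.
Qed.

Lemma eqv_In X s t : eqv s t -> Th (In s X) -> Th (In t X).
Proof. intros h; exact (eqv_leibniz (In (Var 0) X) s t h). Qed.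

(** Classes are represented by predicates, so that equality of numbers in the model is equality. *)
Definition class : Type := {c : term -> Prop | exists t, c = eqv t}.
Definition cls (t : term) : class := exist _ (eqv t) (ex_intro _ t eq_refl).
Definition rep (c : class) : term :=
  proj1_sig (constructive_indefinite_description _ (proj2_sig c)).

Lemma cls_eq s t : cls s = cls t <-> eqv s t.
Proof.
  split; [intros h|intros h].
  - assert (k : eqv s = eqv t) by exact (f_equal (@proj1_sig _ _) h).
    rewrite k; apply eqv_refl.
  - assert (k : eqv s = eqv t).
    { apply functional_extensionality; intros u; apply propositional_extensionality.
      split; intros h'; [eapply eqv_trans; [apply eqv_sym, h|assumption]|eapply eqv_trans; eauto]. }
    apply eq_sig_hprop; [intros; apply proof_irrelevance|exact k].
Qed.

Lemma cls_rep c : cls (rep c) = c.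
Proof.
  unfold rep; destruct constructive_indefinite_description as [t h]; cbn.
  destruct c as [c hc]; cbn in h; subst c; unfold cls; f_equal; apply proof_irrelevance.
Qed.

Lemma rep_cls t : eqv (rep (cls t)) t.
Proof. apply cls_eq, cls_rep. Qed.

Definition term_model : structure := {|
  carrier := class; points := nat;
  s_zero := cls Zero; s_one := cls One;
  s_plus := fun a b => cls (Plus (rep a) (rep b));
  s_times := fun a b => cls (Times (rep a) (rep b));
  s_lt := fun a b => Th (Lt (rep a) (rep b));
  s_mem := fun a X => Th (In (rep a) X) |}.

Lemma eval_term_model f t : eval term_model (fun x => cls (f x)) t = cls (tsubst f t).
Proof.
  induction t; cbn; auto; rewrite IHt1, IHt2; apply cls_eq;
    [apply (eqv_op Plus)|apply (eqv_op Times)]; auto using rep_cls.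
Qed.

(** Every environment is given by a substitution, as all numbers are classes of terms; this
    is what the induction on formulas needs at the quantifiers. *)
Lemma sat_term_model A : forall f r,
  sat term_model (fun x => cls (f x)) r A <-> Th (subst f r A).
Proof.
  induction A; intros f r; cbn [sat subst]; rewrite ?eval_term_model.
  - apply cls_eq.
  - cbn; split; apply (eqv_atom Lt); auto using rep_cls, eqv_sym.
  - cbn; split; apply eqv_In; auto using rep_cls, eqv_sym.
  - split; [easy|apply Th_Bot; auto].
  - rewrite IHA1, IHA2, Th_Imp; auto; tauto.
  - rewrite Th_AllN; auto; split; intros H t.
    + rewrite inst_num_up, <- IHA; specialize (H (cls t)).
      now rewrite scons_comp.
    + rewrite <- (cls_rep t), <- (scons_comp cls), IHA, <- inst_num_up; apply H.
  - rewrite Th_AllS; auto; split; intros H X.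
    + rewrite inst_set_up, <- IHA; apply H.
    + rewrite IHA, <- inst_set_up; apply H.
Qed.

Lemma term_model_axioms B : Ax B -> forall e r, sat term_model e r B.
Proof.
  intros h e r; replace e with (fun x => cls (rep (e x))).
  - apply sat_term_model; exists 0; apply prv_Ax; auto.
  - apply functional_extensionality; intros x; apply cls_rep.
Qed.

Lemma term_model_counterexample : ~ sat term_model (fun x => cls (Var x)) (fun X => X) A0.
Proof. rewrite sat_term_model, subst_id; apply Th_A0; auto. Qed.
End TermModel.

(** Closure under substitution is needed because the free variables of the axioms are read
    universally: an axiom must hold in the term model under all values of its variables. *)
Theorem completeness Ax A : (forall f r B, Ax B -> Ax (subst f r B)) ->
  (forall K, (forall B, Ax B -> forall e r, sat K e r B) -> inhabited (points K) -> forall e r, sat K e r A) ->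
  proves Ax A.
Proof.
  intros Ax_subst valid; apply NNPP; intros unprovable.
  apply (term_model_counterexample Ax Ax_subst A unprovable), valid.
  - now apply term_model_axioms.
  - exact (inhabits 0).
Qed.

(** * The axioms are closed under substitution *)

Lemma Sigma00_subst A : Sigma00 A -> forall f r, Sigma00 (subst f r A).
Proof.
  induction 1; intros f r; cbn [subst tsubst]; try (now constructor).
  replace (tsubst (up_num f) (tshift t)) with (tshift (tsubst f t)); [now constructor|].
  unfold tshift at 2; rewrite tsubst_tsubst; symmetry; apply tsubst_tshift.
Qed.

Lemma at_succ_subst f r A : subst (up_num f) r (at_succ A) = at_succ (subst (up_num f) r A).
Proof.
  unfold at_succ; rewrite !subst_subst; f_equal.
  apply functional_extensionality; intros [|x]; [reflexivity|].
  cbn; unfold up_num; cbn; now rewrite tsubst_scons_tshift.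
Qed.

Lemma induction_subst f r A : subst f r (induction A) = induction (subst (up_num f) r A).
Proof. unfold induction; cbn [subst]; now rewrite subst_inst_num, at_succ_subst. Qed.

Lemma comprehension_subst f r A B :
  subst f r (comprehension A B) = comprehension (subst (up_num f) r A) (subst (up_num f) r B).
Proof.
  unfold comprehension, Iff, ExS, And, Neg; cbn [subst]; now rewrite !subst_shift_set.
Qed.

Lemma RCA0_subst f r A : RCA0 A -> RCA0 (subst f r A).
Proof.
  intros [].
  1-8: cbn; try (now constructor).
  - rewrite induction_subst; apply Sigma01_induction; destruct H; constructor.
    now apply Sigma00_subst.
  - rewrite comprehension_subst; apply Delta01_comprehension; [destruct H|destruct H0];
      constructor; now apply Sigma00_subst.
Qed.

(** * Bounded formulas define the bounded definable relations *)

Definition mix {A : Type} (a b : nat -> A) (n : nat) : A :=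
  if Nat.even n then a (Nat.div2 n) else b (Nat.div2 n).

Lemma mix_even {A : Type} (a b : nat -> A) i : mix a b (2 * i) = a i.
Proof. unfold mix; now rewrite Nat.even_even, Nat.div2_double. Qed.

Lemma mix_odd {A : Type} (a b : nat -> A) i : mix a b (S (2 * i)) = b i.
Proof.
  unfold mix; rewrite Nat.div2_succ_double.
  now rewrite Nat.even_succ, <- Nat.negb_even, Nat.even_even.
Qed.

Lemma mix_comp {A B : Type} (h : A -> B) a b :
  (fun n => h (mix a b n)) = mix (fun i => h (a i)) (fun i => h (b i)).
Proof. apply functional_extensionality; intros n; unfold mix; now destruct (Nat.even n). Qed.

Lemma mix_evens {A : Type} (a b : nat -> A) : (fun i => mix a b (2 * i)) = a.
Proof. apply functional_extensionality; intros i; apply mix_even. Qed.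

Lemma mix_odds {A : Type} (a b : nat -> A) : (fun i => mix a b (S (2 * i))) = b.
Proof. apply functional_extensionality; intros i; apply mix_odd. Qed.

Section Realization.
Variable K : structure.
Local Notation env := (nat -> carrier K).
Local Notation Tm := (Models.Tm (s_plus K) (s_times K)).
Local Notation D0 := (Models.D0 (s_plus K) (s_times K) (s_lt K) (s_mem K)).

(** The environments interleave the variables with the parameters, and these renamings serve
    to join two lists of parameters. *)
Definition left_num : nat -> term := mix (fun i => Var (2 * i)) (fun i => Var (S (2 * (2 * i)))).
Definition right_num : nat -> term := mix (fun i => Var (2 * i)) (fun i => Var (S (2 * S (2 * i)))).

Lemma left_num_eval (e p q : env) : (fun x => eval K (mix e (mix p q)) (left_num x)) = mix e p.
Proof.
  unfold left_num; rewrite (mix_comp (eval K _)); cbn [eval]; f_equal.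
  - apply mix_evens.
  - apply functional_extensionality; intros i; now rewrite mix_odd, mix_even.
Qed.

Lemma right_num_eval (e p q : env) : (fun x => eval K (mix e (mix p q)) (right_num x)) = mix e q.
Proof.
  unfold right_num; rewrite (mix_comp (eval K _)); cbn [eval]; f_equal.
  - apply mix_evens.
  - apply functional_extensionality; intros i; now rewrite mix_odd, mix_odd.
Qed.

Definition left_form : form -> form := subst left_num (fun X => 2 * X).
Definition right_form : form -> form := subst right_num (fun X => S (2 * X)).

Lemma left_form_sat e p q r s A :
  sat K (mix e (mix p q)) (mix r s) (left_form A) <-> sat K (mix e p) r A.
Proof. unfold left_form; now rewrite sat_subst, left_num_eval, mix_evens. Qed.
Lemma right_form_sat e p q r s A :
  sat K (mix e (mix p q)) (mix r s) (right_form A) <-> sat K (mix e q) s A.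
Proof. unfold right_form; now rewrite sat_subst, right_num_eval, mix_odds. Qed.

Lemma Tm_term F : Tm F -> exists t p, forall e, F e = eval K (mix e p) t.
Proof.
  induction 1 as [n|c|s t _ (s' & p & hs) _ (t' & q & ht)|s t _ (s' & p & hs) _ (t' & q & ht)].
  - exists (Var (2 * n)), (fun _ => s_zero K); intros e; cbn [eval]; now rewrite mix_even.
  - exists (Var 1), (fun _ => c); intros e; reflexivity.
  - exists (Plus (tsubst left_num s') (tsubst right_num t')), (mix p q); intros e.
    cbn [eval]; now rewrite !eval_tsubst, left_num_eval, right_num_eval, hs, ht.
  - exists (Times (tsubst left_num s') (tsubst right_num t')), (mix p q); intros e.
    cbn [eval]; now rewrite !eval_tsubst, left_num_eval, right_num_eval, hs, ht.
Qed.

Variable X0 : points K.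

(** The extra point [X0] serves as the value of set variables that do not occur. *)
Lemma D0_form P : D0 P ->
  exists A p r, Sigma00 A /\ forall e, P e <-> sat K (mix e p) r A.
Proof.
  induction 1 as [s t hs ht|s t hs ht|s X hs| |P Q _ (A & p & r & hA & h) _ (B & q & s & hB & h')
    |t P ht _ (A & q & r & hA & h)|P Q PQ _ (A & p & r & hA & h)].
  - apply Tm_term in hs as (s' & p & hs), ht as (t' & q & ht).
    exists (Eq (tsubst left_num s') (tsubst right_num t')), (mix p q), (fun _ => X0).
    split; [constructor|intros e]; cbn [sat].
    now rewrite !eval_tsubst, left_num_eval, right_num_eval, hs, ht.
  - apply Tm_term in hs as (s' & p & hs), ht as (t' & q & ht).
    exists (Lt (tsubst left_num s') (tsubst right_num t')), (mix p q), (fun _ => X0).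
    split; [constructor|intros e]; cbn [sat].
    now rewrite !eval_tsubst, left_num_eval, right_num_eval, hs, ht.
  - apply Tm_term in hs as (s' & p & hs).
    exists (In s' 0), p, (fun _ => X); split; [constructor|intros e]; cbn [sat].
    now rewrite hs.
  - exists Bot, (fun _ => s_zero K), (fun _ => X0); split; [constructor|reflexivity].
  - exists (Imp (left_form A) (right_form B)), (mix p q), (mix r s); split.
    + constructor; now apply Sigma00_subst.
    + intros e; cbn [sat]; now rewrite left_form_sat, right_form_sat, h, h'.
  - apply Tm_term in ht as (t' & p & ht).
    set (g := mix (fun i => match i with 0 => Var 0 | S j => Var (S (2 * j)) end)
                  (fun i => Var (S (S (2 * S (2 * i)))))).
    exists (AllN (Imp (Lt (Var 0) (tshift (tsubst left_num t'))) (subst g (fun X => X) A))),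
      (mix p q), r; split; [constructor; now apply Sigma00_subst|].
    intros e; cbn [sat].
    assert (hb : forall v, P e v <-> sat K (scons v (mix e (mix p q))) r (subst g (fun X => X) A)).
    { intros v; rewrite sat_subst; specialize (h (scons v e)); cbn in h.
      rewrite h; unfold g; rewrite (mix_comp (eval K _)).
      match goal with |- sat K ?a _ _ <-> sat K ?b _ _ => replace b with a; [reflexivity|] end.
      f_equal; apply functional_extensionality.
      - intros [|i]; cbn [eval scons]; [reflexivity|now rewrite mix_even].
      - intros i; cbn [eval scons]; now rewrite !mix_odd. }
    split; intros H v; specialize (H v); cbn [eval scons] in *;
      rewrite eval_tshift, eval_tsubst, left_num_eval, <- ht, <- hb in *; exact H.
  - exists A, p, r; split; auto; intros e; now rewrite <- PQ.
Qed.

(** Binary relations, with the witness and the element as the first two variables. *)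
Lemma D0_form2 (P Q : carrier K -> carrier K -> Prop) :
  D0 (fun e => P (e 0) (e 1)) -> D0 (fun e => Q (e 0) (e 1)) ->
  exists A B p r, Sigma00 A /\ Sigma00 B /\
    (forall y x, sat K (scons y (scons x p)) r A <-> P y x) /\
    (forall y x, sat K (scons y (scons x p)) r B <-> Q y x).
Proof.
  intros hP hQ; apply D0_form in hP as (A & p & r & hA & h), hQ as (B & q & s & hB & h').
  set (g := mix (fun i => match i with 0 => Var 0 | _ => Var 1 end) (fun i => Var (S (S i)))).
  assert (hg : forall y x p', (fun n => eval K (scons y (scons x p')) (g n)) =
    mix (fun i => match i with 0 => y | _ => x end) p').
  { intros y x p'; unfold g; rewrite (mix_comp (eval K _)); f_equal.
    apply functional_extensionality; intros [|i]; reflexivity. }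
  exists (subst g (fun X => X) (left_form A)), (subst g (fun X => X) (right_form B)),
    (mix p q), (mix r s).
  split; [now do 2 apply Sigma00_subst|split; [now do 2 apply Sigma00_subst|split]];
    intros y x; rewrite sat_subst, hg, ?left_form_sat, ?right_form_sat; symmetry.
  - exact (h (fun i => match i with 0 => y | _ => x end)).
  - exact (h' (fun i => match i with 0 => y | _ => x end)).
Qed.

Hypothesis axioms : forall A, RCA0 A -> forall e r, sat K e r A.

Lemma K_induction : Models.sigma1_induction (s_zero K) (s_one K) (s_plus K) (s_times K) (s_lt K) (s_mem K).
Proof.
  intros P hP h0 hS.
  destruct (D0_form2 P P hP hP) as (A & _ & p & r & hA & _ & h & _).
  assert (hE : forall x, sat K (scons x p) r (ExN A) <-> exists y, P y x).
  { intros x; rewrite sat_ExN; split; intros [y hy]; exists y; now apply h. }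
  intros x; apply hE.
  pose proof (axioms _ (Sigma01_induction _ (S01_Ex _ hA)) p r) as ax.
  unfold induction in ax; cbn [sat] in ax; revert x; apply ax.
  - unfold inst_num; rewrite sat_subst, scons_comp; apply hE, h0.
  - intros x hx; unfold at_succ; rewrite sat_subst, scons_comp; cbn [eval scons].
    now apply hE, hS, hE.
Qed.

Lemma K_comprehension : Models.delta1_comprehension (s_plus K) (s_times K) (s_lt K) (s_mem K).
Proof.
  intros P Q hP hQ PQ.
  destruct (D0_form2 P Q hP hQ) as (A & B & p & r & hA & hB & h & h').
  assert (hE : forall x, sat K (scons x p) r (ExN A) <-> exists y, P y x).
  { intros x; rewrite sat_ExN; split; intros [y hy]; exists y; now apply h. }
  assert (hU : forall x, sat K (scons x p) r (AllN B) <-> forall y, Q y x).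
  { intros x; cbn [sat]; split; intros H y; now apply h'. }
  pose proof (axioms _ (Delta01_comprehension _ _ (S01_Ex _ hA) (P01_All _ hB)) p r) as ax.
  assert (hyp : sat K p r (AllN (Iff (ExN A) (AllN B)))).
  { intros x; apply sat_Iff; now rewrite hE, hU. }
  pose proof (ax hyp : sat K p r (ExS (AllN (Iff (In (Var 0) 0) (shift_set (ExN A)))))) as hX.
  apply sat_ExS in hX as [X hX].
  exists X; intros x; pose proof (hX x : sat K (scons x p) (scons X r) (Iff (In (Var 0) 0) (shift_set (ExN A)))) as hx.
  apply sat_Iff in hx.
  unfold shift_set in hx; rewrite sat_subst in hx.
  rewrite <- hE; exact hx.
Qed.
End Realization.

Definition structure_of (M : Models.model) : structure :=
  Structure (Models.num (Models.numbers M)) (Models.sets M) Models.nzero Models.none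
    (@Models.nadd _) (@Models.nmul _) (@Models.nlt _) (@Models.mem M).

Lemma model_of_axioms K : (forall A, RCA0 A -> forall e r, sat K e r A) ->
  inhabited (points K) -> exists M, K = structure_of M.
Proof.
  intros ax [X0].
  pose proof (K_induction K X0 ax) as ind; pose proof (K_comprehension K X0 ax) as comp.
  set (e := fun (x y : carrier K) (i : nat) => match i with 0 => x | _ => y end).
  pose (z := s_zero K).
  assert (a1 : forall x, s_plus K x (s_one K) <> s_zero K).
  { intros x; exact (ax _ (succ_neq_0 (Var 0)) (e x z) (fun _ => X0)). }
  assert (a2 : forall x y, s_plus K x (s_one K) = s_plus K y (s_one K) -> x = y).
  { intros x y; exact (ax _ (succ_inj (Var 0) (Var 1)) (e x y) (fun _ => X0)). }
  assert (a3 : forall x, s_plus K x (s_zero K) = x).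
  { intros x; exact (ax _ (plus_0 (Var 0)) (e x z) (fun _ => X0)). }
  assert (a4 : forall x y, s_plus K x (s_plus K y (s_one K)) = s_plus K (s_plus K x y) (s_one K)).
  { intros x y; exact (ax _ (plus_succ (Var 0) (Var 1)) (e x y) (fun _ => X0)). }
  assert (a5 : forall x, s_times K x (s_zero K) = s_zero K).
  { intros x; exact (ax _ (times_0 (Var 0)) (e x z) (fun _ => X0)). }
  assert (a6 : forall x y, s_times K x (s_plus K y (s_one K)) = s_plus K (s_times K x y) x).
  { intros x y; exact (ax _ (times_succ (Var 0) (Var 1)) (e x y) (fun _ => X0)). }
  assert (a7 : forall x, ~ s_lt K x (s_zero K)).
  { intros x; exact (ax _ (lt_0 (Var 0)) (e x z) (fun _ => X0)). }
  assert (a8 : forall x y, s_lt K x (s_plus K y (s_one K)) <-> s_lt K x y \/ x = y).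
  { intros x y; pose proof (ax _ (lt_succ (Var 0) (Var 1)) (e x y) (fun _ => X0)) as h.
    rewrite sat_Iff, sat_Or in h; exact h. }
  destruct K as [N S o i add mul lt mem]; cbn in *.
  exists (@Models.Model (Models.robinson_arith a1 a2 a3 a4 a5 a6 a7 a8 ind) S mem ind comp).
  reflexivity.
Qed.

(** * The statement read in a model *)

Section Interpretation.
Variable M : Models.model.
Local Notation K := (structure_of M).
Local Notation num := (Models.num (Models.numbers M)).

(** A world records how many quantifiers surround an expression, and the values of the
    variables there.  Open expressions must denote the same thing at all later worlds. *)
Record world := World { depth : nat; sdepth : nat; vals : nat -> num; svals : nat -> Models.sets M }.
Definition later (w v : world) : Prop :=
  (exists k, depth v = k + depth w /\ forall i, vals v (k + i) = vals w i) /\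
  (exists k, sdepth v = k + sdepth w /\ forall i, svals v (k + i) = svals w i).

Lemma later_refl w : later w w.
Proof. split; exists 0; auto. Qed.
Lemma later_trans u v w : later u v -> later v w -> later u w.
Proof.
  intros [(k & a & b) (k' & a' & b')] [(l & c & d) (l' & c' & d')]; split.
  - exists (l + k); split; [lia|intros i]; now rewrite <- b, <- d, Nat.add_assoc.
  - exists (l' + k'); split; [lia|intros i]; now rewrite <- b', <- d', Nat.add_assoc.
Qed.

Definition push_num (a : num) (w : world) := World (S (depth w)) (sdepth w) (scons a (vals w)) (svals w).
Definition push_set X (w : world) := World (depth w) (S (sdepth w)) (vals w) (scons X (svals w)).
Lemma later_num a w : later w (push_num a w).
Proof. split; [exists 1|exists 0]; auto. Qed.
Lemma later_set X w : later w (push_set X w).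
Proof. split; [exists 0|exists 1]; auto. Qed.

Definition denT (w : world) (s : oterm) (a : num) : Prop :=
  forall v, later w v -> eval K (vals v) (s (depth v)) = a.
Definition denS (w : world) (X : oset) (Y : Models.sets M) : Prop :=
  forall v, later w v -> svals v (X (sdepth v)) = Y.
Definition denF (w : world) (A : oform) (P : Prop) : Prop :=
  forall v, later w v -> sat K (vals v) (svals v) (A (depth v) (sdepth v)) <-> P.

Lemma denT_later w v s a : later w v -> denT w s a -> denT v s a.
Proof. intros l h u l'; apply h; eauto using later_trans. Qed.
Lemma denS_later w v X Y : later w v -> denS w X Y -> denS v X Y.
Proof. intros l h u l'; apply h; eauto using later_trans. Qed.

Lemma den_zero w : denT w o_zero Models.nzero. Proof. intros v _; reflexivity. Qed.
Lemma den_one w : denT w o_one Models.none. Proof. intros v _; reflexivity. Qed.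
Lemma den_plus w s t a b : denT w s a -> denT w t b -> denT w (o_plus s t) (Models.nadd a b).
Proof. intros h h' v l; cbn; now rewrite h, h'. Qed.
Lemma den_times w s t a b : denT w s a -> denT w t b -> denT w (o_times s t) (Models.nmul a b).
Proof. intros h h' v l; cbn; now rewrite h, h'. Qed.
Lemma den_pair w s t a b : denT w s a -> denT w t b -> denT w (pair s t) (Models.pr a b).
Proof. intros h h'; unfold pair, Models.pr; auto using den_plus, den_times. Qed.
Lemma den_eq w s t a b : denT w s a -> denT w t b -> denF w (o_eq s t) (a = b).
Proof. intros h h' v l; cbn; now rewrite h, h'. Qed.
Lemma den_lt w s t a b : denT w s a -> denT w t b -> denF w (o_lt s t) (Models.nlt a b).
Proof. intros h h' v l; cbn; now rewrite h, h'. Qed.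
Lemma den_in w s X a Y : denT w s a -> denS w X Y -> denF w (o_in s X) (Models.mem a Y).
Proof. intros h h' v l; cbn; now rewrite h, h'. Qed.
Lemma den_neg w A P : denF w A P -> denF w (o_neg A) (~ P).
Proof. intros h v l; specialize (h v l); cbn; tauto. Qed.
Lemma den_imp w A B P Q : denF w A P -> denF w B Q -> denF w (o_imp A B) (P -> Q).
Proof. intros h h' v l; specialize (h v l); specialize (h' v l); cbn; tauto. Qed.
Lemma den_and w A B P Q : denF w A P -> denF w B Q -> denF w (o_and A B) (P /\ Q).
Proof. intros h h' v l; specialize (h v l); specialize (h' v l); cbn; tauto. Qed.
Lemma den_or w A B P Q : denF w A P -> denF w B Q -> denF w (o_or A B) (P \/ Q).
Proof. intros h h' v l; specialize (h v l); specialize (h' v l); cbn; tauto. Qed.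
Lemma den_iff w A B P Q : denF w A P -> denF w B Q -> denF w (o_iff A B) (P <-> Q).
Proof. intros h h' v l; specialize (h v l); specialize (h' v l); cbn; tauto. Qed.
Lemma den_le w s t a b : denT w s a -> denT w t b ->
  denF w (o_or (o_lt s t) (o_eq s t)) (Models.nle a b).
Proof. intros h h'; apply den_or; [now apply den_lt|now apply den_eq]. Qed.

Lemma denT_bound a w : denT (push_num a w) (fun d => Var (d - S (depth w))) a.
Proof.
  intros v [(k & e & h) _]; cbn in *; rewrite e.
  replace (k + S (depth w) - S (depth w)) with (k + 0) by lia; apply h.
Qed.
Lemma denS_bound X w : denS (push_set X w) (fun d => d - S (sdepth w)) X.
Proof.
  intros v [_ (k & e & h)]; cbn in *; rewrite e.
  replace (k + S (sdepth w) - S (sdepth w)) with (k + 0) by lia; apply h.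
Qed.

Lemma den_all w A P : (forall v s a, later w v -> denT v s a -> denF v (A s) (P a)) ->
  denF w (o_all A) (forall a, P a).
Proof.
  intros h v l; unfold o_all; cbn [sat]; split; intros H a;
    apply (h (push_num a v) _ a (later_trans _ _ _ l (later_num a v)) (denT_bound a v) _ (later_refl _));
    apply H.
Qed.
Lemma den_ex w A P : (forall v s a, later w v -> denT v s a -> denF v (A s) (P a)) ->
  denF w (o_ex A) (exists a, P a).
Proof.
  intros h v l; unfold o_ex; rewrite sat_ExN; split; intros [a H]; exists a;
    apply (h (push_num a v) _ a (later_trans _ _ _ l (later_num a v)) (denT_bound a v) _ (later_refl _));
    apply H.
Qed.
Lemma den_allS w A P : (forall v X Y, later w v -> denS v X Y -> denF v (A X) (P Y)) ->
  denF w (o_allS A) (forall Y, P Y).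
Proof.
  intros h v l; unfold o_allS; cbn [sat]; split; intros H a;
    apply (h (push_set a v) _ a (later_trans _ _ _ l (later_set a v)) (denS_bound a v) _ (later_refl _));
    apply H.
Qed.
Lemma den_exS w A P : (forall v X Y, later w v -> denS v X Y -> denF v (A X) (P Y)) ->
  denF w (o_exS A) (exists Y, P Y).
Proof.
  intros h v l; unfold o_exS; rewrite sat_ExS; split; intros [a H]; exists a;
    apply (h (push_set a v) _ a (later_trans _ _ _ l (later_set a v)) (denS_bound a v) _ (later_refl _));
    apply H.
Qed.

(** Under a binder, what is known about the free expressions is carried to the later world. *)
Ltac den_bind := let l := fresh in let h := fresh in intros ? ? ? l h;
  repeat match goal with
  | H : denT ?w _ _, l : later ?w ?v |- _ => apply (denT_later _ _ _ _ l) in H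
  | H : denS ?w _ _, l : later ?w ?v |- _ => apply (denS_later _ _ _ _ l) in H
  end; clear l.
Ltac den_with tac := repeat first [ assumption | progress cbv beta | tac
  | apply den_le | apply den_pair
  | apply den_eq | apply den_lt | apply den_in | apply den_neg | apply den_and | apply den_or
  | apply den_iff | apply den_imp
  | apply den_zero | apply den_one | apply den_plus | apply den_times
  | apply den_all; den_bind | apply den_ex; den_bind
  | apply den_allS; den_bind | apply den_exS; den_bind ].
Ltac den := den_with fail.

(** The relation [denF] follows the structure of formulas, so a definition is interpreted by the
    relation that is written with the same connectives. *)
Lemma den_Rem w s t u a b c : denT w s a -> denT w t b -> denT w u c ->
  denF w (Rem s t u) (Models.Rem_ a b c).
Proof. intros; unfold Rem, Models.Rem_; den. Qed.
Lemma den_Len w s t a b : denT w s a -> denT w t b ->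
  denF w (Len s t) (Models.Len_ a b).
Proof. intros; unfold Len, Models.Len_; den. Qed.
Lemma den_Entry w s t u a b c : denT w s a -> denT w t b -> denT w u c ->
  denF w (Entry s t u) (Models.Entry_ a b c).
Proof.
  intros; unfold Entry, Models.Entry_;
  den_with ltac:(apply den_Rem).
Qed.
Lemma den_SameSeq w s t a b : denT w s a -> denT w t b ->
  denF w (SameSeq s t) (Models.SameSeq_ a b).
Proof.
  intros; unfold SameSeq, Models.SameSeq_;
  den_with ltac:(first [apply den_Len | apply den_Entry]).
Qed.
Lemma den_Seq w s a : denT w s a ->
  denF w (Seq s) (Models.Seq_ a).
Proof.
  intros; unfold Seq, Models.Seq_;
  den_with ltac:(first [apply den_Len | apply den_SameSeq]).
Qed.
Lemma den_Str w s a : denT w s a ->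
  denF w (Str s) (Models.Str_ a).
Proof.
  intros; unfold Str, Models.Str_;
  den_with ltac:(first [apply den_Seq | apply den_Entry]).
Qed.
Lemma den_Prefix w s t a b : denT w s a -> denT w t b ->
  denF w (Prefix s t) (Models.Prefix_ a b).
Proof.
  intros; unfold Prefix, Models.Prefix_;
  den_with ltac:(first [apply den_Str | apply den_Entry]).
Qed.
Lemma den_Incomparable w s t a b : denT w s a -> denT w t b ->
  denF w (Incomparable s t) (Models.Incomparable_ a b).
Proof.
  intros; unfold Incomparable, Models.Incomparable_;
  den_with ltac:(apply den_Prefix).
Qed.
Lemma den_Mem w s t a b : denT w s a -> denT w t b ->
  denF w (Mem s t) (Models.Mem_ a b).
Proof.
  intros; unfold Mem, Models.Mem_;
  den_with ltac:(apply den_Entry).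
Qed.
Lemma den_Pow2 w s t a b : denT w s a -> denT w t b ->
  denF w (Pow2 s t) (Models.Pow2_ a b).
Proof.
  intros; unfold Pow2, Models.Pow2_;
  den_with ltac:(apply den_Entry).
Qed.
Lemma den_WeightGt w s t u a b c : denT w s a -> denT w t b -> denT w u c ->
  denF w (WeightGt s t u) (Models.WeightGt_ a b c).
Proof.
  intros; unfold WeightGt, Models.WeightGt_;
  den_with ltac:(first [apply den_Pow2 | apply den_Entry | apply den_Len | apply den_Mem]).
Qed.
Lemma den_PrefixFree w s a : denT w s a ->
  denF w (PrefixFree s) (Models.PrefixFree_ a).
Proof.
  intros; unfold PrefixFree, Models.PrefixFree_;
  den_with ltac:(first [apply den_Mem | apply den_Prefix]).
Qed.
Lemma den_OpenCodes w X X' : denS w X X' ->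
  denF w (OpenCodes X) (Models.OpenCodes_ X').
Proof.
  intros; unfold OpenCodes, Models.OpenCodes_;
  den_with ltac:(apply den_Str).
Qed.
Lemma den_Restr w X s t X' a b : denS w X X' -> denT w s a -> denT w t b ->
  denF w (Restr X s t) (Models.Restr_ X' a b).
Proof.
  intros; unfold Restr, Models.Restr_;
  den_with ltac:(first [apply den_Str | apply den_Len | apply den_Entry]).
Qed.
Lemma den_InOpen w X Y s X' Y' a : denS w X X' -> denS w Y Y' -> denT w s a ->
  denF w (InOpen X Y s) (Models.InOpen_ X' Y' a).
Proof.
  intros; unfold InOpen, Models.InOpen_;
  den_with ltac:(apply den_Restr).
Qed.
Lemma den_InPi02 w X Y X' Y' : denS w X X' -> denS w Y Y' ->
  denF w (InPi02 X Y) (Models.InPi02_ X' Y').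
Proof.
  intros; unfold InPi02, Models.InPi02_;
  den_with ltac:(apply den_InOpen).
Qed.
Lemma den_InterMeasureGt w X s t u X' a b c : denS w X X' -> denT w s a -> denT w t b -> denT w u c ->
  denF w (InterMeasureGt X s t u) (Models.InterMeasureGt_ X' a b c).
Proof.
  intros; unfold Fun, Models.Fun_, FinSet, InterMeasureGt, Models.InterMeasureGt_;
  den_with ltac:(first [apply den_Str | apply den_Mem | apply den_PrefixFree | apply den_WeightGt | apply den_Prefix]).
Qed.
Lemma den_Positive w X X' : denS w X X' ->
  denF w (Positive X) (Models.Positive_ X').
Proof.
  intros; unfold Positive, Models.Positive_;
  den_with ltac:(apply den_InterMeasureGt).
Qed.
Lemma den_Tree w X X' : denS w X X' ->
  denF w (Tree X) (Models.Tree_ X').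
Proof.
  intros; unfold Tree, Models.Tree_;
  den_with ltac:(first [apply den_Str | apply den_Prefix]).
Qed.
Lemma den_Perfect w X X' : denS w X X' ->
  denF w (Perfect X) (Models.Perfect_ X').
Proof.
  intros; unfold Perfect, Models.Perfect_;
  den_with ltac:(first [apply den_Prefix | apply den_Incomparable]).
Qed.
Lemma den_Path w X Y X' Y' : denS w X X' -> denS w Y Y' ->
  denF w (Path X Y) (Models.Path_ X' Y').
Proof.
  intros; unfold Path, Models.Path_;
  den_with ltac:(apply den_Restr).
Qed.
Lemma den_ContainsPerfect w X X' : denS w X X' ->
  denF w (ContainsPerfect X) (Models.ContainsPerfect_ X').
Proof.
  intros; unfold ContainsPerfect, Models.ContainsPerfect_;
  den_with ltac:(first [apply den_Tree | apply den_Perfect | apply den_Path | apply den_InPi02]).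
Qed.
Lemma den_IsoToFull w X Y X' Y' : denS w X X' -> denS w Y Y' ->
  denF w (IsoToFull X Y) (Models.IsoToFull_ X' Y').
Proof.
  intros; unfold Fun, Models.Fun_, FinSet, IsoToFull, Models.IsoToFull_;
  den_with ltac:(first [apply den_Str | apply den_Prefix]).
Qed.
Lemma den_PerfectlyHomogeneous w X Y X' Y' : denS w X X' -> denS w Y Y' ->
  denF w (PerfectlyHomogeneous X Y) (Models.PerfectlyHomogeneous_ X' Y').
Proof.
  intros; unfold PerfectlyHomogeneous, Models.PerfectlyHomogeneous_;
  den_with ltac:(first [apply den_Str | apply den_IsoToFull]).
Qed.

Lemma den_statement w : denF w (PositivePi02HasPerfectSubset ==> TT1)%L2
  (Models.PositivePi02HasPerfectSubset_ M -> Models.TT1_ M).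
Proof.
  unfold PositivePi02HasPerfectSubset, Models.PositivePi02HasPerfectSubset_, TT1, Models.TT1_, Fun, Models.Fun_.
  den_with ltac:(first [apply den_OpenCodes | apply den_Positive | apply den_ContainsPerfect | apply den_Str | apply den_PerfectlyHomogeneous]).
Qed.

Lemma sat_statement e r : sat K e r (close (PositivePi02HasPerfectSubset ==> TT1)%L2).
Proof. apply (den_statement (World 0 0 e r) _ (later_refl _)), Models.model_TT1. Qed.
End Interpretation.

Theorem proposition3p1 :
  proves RCA0 (close (PositivePi02HasPerfectSubset ==> TT1)%L2).
Proof.
  apply completeness; [intros f r A; apply RCA0_subst|].
  intros K ax X0 e r; destruct (model_of_axioms K ax X0) as [M ->]; apply sat_statement.
Qed.
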